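(* Fix $0<q<1$, $\sigma>0$ and a constant $0<\epsilon<1$. Consider a sequence of problems indexed by $(k,n,p)$ with $p\to\infty$, $k/p\to0$ and $(k\log p)/n\to0$, with random designs $X\in\mathbb{R}^{n\times p}$ having i.i.d. $\mathcal{N}(0,1/n)$ entries. Let $\hat\beta_{\mathrm{SLOPE}}$ be the SLOPE estimate with weights $\lambda_i=\sigma(1+\epsilon)\Phi^{-1}(1-iq/(2p))$, $1\le i\le p$. Then $$\sup_{\|\beta\|_0\le k}\mathbb{P}\left(\frac{\|X\hat\beta_{\mathrm{SLOPE}}-X\beta\|^2}{2\sigma^2k\log(p/k)}>1+3\epsilon\right)\longrightarrow0.$$
   Context: $k,n,p$ are positive integers. We observe $(X,y)$ with $y=X\beta+z$, where $\beta\in\mathbb{R}^p$ is unknown and $z\sim\mathcal{N}(0,\sigma^2I_n)$ is independent of $X$. $\|\beta\|_0$ is the number of nonzero entries of $\beta$, $\|\cdot\|$ is the Euclidean norm, and $\Phi$ is the standard normal cumulative distribution function. Given weights $\lambda_1\ge\lambda_2\ge\cdots\ge\lambda_p\ge0$, not all zero, the SLOPE estimate is the solution (minimizer) of $$\min_{b\in\mathbb{R}^p}\ \tfrac12\|y-Xb\|^2+\lambda_1|b|_{(1)}+\cdots+\lambda_p|b|_{(p)},$$ where $|b|_{(1)}\ge\cdots\ge|b|_{(p)}$ are the order statistics of $|b_1|,\dots,|b_p|$. The supremum is over all $\beta\in\mathbb{R}^p$ with at most $k$ nonzero entries. *)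

(* Defs.v *)
From HB Require Import structures.
From mathcomp Require Import all_boot all_order all_algebra.
From mathcomp Require Import all_classical all_reals all_analysis.

Set Implicit Arguments.
Unset Strict Implicit.
Unset Printing Implicit Defensive.

Import Order.TTheory GRing.Theory Num.Theory.
Import numFieldNormedType.Exports.

Local Open Scope classical_set_scope.
Local Open Scope ring_scope.

Section Probability.
Context d (T : measurableType d) (R : realType) (P : probability T R).

(* Product rule over every subfamily J of a finite family. *)
Definition mutually_independent (I : finType) (Y : I -> {RV P >-> R}) : Prop :=
  forall (J : {set I}) (B : I -> set R), (forall i, measurable (B i)) ->
    P (\bigcap_(i in [set i | i \in J]) (Y i @^-1` B i)) =
    (\prod_(i in J) P (Y i @^-1` B i))%E.

(* The second parameter s is the standard deviation, as in normal_prob. *)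
Definition iid_normal (I : finType) (mu s : R) (Y : I -> {RV P >-> R}) : Prop :=
  mutually_independent Y /\
  forall i (B : set R), measurable B ->
    distribution P (Y i) B = normal_prob mu s B.

Definition sigma_of (I : finType) (Y : I -> {RV P >-> R}) : set (set T) :=
  <<s \bigcup_i preimage_set_system setT (Y i) measurable >>.

Definition independent_families (I K : finType)
    (Y : I -> {RV P >-> R}) (Z : K -> {RV P >-> R}) : Prop :=
  forall A B, sigma_of Y A -> sigma_of Z B -> P (A `&` B) = (P A * P B)%E.

End Probability.

Section Slope.
Context {R : realType}.

(* The library norm `|v| on matrices is the sup norm. *)
Definition enorm (n : nat) (v : 'cV[R]_n) : R :=
  Num.sqrt (\sum_(i < n) v i ord0 ^+ 2).

Definition l0 (p : nat) (b : 'cV[R]_p) : nat :=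
  #|[set i : 'I_p | b i ord0 != 0]%SET|.

Definition Phi (x : R) : R := fine (normal_prob (0 : R) 1 `]-oo, x]).

Definition Phi_inv : R -> R := pinv [set: R] Phi.

(* order_stats b is |b|_(1) >= ... >= |b|_(p), with |b|_(i) at position i-1. *)
Definition order_stats (p : nat) (b : 'cV[R]_p) : seq R :=
  sort >=%R [seq `|b i ord0| | i <- enum 'I_p].

(* Weights are numbered from 1: lam 1, ..., lam p. *)
Definition slope_objective (n p : nat) (lam : nat -> R)
    (X : 'M[R]_(n, p)) (y : 'cV[R]_n) (b : 'cV[R]_p) : R :=
  2^-1 * enorm (y - X *m b) ^+ 2
  + \sum_(1 <= i < p.+1) lam i * (order_stats b)`_i.-1.

Definition is_slope_estimate (n p : nat) (lam : nat -> R)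
    (X : 'M[R]_(n, p)) (y : 'cV[R]_n) (b : 'cV[R]_p) : Prop :=
  forall b' : 'cV[R]_p,
    slope_objective lam X y b <= slope_objective lam X y b'.

Definition slope_weight (sigma eps q : R) (p i : nat) : R :=
  sigma * (1 + eps) * Phi_inv (1 - i%:R * q / (2 * p%:R)).

Definition design (d : measure_display) (T : measurableType d)
    (P : probability T R) (n p : nat) (X : 'I_n * 'I_p -> {RV P >-> R})
    (w : T) : 'M[R]_(n, p) := \matrix_(i, j) X (i, j) w.

Definition noise (d : measure_display) (T : measurableType d)
    (P : probability T R) (n : nat) (z : 'I_n -> {RV P >-> R})
    (w : T) : 'cV[R]_n := \col_i z i w.

End Slope.

(* Main.v *)
Require Import Defs.
From HB Require Import structures.
From mathcomp Require Import all_boot all_order all_algebra.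
From mathcomp Require Import all_classical all_reals all_analysis.
From mathcomp Require Import measurable_realfun ring lra.

Set Implicit Arguments.
Unset Strict Implicit.
Unset Printing Implicit Defensive.
Import Order.TTheory GRing.Theory Num.Theory.
Import numFieldNormedType.Exports.

Local Open Scope classical_set_scope.
Local Open Scope ring_scope.

(** The risk of SLOPE is compared with that of an oracle. Let A be the design, S the
    support of beta, J the SLOPE penalty and D^2 = 2 sigma^2 k ln (p / k). The oracle
    bt minimizes the SLOPE objective in which the columns outside S are erased.

    Risk of the oracle. Let h = bt - beta, a vector supported on S. Optimality of bt
    gives |A h|^2 <= <z, A h> + J h. By Cauchy-Schwarz, J h is at most |h| times the
    Euclidean norm of the k largest weights, and this norm is at most
    (1 + eps) (1 + o(1)) D: the squared quantile of order i is at most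
    2 ln (2 p / (i q)), and k! >= (k / e)^k ([sum_quantile_sqr]). The noise term is of
    order sqrt k |h|, which is o(D) |h|. As A is nearly isometric on sparse vectors
    ([rip_prob]), |A h| <= (1 + eps) (1 + o(1)) D ([oracle_error]).

    Cost of ignoring S. The residual w of the oracle depends only on z and on the columns
    in S. Hence, given w, its correlations with the other columns are independent centred
    Gaussian variables; outside a rare event their standard deviation is at most
    sigma (1 + eps / 3), below the factor sigma (1 + eps) of the weights. Sort them
    by size. By Chernoff's bound the r-th one stays below the weight of order
    #|S| + r, with a margin c > 0, for all r >= L k; and the first L k ones exceed
    their weights by amounts whose sum of squares is o(k) ([residual_event]). The
    penalty therefore absorbs the correlations, and bhat differs from bt by a vector
    whose image under A is o(D) ([correction_error]; restricted isometry is used on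
    vectors that are not sparse but have small l1 norm, [cone_lower]).

    Together |A bhat - A beta| <= (1 + eps) (1 + o(1)) D ([deterministic_bound]), and
    (1 + eps)^2 < 1 + 3 eps because eps < 1. All bounds are uniform over beta
    ([uniform_risk]), so that the supremum tends to 0. There are two
    measure-theoretic points: conditioning on w is expressed by decoupling, an integral
    over two independent copies of the sample ([decouple_groups]), and the fitted
    values are proved measurable as derivatives of the optimal value
    ([fit_measurable]). *)

(** * Euclidean norm and restriction to coordinates *)

Section Euclid.
Context {R : realType}.

Lemma sqr_abs (x : R) : `|x| ^+ 2 = x ^+ 2.
Proof. by rewrite real_normK ?num_real. Qed.

Definition dot n (u v : 'cV[R]_n) : R := \sum_i u i ord0 * v i ord0.

Lemma dotC n (u v : 'cV[R]_n) : dot u v = dot v u.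
Proof. by apply: eq_bigr => i _; rewrite mulrC. Qed.

Lemma dotDr n (u v w : 'cV[R]_n) : dot u (v + w) = dot u v + dot u w.
Proof. by rewrite -big_split; apply: eq_bigr => i _; rewrite mxE mulrDr. Qed.

Lemma dotDl n (u v w : 'cV[R]_n) : dot (v + w) u = dot v u + dot w u.
Proof. by rewrite !(dotC _ u) dotDr. Qed.

Lemma dotZr n a (u v : 'cV[R]_n) : dot u (a *: v) = a * dot u v.
Proof. by rewrite mulr_sumr; apply: eq_bigr => i _; rewrite mxE mulrCA. Qed.

Lemma dotZl n a (u v : 'cV[R]_n) : dot (a *: u) v = a * dot u v.
Proof. by rewrite dotC dotZr dotC. Qed.

Lemma dotNr n (u v : 'cV[R]_n) : dot u (- v) = - dot u v.
Proof. by rewrite -scaleN1r dotZr mulN1r. Qed.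

Lemma dotNl n (u v : 'cV[R]_n) : dot (- u) v = - dot u v.
Proof. by rewrite dotC dotNr dotC. Qed.

Lemma dotBr n (u v w : 'cV[R]_n) : dot u (v - w) = dot u v - dot u w.
Proof. by rewrite dotDr dotNr. Qed.

Lemma dotBl n (u v w : 'cV[R]_n) : dot (v - w) u = dot v u - dot w u.
Proof. by rewrite dotDl dotNl. Qed.

Lemma dot_subZ n t (r u : 'cV[R]_n) :
  dot (r - t *: u) (r - t *: u) =
  dot r r - 2 * t * dot r u + t ^+ 2 * dot u u.
Proof. rewrite dotBl !dotBr !dotZl !dotZr (dotC u r); ring. Qed.

Lemma dot_ge0 n (u : 'cV[R]_n) : 0 <= dot u u.
Proof. by apply: sumr_ge0 => i _; rewrite -expr2 sqr_ge0. Qed.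

Lemma enorm_sqr n (u : 'cV[R]_n) : enorm u ^+ 2 = dot u u.
Proof.
rewrite sqr_sqrtr; last by apply: sumr_ge0 => i _; rewrite sqr_ge0.
by apply: eq_bigr => i _; rewrite expr2.
Qed.

Lemma enorm_ge0 n (u : 'cV[R]_n) : 0 <= enorm u.
Proof. exact: sqrtr_ge0. Qed.

Lemma enormE n (u : 'cV[R]_n) : enorm u = Num.sqrt (dot u u).
Proof. by rewrite -enorm_sqr sqrtr_sqr ger0_norm ?enorm_ge0. Qed.

Lemma dot_le n (u v : 'cV[R]_n) : dot u v <= enorm u * enorm v.
Proof.
have [v0|vN0] := eqVneq (dot v v) 0.
  have vi0 i : v i ord0 = 0.
    apply/eqP; rewrite -sqrf_eq0 expr2; apply/eqP.
    move/eqP: v0; rewrite psumr_eq0 => [/allP/(_ i)|j _]; last first.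
      by rewrite -expr2 sqr_ge0.
    by rewrite mem_index_enum => /(_ isT)/eqP.
  rewrite /dot big1 ?mulr_ge0 ?enorm_ge0// => i _.
  by rewrite vi0 mulr0.
have vpos : 0 < dot v v by rewrite lt_neqAle eq_sym vN0 dot_ge0.
rewrite (le_trans (ler_norm _))// -ler_sqr ?nnegrE ?mulr_ge0 ?enorm_ge0//.
rewrite sqr_abs exprMn !enorm_sqr.
have := dot_ge0 (u - (dot u v / dot v v) *: v).
rewrite dotBr !dotBl !dotZr !dotZl (dotC v u).
rewrite divfK// subrr subr0 subr_ge0 => h.
have : dot u v / dot v v * dot u v * dot v v <= dot u u * dot v v.
  by rewrite ler_pM2r.
by rewrite mulrAC divfK// expr2.
Qed.

Lemma dot_ge n (u v : 'cV[R]_n) : - (enorm u * enorm v) <= dot u v.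
Proof.
rewrite lerNl -dotNr (le_trans (dot_le _ _))//.
by rewrite [enorm (- v)]enormE dotNl dotNr opprK -enormE.
Qed.

Lemma enormN n (u : 'cV[R]_n) : enorm (- u) = enorm u.
Proof. by rewrite !enormE dotNl dotNr opprK. Qed.

Lemma enorm0 n : enorm (0 : 'cV[R]_n) = 0.
Proof. by rewrite enormE /dot big1 ?sqrtr0// => i _; rewrite mxE mul0r. Qed.

Lemma enormZ n a (u : 'cV[R]_n) : enorm (a *: u) = `|a| * enorm u.
Proof.
by rewrite !enormE dotZl dotZr mulrA -expr2 sqrtrM ?sqr_ge0// sqrtr_sqr.
Qed.

Lemma enormD n (u v : 'cV[R]_n) : enorm (u + v) <= enorm u + enorm v.
Proof.
rewrite -ler_sqr ?nnegrE ?addr_ge0 ?enorm_ge0// enorm_sqr sqrrD !enorm_sqr.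
rewrite dotDl !dotDr (dotC v u) -addrA -[leRHS]addrA lerD2l addrA lerD2r.
by rewrite -mulr2n lerMn2r dot_le orbT.
Qed.

Lemma enormB n (u v : 'cV[R]_n) : enorm (u - v) <= enorm u + enorm v.
Proof. by rewrite (le_trans (enormD _ _))// enormN. Qed.

Lemma enorm_eq0 n (u : 'cV[R]_n) : enorm u = 0 -> u = 0.
Proof.
move=> /eqP; rewrite -sqrf_eq0 enorm_sqr psumr_eq0; last first.
  by move=> i _; rewrite -expr2 sqr_ge0.
move=> /allP h; apply/colP => i; rewrite mxE; apply/eqP.
by have := h i; rewrite mem_index_enum -expr2 sqrf_eq0 => /(_ isT).
Qed.

Lemma enorm_sum n (I : Type) (r : seq I) (Q : pred I) (F : I -> 'cV[R]_n) :
  enorm (\sum_(i <- r | Q i) F i) <= \sum_(i <- r | Q i) enorm (F i).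
Proof.
elim/big_rec2: _ => [|i x y _ h]; first by rewrite enorm0.
by rewrite (le_trans (enormD _ _))// lerD2l.
Qed.

Lemma coord_le_enorm n (u : 'cV[R]_n) i : `|u i ord0| <= enorm u.
Proof.
rewrite -ler_sqr ?nnegrE ?enorm_ge0// sqr_abs enorm_sqr /dot (bigD1 i)//=.
by rewrite -expr2 lerDl sumr_ge0// => j _; rewrite -expr2 sqr_ge0.
Qed.

(** Cauchy-Schwarz for sums restricted to a predicate, obtained from [dot_le]
    by setting to 0 the entries outside the predicate. *)
Lemma sum_mul_le (I : finType) (Q : pred I) (f g : I -> R) :
  \sum_(i | Q i) f i * g i <=
  Num.sqrt (\sum_(i | Q i) f i ^+ 2) * Num.sqrt (\sum_(i | Q i) g i ^+ 2).
Proof.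
pose F h : 'cV[R]_#|I| :=
  \col_i (if Q (enum_val i) then h (enum_val i) else 0).
have E (h1 h2 : I -> R) :
    \sum_(i | Q i) h1 i * h2 i = dot (F h1) (F h2).
  rewrite /dot (reindex (@enum_val I predT))/=; last first.
    by exists enum_rank => i _; [exact: enum_valK | exact: enum_rankK].
  rewrite big_mkcond/=; apply: eq_bigr => i _; rewrite !mxE.
  by case: ifP => //; rewrite mul0r.
rewrite E (le_trans (dot_le _ _))// !enormE -!E.
by under eq_bigr do rewrite -expr2;
   under [X in _ * Num.sqrt X <= _]eq_bigr do rewrite -expr2.
Qed.

Definition restr p (S : {set 'I_p}) (b : 'cV[R]_p) : 'cV[R]_p :=
  \col_i (if i \in S then b i ord0 else 0).

(** Zeroing columns rather than deleting them keeps all fits in the same space. *)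
Definition restrcol n p (S : {set 'I_p}) (A : 'M[R]_(n, p)) : 'M[R]_(n, p) :=
  \matrix_(i, j) (if j \in S then A i j else 0).

Definition supp p (b : 'cV[R]_p) : {set 'I_p} := [set i | b i ord0 != 0]%SET.

Lemma restrcolM n p S (A : 'M[R]_(n, p)) b : restrcol S A *m b = A *m restr S b.
Proof.
apply/colP => i; rewrite !mxE; apply: eq_bigr => j _; rewrite !mxE.
by case: ifP; rewrite ?mul0r ?mulr0.
Qed.

Lemma restrD p S (b c : 'cV[R]_p) : restr S (b + c) = restr S b + restr S c.
Proof. by apply/colP => i; rewrite !mxE; case: ifP; rewrite ?addr0. Qed.

Lemma restrN p S (b : 'cV[R]_p) : restr S (- b) = - restr S b.
Proof. by apply/colP => i; rewrite !mxE; case: ifP; rewrite ?oppr0. Qed.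

Lemma restr_restr p S (b : 'cV[R]_p) : restr S (restr S b) = restr S b.
Proof. by apply/colP => i; rewrite !mxE; case: (i \in S). Qed.

Lemma restrDC p S (b : 'cV[R]_p) : restr S b + restr (~: S)%SET b = b.
Proof.
by apply/colP => i; rewrite !mxE inE; case: ifP; rewrite ?addr0 ?add0r.
Qed.

Lemma restr_supp p (S : {set 'I_p}) (b : 'cV[R]_p) : supp b \subset S -> restr S b = b.
Proof.
move=> /fintype.subsetP h; apply/colP => i; rewrite !mxE; case: ifPn => // iS.
by apply/esym/eqP; apply: contraNT iS => bi; apply: h; rewrite inE.
Qed.

Lemma supp_restr p (S : {set 'I_p}) (b : 'cV[R]_p) : supp (restr S b) \subset S.
Proof.
by apply/fintype.subsetP => i; rewrite inE mxE; case: ifP => //; rewrite eqxx.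
Qed.

End Euclid.

(** * The sorted l1 penalty *)

Section SortedL1.
Context {R : realType}.
Implicit Types (lam : nat -> R) (s : seq R).

(** The recursion shifts the weights, which suits inductions on [s]; the weights
    are numbered from 0 here and from 1 in the SLOPE penalty. *)
Fixpoint wsum lam s : R :=
  if s is x :: s' then lam 0%N * x + wsum (lam \o succn) s' else 0.

Lemma wsum_cat lam s1 s2 :
  wsum lam (s1 ++ s2) = wsum lam s1 + wsum (fun i => lam (size s1 + i)%N) s2.
Proof.
by elim: s1 lam => [|x s IH] lam/=; rewrite ?add0r// IH addrA.
Qed.

Lemma wsumE lam s : wsum lam s = \sum_(0 <= i < size s) lam i * s`_i.
Proof.
elim: s lam => [|x s IH] lam /=; first by rewrite big_nil.
by rewrite big_nat_recl//= IH.
Qed.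

Definition noninc lam n := forall i j, (i <= j < n)%N -> lam j <= lam i.

(** One step of the rearrangement inequality: the entry x overtakes smaller
    entries, each of which moves to a smaller weight. *)
Lemma wsum_front lam x s1 s2 :
  noninc lam (size s1).+1 -> {in s1, forall y, y <= x} ->
  wsum lam (s1 ++ x :: s2) <= wsum lam (x :: s1 ++ s2).
Proof.
elim: s1 lam => [|y s1 IH] lam//= dec ymax.
have := IH (lam \o succn); rewrite /= => /(_ _ _)/wrap[].
- by move=> i j ij; apply: dec; rewrite !ltnS.
- by move=> z zs; apply: ymax; rewrite inE zs orbT.
move=> h; have yx : y <= x by apply: ymax; rewrite mem_head.
have l01 : lam 1%N <= lam 0%N by apply: dec.
rewrite -(lerD2l (lam 0%N * y)) in h; apply: (le_trans h).
rewrite !addrA lerD2r; nra.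
Qed.

(** Rearrangement inequality: among all orderings of the same entries, the
    nonincreasing one maximizes a weighted sum with nonincreasing weights. It
    makes the SLOPE penalty a maximum of weighted l1 norms over permutations,
    hence convex, and gives lower bounds on it by any convenient ordering. *)
Lemma rearrangement lam s s' : noninc lam (size s) ->
  sorted >=%R s -> perm_eq s s' -> wsum lam s' <= wsum lam s.
Proof.
elim: s lam s' => [|x s IH] lam s' dec srt peq.
  by move: peq; rewrite perm_sym => /perm_nilP ->.
have xs' : x \in s' by rewrite -(perm_mem peq) mem_head.
case/splitPr: xs' peq => s1 s2 peq.
have pss : perm_eq s (s1 ++ s2).
  rewrite -(perm_cons x) (permPl peq) -cat1s perm_catCA; exact: perm_refl.
have smax : {in s1, forall y, y <= x}.
  move=> y ys1; have: y \in s by rewrite (perm_mem pss) mem_cat ys1.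
  move: srt; rewrite /= path_sortedE; last by move=> a b c /= ab bc; exact: le_trans bc ab.
  by case/andP => /allP h _ /h.
apply: (@le_trans _ _ (wsum lam (x :: s1 ++ s2))).
  apply: wsum_front => // i j /andP[ij js]; apply: dec; rewrite ij/=.
  by rewrite (leq_trans js)// ltnS (perm_size pss) size_cat leq_addr.
rewrite /= lerD2l; apply: IH => //.
- by move=> i j ij; apply: dec; rewrite !ltnS.
- exact: path_sorted srt.
Qed.

(** The SLOPE penalty. *)
Definition J p lam (b : 'cV[R]_p) : R :=
  \sum_(1 <= i < p.+1) lam i * (order_stats b)`_i.-1.

Lemma JE p lam (b : 'cV[R]_p) : J lam b = wsum (lam \o succn) (order_stats b).
Proof.
rewrite wsumE /J big_add1/=.
by rewrite size_sort size_map size_enum_ord.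
Qed.

Lemma slope_objectiveE n p lam (A : 'M[R]_(n, p)) y b :
  slope_objective lam A y b = 2^-1 * enorm (y - A *m b) ^+ 2 + J lam b.
Proof. by []. Qed.

Lemma order_stats_sorted p (b : 'cV[R]_p) : sorted >=%R (order_stats b).
Proof. by apply: sort_sorted => x y; exact: (le_total y x). Qed.

Variables (p : nat) (lam : nat -> R).
Hypothesis dec : noninc (lam \o succn) p.

Lemma J_ge (b : 'cV[R]_p) (s : seq 'I_p) : perm_eq s (enum 'I_p) ->
  wsum (lam \o succn) [seq `|b j ord0| | j <- s] <= J lam b.
Proof.
move=> peq; rewrite JE; apply: rearrangement.
- by rewrite size_sort size_map size_enum_ord.
- exact: order_stats_sorted.
- rewrite /order_stats perm_sort perm_map// perm_sym//.
Qed.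

Lemma J_eq (b : 'cV[R]_p) (s : seq 'I_p) : perm_eq s (enum 'I_p) ->
  sorted >=%R [seq `|b j ord0| | j <- s] ->
  J lam b = wsum (lam \o succn) [seq `|b j ord0| | j <- s].
Proof.
move=> peq srt; rewrite JE; congr wsum.
apply: (@sorted_eq _ >=%R) => //.
- by move=> x y z /= xy yz; exact: le_trans yz xy.
- by move=> x y /=; rewrite andbC => /le_anti.
- exact: order_stats_sorted.
- by rewrite /order_stats perm_sort perm_map// perm_sym.
Qed.

Lemma J_ex (b : 'cV[R]_p) : exists2 s : seq 'I_p, perm_eq s (enum 'I_p) &
  J lam b = wsum (lam \o succn) [seq `|b j ord0| | j <- s].
Proof.
exists (sort (fun i j => `|b i ord0| >= `|b j ord0|) (enum 'I_p)).
  by rewrite perm_sort.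
apply: J_eq; first by rewrite perm_sort.
rewrite sorted_map; apply: sort_sorted => i j /=.
exact: le_total.
Qed.

Hypothesis lam_ge0 : forall i, (i < p)%N -> 0 <= lam i.+1.

Lemma wsum_le (f g : 'I_p -> R) (s : seq 'I_p) : (size s <= p)%N ->
  (forall j, f j <= g j) ->
  wsum (lam \o succn) (map f s) <= wsum (lam \o succn) (map g s).
Proof.
move=> sp fg; rewrite !wsumE !size_map; apply: ler_sum_nat => i /= i_s.
case: s sp i_s => // x s sp i_s.
rewrite !(nth_map x)//; apply: ler_wpM2l => //=.
by rewrite lam_ge0// (leq_trans i_s).
Qed.

Lemma wsumD (l : nat -> R) (f g : 'I_p -> R) (s : seq 'I_p) :
  wsum l (map (fun j => f j + g j) s) = wsum l (map f s) + wsum l (map g s).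
Proof. by elim: s l => [|x s IH] l/=; rewrite ?addr0// IH; ring. Qed.

Lemma wsumZ (l : nat -> R) a (f : 'I_p -> R) (s : seq 'I_p) :
  wsum l (map (fun j => a * f j) s) = a * wsum l (map f s).
Proof. by elim: s l => [|x s IH] l/=; rewrite ?mulr0// IH; ring. Qed.

Lemma size_perm_ord (s : seq 'I_p) : perm_eq s (enum 'I_p) -> size s = p.
Proof. by move=> /perm_size ->; rewrite size_enum_ord. Qed.

(** Homogeneity and the triangle inequality in one statement: with the ordering
    that is optimal for the combination, both terms are bounded by [J_ge]. *)
Lemma JD_scaled a c (b d : 'cV[R]_p) : 0 <= a -> 0 <= c ->
  J lam (a *: b + c *: d) <= a * J lam b + c * J lam d.
Proof.
move=> a0 c0; have [s ps ->] := J_ex (a *: b + c *: d).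
apply: (@le_trans _ _ (wsum (lam \o succn)
  [seq a * `|b j ord0| + c * `|d j ord0| | j <- s])).
  apply: wsum_le; first by rewrite (size_perm_ord ps).
  move=> j; rewrite !mxE (le_trans (ler_normD _ _))// !normrM.
  by rewrite (ger0_norm a0) (ger0_norm c0).
rewrite (wsumD _ (fun j => a * `|b j ord0|)) !wsumZ.
by apply: lerD; rewrite ler_wpM2l// J_ge.
Qed.

Lemma JD (b d : 'cV[R]_p) : J lam (b + d) <= J lam b + J lam d.
Proof. by have := @JD_scaled 1 1 b d ler01 ler01; rewrite !scale1r !mul1r. Qed.

Lemma JN (b : 'cV[R]_p) : J lam (- b) = J lam b.
Proof.
rewrite !JE; congr (wsum _ (sort _ _)).
by apply: eq_map => j; rewrite mxE normrN.
Qed.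

Lemma J_mono (b d : 'cV[R]_p) :
  (forall j, `|b j ord0| <= `|d j ord0|) -> J lam b <= J lam d.
Proof.
move=> bd; have [s ps ->] := J_ex b.
apply: le_trans (J_ge d ps).
by apply: wsum_le => //; rewrite (size_perm_ord ps).
Qed.

Lemma J_restr S (b : 'cV[R]_p) : J lam (restr S b) <= J lam b.
Proof. by apply: J_mono => j; rewrite mxE; case: ifP => // _; rewrite normr0. Qed.

(** First-order optimality without subgradients: compare b with b + t d, bound
    the penalty by convexity, divide by t and let t tend to 0. *)
Lemma slope_vi n (A : 'M[R]_(n, p)) y b : is_slope_estimate lam A y b ->
  forall d, dot (y - A *m b) (A *m d) <= J lam (b + d) - J lam b.
Proof.
move=> bmin d; apply/ler_addgt0Pr => e e0.
set r := y - A *m b; set u := A *m d.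
have key t : 0 < t -> t <= 1 ->
    dot r u <= J lam (b + d) - J lam b + t * (2^-1 * dot u u).
  move=> t0 t1; have := bmin (b + t *: d); rewrite !slope_objectiveE.
  have -> : y - A *m (b + t *: d) = r - t *: u.
    by rewrite mulmxDr -scalemxAr /r/u opprD addrA.
  rewrite !enorm_sqr -/r dot_subZ.
  have -> : b + t *: d = (1 - t) *: b + t *: (b + d).
    by rewrite scalerBl scalerDr scale1r addrA subrK.
  have := @JD_scaled (1 - t) t b (b + d); rewrite subr_ge0 => /(_ t1 (ltW t0)).
  move=> h1 h2; rewrite -(ler_pM2l t0); nra.
have u0 := dot_ge0 u.
have t0 : 0 < e / (e + dot u u) by rewrite divr_gt0// ltr_wpDr.
apply: le_trans (key _ t0 _) _.
  by rewrite ler_pdivrMr ?ltr_wpDr// mul1r lerDl.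
rewrite lerD2l mulrAC ler_pdivrMr ?ltr_wpDr// ler_wpM2l ?(ltW e0)//; lra.
Qed.

End SortedL1.

(** * Comparison of SLOPE with an oracle *)

Section Lists.
Context {R : realType}.

(** Cauchy-Schwarz between the weights and the entries. *)
Lemma wsum_CS (l : nat -> R) (I : eqType) (f : I -> R) (s : seq I) (a : R) :
  \sum_(0 <= i < size s) l i ^+ 2 <= a ->
  wsum l (map f s) <= Num.sqrt a * Num.sqrt (\sum_(j <- s) f j ^+ 2).
Proof.
case: s => [|x0 s'] ha.
  by rewrite /= big_nil sqrtr0 mulr0.
set s := x0 :: s' in ha *.
rewrite wsumE size_map big_mkord.
have -> : \sum_(i < size s) l i * (map f s)`_i =
          \sum_(i < size s) l i * f (nth x0 s i).
  by apply: eq_bigr => i _; rewrite (nth_map x0).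
apply: le_trans (sum_mul_le _ _ _) _.
apply: ler_pM; rewrite ?sqrtr_ge0//.
  by rewrite ler_wsqrtr// -(big_mkord xpredT (fun i => l i ^+ 2)).
by rewrite (big_nth x0 predT) big_mkord.
Qed.

Lemma sum_le_wsum (I : eqType) (x0 : I) (l : nat -> R) (g f : I -> R)
    (a : I -> R) (s : seq I) : (forall j, 0 <= a j) ->
  (forall i, (i < size s)%N -> g (nth x0 s i) <= l i + f (nth x0 s i)) ->
  \sum_(j <- s) g j * a j <= wsum l (map a s) + \sum_(j <- s) f j * a j.
Proof.
move=> a0; elim: s l => [|x s IH] l h; first by rewrite !big_nil /= addr0.
rewrite !big_cons /= addrACA; apply: lerD; last first.
  by apply: IH => i i_s; apply: (h i.+1).
by rewrite -mulrDl ler_wpM2r//; exact: (h 0%N).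
Qed.

Lemma topset p (f : 'I_p -> R) k : (k <= p)%N ->
  exists2 T : {set 'I_p}, #|T| = k &
    forall i j, i \in T -> j \notin T -> f j <= f i.
Proof.
elim: k => [|k IH] kp; first by exists finset.set0; rewrite ?cards0// => i j; rewrite inE.
have [T Tk Tmax] := IH (ltnW kp).
have : (0 < #|(~: T)%SET|)%N by rewrite cardsCs finset.setCK Tk card_ord subn_gt0.
rewrite card_gt0 => /finset.set0Pn[j0 j0T].
case: (@arg_maxP _ R _ j0 (fun j => j \in (~: T)%SET) f j0T) => j jT jmax.
exists (j |: T)%SET.
  by rewrite cardsU1 Tk; move: jT; rewrite inE => ->.
move=> i l; rewrite !inE negb_or => /orP[/eqP ->|iT] /andP[lj lT].
  by apply: jmax; rewrite inE.
exact: Tmax.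
Qed.

Definition l1 p (x : 'cV[R]_p) : R := \sum_j `|x j ord0|.

Lemma l1_ge0 p (x : 'cV[R]_p) : 0 <= l1 x.
Proof. by apply: sumr_ge0. Qed.

Lemma l1_restrC p (S : {set 'I_p}) (x : 'cV[R]_p) :
  l1 x = l1 (restr S x) + l1 (restr (~: S)%SET x).
Proof.
rewrite /l1 -big_split; apply: eq_bigr => j _; rewrite !mxE inE.
by case: (j \in S); rewrite /= normr0 ?addr0 ?add0r.
Qed.

Lemma restr_enorm p (S : {set 'I_p}) (x : 'cV[R]_p) : enorm (restr S x) <= enorm x.
Proof.
rewrite !enormE ler_wsqrtr// ler_sum// => i _; rewrite !mxE.
by case: ifP => // _; rewrite mul0r -expr2 sqr_ge0.
Qed.

Lemma enorm_linf_l1 p (x : 'cV[R]_p) (t : R) : (forall j, `|x j ord0| <= t) ->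
  enorm x ^+ 2 <= t * l1 x.
Proof.
move=> xt; rewrite enorm_sqr mulr_sumr ler_sum// => j _.
by rewrite -expr2 -sqr_abs expr2 ler_wpM2r.
Qed.

End Lists.

Section Cone.
Context {R : realType}.
Variables (n p k : nat) (A : 'M[R]_(n, p)) (dl : R).
Hypotheses (k0 : (0 < k)%N) (kp : (k <= p)%N).
Hypotheses (dl0 : 0 <= dl) (dl4 : dl <= 1/4).
Hypothesis rip : forall h : 'cV[R]_p, (#|supp h| <= 2 * k)%N ->
  (1 - dl) * enorm h <= enorm (A *m h) /\
  enorm (A *m h) <= (1 + dl) * enorm h.

Let kR : 0 < k%:R :> R. Proof. by rewrite ltr0n. Qed.
Let sk : 0 < Num.sqrt k%:R :> R. Proof. by rewrite sqrtr_gt0. Qed.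
Let skk : Num.sqrt k%:R * Num.sqrt k%:R = k%:R :> R.
Proof. by rewrite -expr2 sqr_sqrtr// ltW. Qed.

Let skd (a : R) : Num.sqrt k%:R * (a / k%:R) = a / Num.sqrt k%:R :> R.
Proof. by rewrite -{2}skk; field; rewrite gt_eqF. Qed.

Lemma supp_restr_card (S : {set 'I_p}) (h : 'cV[R]_p) : (#|supp (restr S h)| <= #|S|)%N.
Proof. exact: subset_leq_card (supp_restr _ _). Qed.

(** Restricted isometry extends from sparse vectors to all vectors: peel off the k
    largest entries repeatedly. A block is bounded in sup norm by the average
    entry of the preceding block, so the Euclidean norms of the blocks add up to
    at most the l1 norm divided by sqrt k. *)
Lemma rip_l1 m (x : 'cV[R]_p) (t : R) : (#|supp x| <= m)%N -> 0 <= t ->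
  (forall j, `|x j ord0| <= t) ->
  enorm (A *m x) <= (1 + dl) * (Num.sqrt k%:R * t + l1 x / Num.sqrt k%:R).
Proof.
elim: m x t => [|m IH] x t xm t0 xt.
  have -> : x = 0.
    apply/colP => j; rewrite mxE; apply/eqP/negPn/negP => xj.
    by move: xm; rewrite leqn0 cards_eq0 => /eqP/finset.setP/(_ j); rewrite !inE xj.
  rewrite mulmx0 enorm0 mulr_ge0 ?addr_ge0 ?mulr_ge0 ?invr_ge0 ?l1_ge0 ?sqrtr_ge0//.
have small y : (#|supp y| <= k)%N -> (forall j, `|y j ord0| <= t) ->
    enorm (A *m y) <= (1 + dl) * (Num.sqrt k%:R * t).
  move=> yk yt; have [] := @rip y; first by rewrite (leq_trans yk)// leq_pmull.
  move=> _ /le_trans; apply; rewrite ler_wpM2l ?addr_ge0//.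
  rewrite -ler_sqr ?nnegrE ?mulr_ge0 ?enorm_ge0 ?sqrtr_ge0//.
  rewrite enorm_sqr exprMn sqr_sqrtr ?(ltW kR)//.
  apply: (@le_trans _ _ (\sum_(j in supp y) t ^+ 2)).
    rewrite /dot [leRHS]big_mkcond ler_sum// => j _; rewrite inE.
    case: ifPn => [_|]; last by rewrite negbK => /eqP ->; rewrite mulr0.
    by rewrite -expr2 -sqr_abs ler_sqr ?nnegrE.
  rewrite sumr_const -[leLHS]mulr_natl ler_wpM2r ?sqr_ge0// ler_nat.
  exact: yk.
have [xk|xk] := leqP #|supp x| k.
  apply: le_trans (small x xk xt) _; rewrite ler_wpM2l ?addr_ge0//.
  by rewrite lerDl divr_ge0 ?l1_ge0 ?sqrtr_ge0.
have [T Tk Tmax] := topset (fun j => `|x j ord0|) kp.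
pose x1 := restr T x; pose x2 := restr (~: T)%SET x.
have xE : x = x1 + x2 by rewrite restrDC.
have x1x : enorm (A *m x1) <= (1 + dl) * (Num.sqrt k%:R * t).
  apply: small => [|j]; first by rewrite (leq_trans (supp_restr_card _ _))// Tk.
  by rewrite mxE; case: ifP => // _; rewrite normr0.
have x2max j : `|x2 j ord0| <= l1 x1 / k%:R.
  rewrite mxE inE; case: ifPn => jT; last by rewrite normr0 divr_ge0 ?l1_ge0.
  rewrite ler_pdivlMr// mulr_natr -Tk -sumr_const.
  apply: (@le_trans _ _ (\sum_(i in T) `|x i ord0|)).
    by apply: ler_sum => i iT; exact: Tmax.
  rewrite /l1 big_mkcond/= ler_sum// => i _; rewrite mxE.
  by case: ifP => // _; rewrite normr0.
have x2m : (#|supp x2| <= m)%N.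
  have: (#|supp x2| < #|supp x|)%N.
    apply: proper_card; apply/properP; split.
      apply/fintype.subsetP => j; rewrite !inE mxE inE.
      by case: ifP => //; rewrite eqxx.
    have [j jT] : exists j, j \in T by apply/finset.set0Pn; rewrite -card_gt0 Tk.
    exists j; last by rewrite inE mxE inE jT/= eqxx.
    rewrite inE; apply/negP => /eqP xj0.
    suff /subset_leq_card : supp x \subset T by rewrite Tk leqNgt xk.
    apply/fintype.subsetP => i; rewrite inE; apply: contraNT => iT.
    by have := Tmax _ _ jT iT; rewrite xj0 normr0 normr_le0.
  by move=> /leq_trans/(_ xm); rewrite ltnS.
have := IH x2 _ x2m _ x2max; rewrite divr_ge0 ?l1_ge0// => /(_ isT) h2.
rewrite [in leLHS]xE mulmxDr (le_trans (enormD _ _))// mulrDr.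
apply: lerD => //; apply: (le_trans h2).
rewrite ler_wpM2l ?addr_ge0// (l1_restrC T x) -/x1 -/x2 mulrDl lerD2r.
by rewrite skd.
Qed.

(** A vector D whose part v outside the small set S has small l1 norm cannot be
    nearly annihilated by A. Entries of v above the threshold |v|_1 / k are at
    most k in number; together with S they form a 2k-sparse vector h0, on which
    restricted isometry gives a lower bound. The rest h1 is small in sup norm
    and in l1 norm, so that [rip_l1] makes its image negligible. *)
Lemma cone_lower (S : {set 'I_p}) (D : 'cV[R]_p) :
  let v := restr (~: S)%SET D in
  (#|S| <= k)%N -> l1 v <= 20^-1 * Num.sqrt k%:R * enorm v ->
  2^-1 * enorm v <= enorm (A *m D).
Proof.
move=> v Sk lv.
have [v0|vN0] := eqVneq (l1 v) 0.
  have -> : enorm v = 0.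
    apply/eqP; rewrite -sqrf_eq0 eq_le sqr_ge0 andbT.
    have := @enorm_linf_l1 _ _ v (enorm v) (@coord_le_enorm _ _ v).
    by rewrite v0 mulr0.
  by rewrite mulr0 enorm_ge0.
have l1pos : 0 < l1 v by rewrite lt_neqAle eq_sym vN0 l1_ge0.
pose t := l1 v / k%:R; have t0 : 0 < t by rewrite divr_gt0.
pose T := [set j | t < `|v j ord0|]%SET.
have Tk : (#|T| <= k)%N.
  have kt : k%:R * t = l1 v by rewrite /t mulrC divfK ?gt_eqF.
  rewrite -(ler_nat R) -(ler_pM2r t0) kt [leLHS]mulr_natl -sumr_const /l1 big_mkcond ler_sum// => j _.
  by rewrite inE; case: ifP => // /ltW.
pose h0 := restr (S :|: T)%SET D; pose h1 := restr (~: (S :|: T))%SET D.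
have DE : D = h0 + h1 by rewrite restrDC.
have h1v j : `|h1 j ord0| <= `|v j ord0|.
  rewrite !mxE !inE; case: (j \in S) => //=; case: (t < _) => //=.
  by rewrite normr0.
have h1t j : `|h1 j ord0| <= t.
  rewrite mxE !inE negb_or mxE inE; case: (boolP (j \in S)) => jS /=.
    by rewrite normr0 ltW.
  by case: ltP => //=; rewrite normr0 ltW.
have h1l : l1 h1 <= l1 v by apply: ler_sum.
have h0s : (#|supp h0| <= 2 * k)%N.
  rewrite (leq_trans (supp_restr_card _ _))// mul2n -addnn.
  by rewrite (leq_trans (leq_card_setU _ _))// leq_add.
have [+ _] := rip h0s => h0A.
have h1A := rip_l1 (leqnn _) (ltW t0) h1t.
set e := enorm v in lv *; have e0 : 0 <= e := enorm_ge0 v.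
have ske : l1 v / Num.sqrt k%:R <= 20^-1 * e.
  by rewrite ler_pdivrMr// mulrAC.
have h1A' : enorm (A *m h1) <= (1 + dl) * (2 * (20^-1 * e)).
  apply: (le_trans h1A); rewrite ler_wpM2l ?addr_ge0// mulr2n mulrDl mul1r lerD//.
    by rewrite /t skd.
  by rewrite (le_trans _ ske)// ler_wpM2r ?invr_ge0 ?sqrtr_ge0.
have h1e : enorm h1 <= 20^-1 * e.
  have e20 : 0 <= 20^-1 * e by rewrite mulr_ge0 ?invr_ge0.
  rewrite -ler_sqr ?nnegrE ?enorm_ge0//.
  apply: (le_trans (@enorm_linf_l1 _ _ h1 t h1t)).
  apply: (@le_trans _ _ (t * l1 v)); first by rewrite ler_wpM2l// ltW.
  have -> : t * l1 v = (l1 v / Num.sqrt k%:R) * (l1 v / Num.sqrt k%:R).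
    by rewrite -skd mulrACA skk /t; field; rewrite gt_eqF.
  rewrite expr2.
  by rewrite ler_pM// divr_ge0 ?l1_ge0 ?sqrtr_ge0.
have vh : e <= enorm h0 + enorm h1.
  have -> : e = enorm (restr (~: S)%SET h0 + restr (~: S)%SET h1) by rewrite -restrD -DE.
  by rewrite (le_trans (enormD _ _))// lerD// restr_enorm.
have AD : enorm (A *m h0) <= enorm (A *m D) + enorm (A *m h1).
  have -> : A *m h0 = A *m D - A *m h1 by rewrite {1}DE mulmxDr addrK.
  exact: enormB.
have : (1 - dl) * (e - 20^-1 * e) <= enorm (A *m h0).
  apply: le_trans h0A; rewrite ler_wpM2l//; first by move: dl4; lra.
  by move: vh h1e; lra.
have : 0 <= (1 / 4 - dl) * e by rewrite mulr_ge0// subr_ge0.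
move: AD h1A' e0; lra.
Qed.

End Cone.

(** The comparison of SLOPE with an oracle which knows the support S. The oracle
    [bt] solves the problem in which the columns outside S are erased; its
    residual [w] does not involve these columns, and this is what makes the
    hypothesis [noise] accessible to probabilistic estimates. *)
Section Deterministic.
Context {R : realType}.
Variables (n p k : nat) (lam : nat -> R).
Hypotheses (k0 : (0 < k)%N) (kp : (k <= p)%N).
Hypothesis dec : noninc (lam \o succn) p.
Hypothesis lam_ge0 : forall i, (i < p)%N -> 0 <= lam i.+1.
Variables (A : 'M[R]_(n, p)) (beta : 'cV[R]_p) (z : 'cV[R]_n).
Let S := supp beta.
Hypothesis Sk : (#|S| <= k)%N.
Let y : 'cV[R]_n := A *m beta + z.
Variables (bhat bt0 : 'cV[R]_p).
Hypothesis bhat_min : is_slope_estimate lam A y bhat.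
Hypothesis bt0_min : is_slope_estimate lam (restrcol S A) y bt0.
Let bt := restr S bt0.
Let w : 'cV[R]_n := y - A *m bt.
Variables (dl nz lamk c E : R) (e : 'I_p -> R).
Hypotheses (dl0 : 0 <= dl) (dl4 : dl <= 1/4).
Hypothesis rip : forall h : 'cV[R]_p, (#|supp h| <= 2 * k)%N ->
  (1 - dl) * enorm h <= enorm (A *m h) /\
  enorm (A *m h) <= (1 + dl) * enorm h.
Hypotheses (nz0 : 0 <= nz) (lamk0 : 0 <= lamk).
Hypothesis Hnz : \sum_(j in S) dot (col j A) z ^+ 2 <= nz ^+ 2.
Hypothesis Hlam : \sum_(0 <= i < k) lam i.+1 ^+ 2 <= lamk ^+ 2.

Lemma dot_mulmx (u : 'cV[R]_n) (h : 'cV[R]_p) :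
  dot u (A *m h) = \sum_j dot (col j A) u * h j ord0.
Proof.
rewrite /dot; under eq_bigr do rewrite mxE mulr_sumr.
rewrite exchange_big; apply: eq_bigr => j _ /=; rewrite mulr_suml.
by apply: eq_bigr => i _; rewrite mxE; ring.
Qed.

(** The restricted problem ignores the coordinates outside S and the penalty only
    grows with them, so the restriction of a minimizer is a minimizer. *)
Lemma bt_min : is_slope_estimate lam (restrcol S A) y bt.
Proof.
move=> b'; apply: le_trans (bt0_min b').
rewrite !slope_objectiveE !restrcolM restr_restr lerD2l.
exact: J_restr.
Qed.

Lemma oracle_vi d : dot w (A *m restr S d) <= J lam (bt + d) - J lam bt.
Proof.
have := slope_vi dec lam_ge0 bt_min d.
by rewrite !restrcolM restr_restr.
Qed.

Let sS (b : 'cV[R]_p) := sort (fun i j : 'I_p => `|b i ord0| >= `|b j ord0|) (enum S).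

Let sSperm (b : 'cV[R]_p) s2 : perm_eq s2 (enum (~: S)%SET) ->
  perm_eq (sS b ++ s2) (enum 'I_p).
Proof.
move=> ps2.
apply: (@perm_trans _ (enum S ++ enum (~: S)%SET)).
  by apply: perm_cat => //; rewrite /sS perm_sort.
apply: uniq_perm; rewrite ?enum_uniq//.
  rewrite cat_uniq !enum_uniq /= andbT; apply/hasPn => j.
  by rewrite !mem_enum inE.
by move=> j; rewrite mem_cat !mem_enum !inE orbN.
Qed.

Let J_supp (b : 'cV[R]_p) :
  J lam (restr S b) = wsum (lam \o succn) [seq `|b j ord0| | j <- sS b].
Proof.
set b' := restr S b.
have ps := sSperm b (perm_refl (enum (~: S)%SET)).
have E1 : [seq `|b' j ord0| | j <- sS b] = [seq `|b j ord0| | j <- sS b].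
  by apply/eq_in_map => j; rewrite /sS mem_sort mem_enum mxE => ->.
have E2 : [seq `|b' j ord0| | j <- enum (~: S)%SET] =
    [seq 0 | j <- enum (~: S)%SET].
  apply/eq_in_map => j; rewrite mem_enum inE mxE => /negbTE ->.
  by rewrite normr0.
rewrite (J_eq lam ps) map_cat E1 E2.
  rewrite wsum_cat [X in _ + X]wsumE big_nat_cond big1 ?addr0//.
  move=> i /andP[/andP[_ ]]; rewrite size_map => i_s _.
  have x0 : 'I_p by move: i_s; case: (enum _).
  by rewrite (nth_map x0)// mulr0.
have tr : transitive (>=%R : rel R) by move=> u v t /= uv vt; exact: le_trans vt uv.
rewrite (sorted_pairwise tr) pairwise_cat; apply/and3P; split.
- by apply/allrelP => u v /mapP[j _ ->] /mapP[i _ ->]; rewrite /= normr_ge0.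
- rewrite -(sorted_pairwise tr) sorted_map; apply: sort_sorted => i j.
  exact: (le_total `|b j ord0| `|b i ord0|).
- by elim: (enum _) => //= j s ->; rewrite andbT; apply/allP => u /mapP[i _ ->]; exact: lexx.
Qed.

Let dot_restr (b : 'cV[R]_p) : \sum_(j <- sS b) `|b j ord0| ^+ 2 <= enorm b ^+ 2.
Proof.
rewrite /sS (perm_big (enum S)) ?perm_sort//= big_enum/= enorm_sqr /dot.
rewrite big_mkcond ler_sum// => j _; rewrite -expr2 sqr_abs.
by case: ifP => // _; rewrite sqr_ge0.
Qed.

Lemma J_small (h : 'cV[R]_p) : J lam (restr S h) <= lamk * enorm h.
Proof.
rewrite J_supp (le_trans (@wsum_CS _ _ _ _ _ (lamk ^+ 2) _))//.
  rewrite size_sort -cardE (le_trans _ Hlam)// [leRHS](big_cat_nat _ Sk)//=.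
  by rewrite lerDl sumr_ge0// => i _; rewrite sqr_ge0.
rewrite sqrtr_sqr ger0_norm// ler_wpM2l// -[leRHS]ger0_norm ?enorm_ge0//.
by rewrite -sqrtr_sqr ler_wsqrtr.
Qed.

(** The variational inequality of the restricted problem in the direction of beta
    gives |A h|^2 <= <z, A h> + J h for h = bt - beta. As h lives on S, both terms
    are at most a constant times |h|, and restricted isometry replaces |h| by
    |A h|. *)
Lemma oracle_error :
  (1 - dl) * enorm (A *m bt - A *m beta) <= nz + lamk.
Proof.
have bS : restr S beta = beta by apply: restr_supp.
pose h := bt - beta.
have hS : restr S h = h by rewrite /h restrD restrN bS restr_restr.
rewrite -mulmxBr -/h.
have hk : (#|supp h| <= 2 * k)%N.
  by rewrite -hS (leq_trans (supp_restr_card _ _))// (leq_trans Sk)// leq_pmull.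
have [hA _] := rip hk.
have J1 : J lam beta - J lam bt <= lamk * enorm h.
  have -> : beta = bt - h by rewrite opprB addrC subrK.
  have := JD dec lam_ge0 bt (- h); rewrite JN -{2}hS.
  have := J_small h; lra.
have := oracle_vi (- h); rewrite restrN hS mulmxN dotNr.
have -> : bt - h = beta by rewrite opprB addrC subrK.
have -> : w = z - A *m h.
  by rewrite /w/y/h mulmxBr opprB addrA (addrC z).
rewrite dotBl -enorm_sqr => vi.
have dz : dot z (A *m h) <= nz * enorm h.
  rewrite dot_mulmx.
  have -> : \sum_j dot (col j A) z * h j ord0 =
            \sum_(j in S) dot (col j A) z * h j ord0.
    rewrite [RHS]big_mkcond; apply: eq_bigr => j _.
    by case: ifPn => // jS; rewrite -hS mxE (negbTE jS) mulr0.
  apply: le_trans (sum_mul_le _ _ _) _; apply: ler_pM; rewrite ?sqrtr_ge0//.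
    by rewrite (le_trans (ler_wsqrtr Hnz))// sqrtr_sqr ger0_norm.
  rewrite enormE ler_wsqrtr// /dot big_mkcond ler_sum// => j _.
  by case: ifP => _; rewrite ?expr2// -expr2 sqr_ge0.
have key : enorm (A *m h) ^+ 2 <= (nz + lamk) * enorm h by nra.
have [->|hA0] := eqVneq (enorm (A *m h)) 0; first by rewrite mulr0 addr_ge0.
have hApos : 0 < enorm (A *m h) by rewrite lt_neqAle eq_sym hA0 enorm_ge0.
rewrite -(ler_pM2r hApos) -mulrA -expr2.
have d1 : 0 <= 1 - dl by move: dl4; lra.
apply: (le_trans (ler_wpM2l d1 key)).
rewrite mulrCA ler_wpM2l ?addr_ge0//.
Qed.

Variable s2 : seq 'I_p.
Hypothesis ps2 : perm_eq s2 (enum (~: S)%SET).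
Hypothesis c0 : 0 < c.
Hypothesis noise : forall x0 i, (i < size s2)%N ->
  `|dot (col (nth x0 s2 i) A) w| <=
  lam (#|S| + i).+1 + (e (nth x0 s2 i) - c).
Hypothesis HE : \sum_(j in (~: S)%SET) e j ^+ 2 <= E.
Hypothesis Esmall : Num.sqrt E <= 20^-1 * c * Num.sqrt k%:R.

(** Let D = bhat - bt and let v be its part outside S. Adding the variational
    inequalities of the full and the restricted problem gives
    |A D|^2 <= <w, A v> + J (restr S bhat) - J bhat. In the penalty of bhat, give
    the first #|S| weights to S and the following ones to the complement, in the
    order of [s2]; this leaves the correlations of w with the columns
    outside S minus the weights, which are at most e - c. Thus
    |A D|^2 + c |v|_1 <= sqrt E |v|, and since sqrt E is small compared with
    c sqrt k, the vector v has small l1 norm and [cone_lower] bounds |v| by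
    2 |A D|. *)
Lemma correction_error : enorm (A *m bhat - A *m bt) <= 2 * Num.sqrt E.
Proof.
pose D := bhat - bt; pose v := restr (~: S)%SET D.
have btS : restr S bt = bt by rewrite restr_restr.
have vE : v = restr (~: S)%SET bhat.
  rewrite /v restrD restrN -btS; apply/colP => j; rewrite !mxE inE.
  by case: (j \in S); rewrite /= ?subr0.
have sE : bt + restr S D = restr S bhat.
  by rewrite restrD restrN btS addrC subrK.
rewrite -mulmxBr -/D.
have := slope_vi dec lam_ge0 bhat_min (- D).
have -> : bhat - D = bt by rewrite opprB addrC subrK.
have -> : y - A *m bhat = w - A *m D.
  by rewrite /w mulmxBr opprB addrA subrK.
rewrite mulmxN dotNr dotBl -enorm_sqr => vi1.
have := oracle_vi (restr S D); rewrite sE restr_restr => vi2.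
have dE : dot w (A *m D) = dot w (A *m restr S D) + dot w (A *m v).
  by rewrite -dotDr -mulmxDr restrDC.
have main : enorm (A *m D) ^+ 2 <=
    dot w (A *m v) + J lam (restr S bhat) - J lam bhat by lra.
have Jlow : J lam (restr S bhat) +
    wsum (fun i => lam (#|S| + i).+1) [seq `|bhat j ord0| | j <- s2] <= J lam bhat.
  have := J_ge dec bhat (sSperm bhat ps2).
  rewrite map_cat wsum_cat -J_supp size_map size_sort -cardE.
  by [].
have perm_sum (F : 'I_p -> R) : \sum_(j <- s2) F j = \sum_(j in (~: S)%SET) F j.
  by rewrite (perm_big _ ps2) /= big_enum.
have vj j : j \in (~: S)%SET -> v j ord0 = bhat j ord0.
  by move=> jS; rewrite vE mxE jS.
have up : dot w (A *m v) <=
    \sum_(j <- s2) `|dot (col j A) w| * `|bhat j ord0|.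
  rewrite perm_sum dot_mulmx [leRHS]big_mkcond ler_sum// => j _.
  case: ifPn => jS; last by rewrite vE mxE (negbTE jS) mulr0.
  by rewrite (vj _ jS) -normrM ler_norm.
have p0 : (0 < p)%N by exact: leq_trans k0 kp.
have x0 := Ordinal p0.
have up2 := @sum_le_wsum R _ x0 (fun i => lam (#|S| + i).+1)
  (fun j => `|dot (col j A) w|) (fun j => e j - c)
  (fun j => `|bhat j ord0|) s2 (fun j => normr_ge0 _) (noise x0).
have lv : l1 v = \sum_(j in (~: S)%SET) `|bhat j ord0|.
  rewrite /l1 [RHS]big_mkcond; apply: eq_bigr => j _.
  by case: ifPn => jS; [rewrite vj|rewrite vE mxE (negbTE jS) normr0].
have ev : \sum_(j in (~: S)%SET) `|bhat j ord0| ^+ 2 <= enorm v ^+ 2.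
  rewrite enorm_sqr /dot big_mkcond ler_sum// => j _.
  case: ifPn => jS; last by rewrite -expr2 sqr_ge0.
  by rewrite (vj _ jS) -expr2 sqr_abs.
have E0 : 0 <= E by apply: le_trans HE; apply: sumr_ge0 => j _; rewrite sqr_ge0.
have eb : \sum_(j in (~: S)%SET) e j * `|bhat j ord0| <= Num.sqrt E * enorm v.
  apply: le_trans (sum_mul_le _ _ _) _; apply: ler_pM; rewrite ?sqrtr_ge0//.
    by rewrite ler_wsqrtr.
  rewrite -[leRHS]ger0_norm ?enorm_ge0// -sqrtr_sqr.
  by rewrite ler_wsqrtr.
have key : enorm (A *m D) ^+ 2 + c * l1 v <= Num.sqrt E * enorm v.
  move: up2; rewrite [X in _ <= _ + X]perm_sum.
  under [X in _ <= _ + X]eq_bigr do rewrite mulrBl.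
  rewrite sumrB -mulr_sumr -lv; lra.
have lsmall : l1 v <= 20^-1 * Num.sqrt k%:R * enorm v.
  rewrite -(ler_pM2l c0) !mulrA.
  apply: (@le_trans _ _ (Num.sqrt E * enorm v)).
    by apply: le_trans key; rewrite lerDr sqr_ge0.
  by rewrite ler_wpM2r ?enorm_ge0// (mulrC c).
have low := cone_lower k0 kp dl0 dl4 rip Sk lsmall.
have [->|hA0] := eqVneq (enorm (A *m D)) 0; first by rewrite mulr_ge0 ?sqrtr_ge0.
have hApos : 0 < enorm (A *m D) by rewrite lt_neqAle eq_sym hA0 enorm_ge0.
rewrite -(ler_pM2r hApos) -expr2.
have l0 := l1_ge0 v; have cl : 0 <= c * l1 v by rewrite mulr_ge0// ltW.
apply: (@le_trans _ _ (Num.sqrt E * enorm v)); first by apply: le_trans key; rewrite lerDl.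
by rewrite -mulrA [leRHS]mulrCA ler_wpM2l ?sqrtr_ge0//; move: low; lra.
Qed.

(** The oracle error plus the error committed by not knowing the support. *)
Theorem deterministic_bound :
  enorm (A *m bhat - A *m beta) <= (nz + lamk) / (1 - dl) + 2 * Num.sqrt E.
Proof.
have -> : A *m bhat - A *m beta =
  (A *m bt - A *m beta) + (A *m bhat - A *m bt).
  by rewrite [RHS]addrC addrA subrK.
rewrite (le_trans (enormD _ _))// lerD ?correction_error//.
by rewrite ler_pdivlMr 1?mulrC ?oracle_error//; move: dl4; lra.
Qed.

End Deterministic.

(** * Gaussian integrals *)

Section Gauss.
Context {R : realType}.
Local Notation mu := (@lebesgue_measure R).
Local Notation gauss := (@normal_prob R 0 1).
Implicit Types f : R -> \bar R.
Local Open Scope ereal_scope.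

Lemma integral_scale d (T : measurableType d)
    (P : {measure set T -> \bar R}) (k : \bar R) (f : T -> \bar R) :
  0 <= k -> measurable_fun setT f -> (forall x, 0 <= f x) ->
  \int[P]_x (k * f x) = k * \int[P]_x f x.
Proof.
by move=> k0 mf f0; exact: (ge0_integralZl P measurableT mf (fun x _ => f0 x) k0).
Qed.

Lemma measurable_pdfE (m s : R) : measurable_fun setT (fun x => (normal_pdf m s x)%:E).
Proof. apply: measurableT_comp => //; exact: measurable_normal_pdf. Qed.

Lemma pdf_ge0 (m s x : R) : 0 <= (normal_pdf m s x)%:E.
Proof. by rewrite lee_fin normal_pdf_ge0. Qed.

Lemma integral_scale_pdf (m s : R) (k : \bar R) : 0 <= k ->
  \int[mu]_x (k * (normal_pdf m s x)%:E) = k.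
Proof.
move=> k0; have h := integral_scale (@lebesgue_measure R) k0 (measurable_pdfE m s) (pdf_ge0 m s).
by etransitivity; [exact: h | rewrite integral_normal_pdf mule1].
Qed.

Lemma lebesgue_affine (a m : R) (A : set R) : a != 0%R -> measurable A ->
  mu A = (`|a|%:E * mu ((fun x => a * x + m)%R @^-1` A)).
Proof.
move=> a0 mA.
have mF : measurable_fun setT ((fun x => a * x + m)%R : R -> measurableTypeR R).
  by apply: measurable_funD => //; apply: measurable_funM.
pose nu := mscale (NngNum (normr_ge0 a)) (pushforward mu ((fun x => a * x + m)%R : R -> measurableTypeR R)).
rewrite -[RHS]/(nu mF A).
apply: lebesgue_measure_unique => //= _ [[c d]] _ <-.
rewrite /nu /mscale/= /pushforward.
have [a_gt0|a_lt0|/esym/eqP] := ltgtP 0%R a; last by rewrite (negbTE a0).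
- have -> : (fun x => a * x + m)%R @^-1` `]c, d] = `]((c - m) / a)%R, ((d - m) / a)%R]%classic.
    apply/seteqP; split => x /=; rewrite !in_itv/= ltr_pdivrMr// ler_pdivlMr//;
    by rewrite ltrBlDr lerBrDr (mulrC x).
  rewrite !lebesgue_measure_itv/= !lte_fin ltr_pM2r ?invr_gt0// ltrD2r.
  case: ifPn => _; last by rewrite mule0.
  rewrite !EFinN -!EFinB -EFinM gtr0_norm//; congr EFin; field.
  by rewrite gt_eqF.
- have -> : (fun x => a * x + m)%R @^-1` `]c, d] = `[((d - m) / a)%R, ((c - m) / a)%R[%classic.
    apply/seteqP; split => x /=; rewrite !in_itv/= ltr_ndivlMr// ler_ndivrMr//;
    by rewrite ltrBlDr lerBrDr (mulrC x) andbC.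
  rewrite !lebesgue_measure_itv/= !lte_fin ltr_nM2r ?invr_lt0// ltrD2r.
  case: ifPn => _; last by rewrite mule0.
  rewrite !EFinN -!EFinB -EFinM ltr0_norm//; congr EFin; field.
  by rewrite lt_eqF.
Qed.

Lemma integral_affine (a m : R) f : a != 0%R ->
  measurable_fun setT f -> (forall x, 0 <= f x) ->
  \int[mu]_x f x = `|a|%:E * \int[mu]_x f (a * x + m)%R.
Proof.
move=> a0 mf f0.
have mF : measurable_fun setT ((fun x => a * x + m)%R : R -> measurableTypeR R).
  by apply: measurable_funD => //; apply: measurable_funM.
pose nu := mscale (NngNum (normr_ge0 a)) (pushforward mu ((fun x => a * x + m)%R : R -> measurableTypeR R)).
transitivity (\int[nu mF]_x f x).
  by apply: eq_measure_integral => A mA _; exact: lebesgue_affine.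
rewrite ge0_integral_mscale//=; congr (_ * _).
by rewrite ge0_integral_pushforward.
Qed.

Lemma integral_normal_prob (m s : R) f : s != 0%R ->
  measurable_fun setT f -> (forall x, 0 <= f x) ->
  \int[normal_prob m s]_x f x = \int[mu]_x (f x * (normal_pdf m s x)%:E).
Proof.
move=> s0 mf f0.
have dom := normal_prob_dominates m s.
rewrite -(Radon_Nikodym_SigmaFinite.change_of_variables dom)//=.
have fint := Radon_Nikodym_SigmaFinite.f_integrable dom.
apply: ae_eq_integral => //.
- apply: emeasurable_funM => //; exact: (measurable_int mu).
- apply: emeasurable_funM => //=; apply/measurableT_comp => //=.
  exact: measurable_normal_pdf.
- apply: ae_eqe_mul2l => /=; apply: integral_ae_eq => //=.
  + by apply/measurableT_comp =>//; exact: measurable_normal_pdf.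
  + by move=> E _ mE; rewrite -Radon_Nikodym_SigmaFinite.f_integral.
Qed.

Lemma normal_pdf_affine (m s x : R) : s != 0%R ->
  (`|s| * normal_pdf m s (s * x + m) = normal_pdf 0 1 x)%R.
Proof.
move=> s0; rewrite !normal_pdfE// mulrA; congr (_ * _)%R.
  rewrite /normal_peak expr1n mul1r -mulrnAr sqrtrM ?sqr_ge0// sqrtr_sqr.
  by rewrite invfM mulrA divff ?mul1r ?normr_eq0.
by rewrite /normal_fun; congr expR; field.
Qed.

(** A normal law is an affine image of the standard one, by the change of variables
    [integral_affine] in the integral against the density. *)
Lemma integral_normal_gauss (m s : R) f : s != 0%R ->
  measurable_fun setT f -> (forall x, 0 <= f x) ->
  \int[normal_prob m s]_x f x = \int[gauss]_x f (s * x + m)%R.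
Proof.
move=> s0 mf f0.
have mlin : measurable_fun setT (fun x : R => s * x + m)%R.
  by apply: measurable_funD => //; apply: measurable_funM.
have mflin : measurable_fun setT (fun x : R => f (s * x + m)%R).
  exact: (measurableT_comp mf mlin).
rewrite (integral_normal_prob m s0 mf f0).
rewrite (integral_normal_prob 0 (oner_neq0 R) mflin (fun x => f0 _)).
rewrite (integral_affine m s0); last 2 first.
- apply: emeasurable_funM => //; apply/measurableT_comp => //.
  exact: measurable_normal_pdf.
- by move=> x; rewrite mule_ge0// lee_fin normal_pdf_ge0.
rewrite -ge0_integralZl//.
- apply: eq_integral => x _; rewrite muleCA -EFinM.
  by rewrite normal_pdf_affine.
- apply: emeasurable_funM => //; apply: measurableT_comp => //.
  apply: (measurableT_comp _ mlin); exact: measurable_normal_pdf.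
- by move=> x _; rewrite mule_ge0// lee_fin normal_pdf_ge0.
Qed.

(** Negation is the affine map of slope -1, and the normal law with parameter -1
    has the density of the standard one. *)
Lemma gauss_sym f : measurable_fun setT f -> (forall x, 0 <= f x) ->
  \int[gauss]_x f (- x)%R = \int[gauss]_x f x.
Proof.
move=> mf f0.
have N1 : (- 1 : R)%R != 0%R by rewrite oppr_eq0 oner_eq0.
have -> : \int[gauss]_x f x = \int[normal_prob 0 (-1)]_x f x.
  rewrite (integral_normal_prob 0 (oner_neq0 R) mf f0).
  rewrite (integral_normal_prob 0 N1 mf f0).
  apply: eq_integral => x _; rewrite !normal_pdfE// /normal_peak /normal_fun.
  by rewrite sqrrN.
rewrite (integral_normal_gauss 0 N1 mf f0).
by under [RHS]eq_integral do rewrite mulN1r addr0.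
Qed.

(** Completing the square: the joint density of (a X + b Y, Y) is the density of the
    sum times the conditional density of Y given the sum. *)
Lemma normal_pdf_split (a b c t y : R) : a != 0%R -> c != 0%R ->
  (c ^+ 2 = a ^+ 2 + b ^+ 2)%R ->
  (normal_pdf (b * y) a t * normal_pdf 0 1 y =
   normal_pdf 0 c t * normal_pdf (b * t / c ^+ 2) (a / c) y)%R.
Proof.
move=> a0 c0 c2; have ac0 : (a / c != 0)%R by rewrite mulf_neq0 ?invr_eq0.
rewrite (normal_pdfE _ a0) (normal_pdfE _ (oner_neq0 R)).
rewrite (normal_pdfE _ c0) (normal_pdfE _ ac0).
rewrite mulrACA [RHS]mulrACA; congr (_ * _)%R.
  have P0 (u : R) : (0 <= u ^+ 2 * pi *+ 2)%R.
    by rewrite mulrn_wge0// mulr_ge0 ?sqr_ge0 ?pi_ge0.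
  rewrite /normal_peak -!invfM -(sqrtrM _ (P0 a)) -(sqrtrM _ (P0 c)).
  by congr ((Num.sqrt _)^-1)%R; field; exact: c0.
rewrite /normal_fun -!expRD; congr expR.
have a2 : (a ^+ 2 = c ^+ 2 - b ^+ 2)%R by rewrite c2 addrK.
have cb : (c ^+ 2 - b ^+ 2 != 0)%R by rewrite -a2 sqrf_eq0.
rewrite [((a / c) ^+ 2)%R]exprMn exprVn a2; field.
by rewrite c0 cb.
Qed.

(** Stability of the Gaussian law: a X + b Y has the law of sqrt (a^2 + b^2) X. The
    inner integral is written against the density of a X + b y, the order of
    integration is exchanged, and by [normal_pdf_split] the integral in y is that
    of a normal density. *)
Lemma gauss_rotation (a b : R) f :
  measurable_fun setT f -> (forall x, 0 <= f x) ->
  \int[gauss]_y \int[gauss]_x f (a * x + b * y)%R =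
  \int[gauss]_x f (Num.sqrt (a ^+ 2 + b ^+ 2) * x)%R.
Proof.
move=> mf f0.
have mlin (c m : R) : measurable_fun setT (fun x : R => c * x + m)%R.
  by apply: measurable_funD => //; apply: measurable_funM.
have [->|a0] := eqVneq a 0%R.
  under eq_integral do under eq_integral do rewrite mul0r add0r.
  under eq_integral do rewrite integral_cst//= probability_setT mule1.
  rewrite expr0n add0r sqrtr_sqr.
  have [b0|b0] := leP 0%R b; first by rewrite ger0_norm.
  rewrite ltr0_norm// -(gauss_sym (f := fun y => f (b * y)%R)).
  + by apply: eq_integral => x _; rewrite mulrN mulNr.
  + apply: measurableT_comp => //; exact: measurable_funM.
  + by [].
pose c := Num.sqrt (a ^+ 2 + b ^+ 2)%R.
have c2 : (c ^+ 2 = a ^+ 2 + b ^+ 2)%R by rewrite sqr_sqrtr// addr_ge0// sqr_ge0.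
have c0 : c != 0%R.
  rewrite gt_eqF// sqrtr_gt0 ltr_pwDl ?sqr_ge0//.
  by rewrite lt_neqAle sqr_ge0 eq_sym sqrf_eq0 a0.
have ac0 : (a / c != 0)%R by rewrite mulf_neq0 ?invr_eq0.
under eq_integral do rewrite -(integral_normal_gauss _ a0 mf f0) (integral_normal_prob _ a0 mf f0).
have m2 : measurable_fun setT (fun yt : R * R => normal_pdf (b * yt.1) a yt.2).
  rewrite (_ : (fun _ => _) = (fun yt : R * R => normal_pdf 0 a (yt.2 - b * yt.1))%R).
    apply: measurableT_comp; first exact: measurable_normal_pdf.
    by apply: measurable_funB => //; apply: measurable_funM => //.
  apply/funext => -[y t] /=; rewrite !normal_pdfE//.
  by rewrite [in RHS]/normal_fun subr0.
have mF : measurable_fun setT (fun yt : R * R =>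
     f yt.2 * (normal_pdf (b * yt.1) a yt.2 * normal_pdf 0 1 yt.1)%:E).
  apply: emeasurable_funM.
    exact: measurableT_comp.
  apply: measurableT_comp => //; apply: measurable_funM => //.
  by apply: measurableT_comp => //; exact: measurable_normal_pdf.
have mG : measurable_fun setT (fun yt : R * R =>
     f yt.2 * (normal_pdf (b * yt.1) a yt.2)%:E).
  apply: emeasurable_funM; first exact: measurableT_comp.
  exact: measurableT_comp.
have G0 (yt : R * R) : 0 <= f yt.2 * (normal_pdf (b * yt.1) a yt.2)%:E.
  by rewrite mule_ge0// lee_fin normal_pdf_ge0.
rewrite (integral_normal_prob 0 (oner_neq0 R)); last 2 first.
- have h := @measurable_fun_fubini_tonelli_F _ _ (measurableTypeR R)
    (measurableTypeR R) R (@lebesgue_measure R) _ mG G0.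
  exact: h.
- move=> y; apply: integral_ge0 => t _; rewrite mule_ge0// lee_fin.
  exact: normal_pdf_ge0.
transitivity (\int[mu]_y \int[mu]_t (f t * (normal_pdf (b * y) a t * normal_pdf 0 1 y)%:E)).
  apply: eq_integral => y _; rewrite -ge0_integralZr//.
  - by apply: eq_integral => t _; rewrite -muleA.
  - apply: emeasurable_funM => //; apply: measurableT_comp => //.
    exact: measurable_normal_pdf.
  - by move=> x _; rewrite mule_ge0// lee_fin normal_pdf_ge0.
  - by rewrite lee_fin normal_pdf_ge0.
have F0 (yt : R * R) :
    0 <= f yt.2 * (normal_pdf (b * yt.1) a yt.2 * normal_pdf 0 1 yt.1)%:E.
  by rewrite mule_ge0// lee_fin mulr_ge0// normal_pdf_ge0.
have swap := @fubini_tonelli _ _ (measurableTypeR R) (measurableTypeR R) R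
  (@lebesgue_measure R) (@lebesgue_measure R) _ mF F0.
etransitivity; first exact: swap.
have -> : \int[gauss]_x f (c * x)%R = \int[normal_prob 0 c]_x f x.
  by rewrite (integral_normal_gauss 0 c0 mf f0); under [RHS]eq_integral do rewrite addr0.
rewrite (integral_normal_prob 0 c0 mf f0); apply: eq_integral => t _.
transitivity (\int[mu]_y
    (f t * (normal_pdf (b * y) a t * normal_pdf 0 1 y)%:E)); first by [].
have mk : measurable_fun setT (fun y : R =>
    (normal_pdf (b * y) a t * normal_pdf 0 1 y)%:E).
  apply/measurable_EFinP; apply: measurable_funM.
    exact: (measurableT_comp m2 (measurable_pair2 _)).
  exact: measurable_normal_pdf.
have k0 (y : R) : 0 <= (normal_pdf (b * y) a t * normal_pdf 0 1 y)%:E.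
  by rewrite lee_fin; apply: mulr_ge0; exact: normal_pdf_ge0.
etransitivity; first exact: (integral_scale (@lebesgue_measure R) (f0 t) mk k0).
congr (_ * _).
transitivity (\int[mu]_y ((normal_pdf 0 c t)%:E * (normal_pdf (b * t / c ^+ 2) (a / c) y)%:E)).
  apply: eq_integral => y _; rewrite -EFinM; congr EFin.
  exact: (normal_pdf_split t y a0 c0 c2).
exact: integral_scale_pdf (pdf_ge0 _ _ _).
Qed.

End Gauss.

(** * The normal distribution function and its quantiles *)

Section GaussFacts.
Context {R : realType}.
Local Notation mu := (@lebesgue_measure R).
Local Notation gauss := (@normal_prob R 0 1).
Implicit Types f : R -> \bar R.

Lemma measurable_expE d (T : measurableType d) (g : T -> R) :
  measurable_fun setT g -> measurable_fun setT (fun x => (expR (g x))%:E).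
Proof.
by move=> mg; apply/measurable_EFinP; exact: (measurableT_comp (@measurable_expR R) mg).
Qed.

Lemma measurable_indicE d (T : measurableType d) (A : set T) :
  measurable A -> measurable_fun setT (fun x => (\1_A x : R)%:E).
Proof. by move=> mA; apply/measurable_EFinP; exact: measurable_indic. Qed.

Lemma measurable_exp_lin (t : R) : measurable_fun setT (fun x : R => (expR (t * x))%:E).
Proof. by apply: measurable_expE; exact: measurable_funM. Qed.

Lemma measurable_exp_sqr (t : R) :
  measurable_fun setT (fun x : R => (expR (t * x ^+ 2))%:E).
Proof.
by apply: measurable_expE; apply: measurable_funM => //; exact: measurable_funX.
Qed.

(** Tilting by exp (t x) translates the Gaussian density by t. *)
Lemma gauss_expR_lin (t : R) :
  (\int[gauss]_x (expR (t * x))%:E = (expR (t ^+ 2 / 2))%:E)%E.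
Proof.
have E0 (x : R) : (0 <= (expR (t * x))%:E)%E by rewrite lee_fin expR_ge0.
rewrite (integral_normal_prob 0 (oner_neq0 R) (measurable_exp_lin t) E0).
transitivity (\int[mu]_x ((expR (t ^+ 2 / 2))%:E * (normal_pdf t 1 x)%:E))%E.
  apply: eq_integral => x _; rewrite -!EFinM; congr EFin.
  rewrite !(normal_pdfE _ (oner_neq0 R)) mulrCA [RHS]mulrCA; congr (_ * _).
  by rewrite /normal_fun -!expRD; congr expR; field.
have k0 : (0%E <= (expR (t ^+ 2 / 2))%:E)%E by rewrite lee_fin expR_ge0.
exact: (integral_scale_pdf t 1 k0).
Qed.

(** Tilting by exp (t x^2) rescales the Gaussian density. *)
Lemma gauss_expR_sqr (t : R) : t < 1 / 2 ->
  (\int[gauss]_x (expR (t * x ^+ 2))%:E = ((Num.sqrt (1 - 2 * t))^-1)%:E)%E.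
Proof.
move=> t2; have p0 : 0 < 1 - 2 * t by lra.
set s := (Num.sqrt (1 - 2 * t))^-1.
have s0 : 0 < s by rewrite invr_gt0 sqrtr_gt0.
have s2 : s ^+ 2 = (1 - 2 * t)^-1 by rewrite exprVn sqr_sqrtr ?(ltW p0).
have E0 (x : R) : (0 <= (expR (t * x ^+ 2))%:E)%E by rewrite lee_fin expR_ge0.
rewrite (integral_normal_prob 0 (oner_neq0 R) (measurable_exp_sqr t) E0).
transitivity (\int[mu]_x (s%:E * (normal_pdf 0 s x)%:E))%E.
  apply: eq_integral => x _; rewrite -!EFinM; congr EFin.
  have sN0 : s != 0 by rewrite gt_eqF.
  rewrite (normal_pdfE _ (oner_neq0 R)) (normal_pdfE _ sN0).
  rewrite mulrCA [RHS]mulrA; congr (_ * _).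
    rewrite /normal_peak expr1n mul1r -mulrnAr sqrtrM ?sqr_ge0//.
    by rewrite sqrtr_sqr gtr0_norm// invfM mulrA divff ?mul1r// gt_eqF.
  rewrite /normal_fun -!expRD; congr expR; rewrite s2 !subr0; field.
  by rewrite gt_eqF.
have k0 : (0%E <= s%:E)%E by rewrite lee_fin ltW.
exact: (integral_scale_pdf 0 s k0).
Qed.

(** Square of the first-order bound at x / 2. *)
Lemma expR_ge2 (x : R) : 0 <= x -> 1 + x + x ^+ 2 / 4 <= expR x.
Proof.
move=> x0.
have -> : expR x = expR (x / 2) ^+ 2.
  by rewrite -expRM_natl; congr expR; field.
have -> : 1 + x + x ^+ 2 / 4 = (1 + x / 2) ^+ 2 by field.
by rewrite ler_sqr ?nnegrE ?expR_ge0 ?expR_ge1Dx// addr_ge0// divr_ge0.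
Qed.

Lemma gauss_expR_sqr_le (t : R) : `|t| <= 1 / 8 ->
  ((\int[gauss]_x (expR (t * x ^+ 2))%:E <= (expR (t + 2 * t ^+ 2))%:E)%E).
Proof.
move=> t4; have := t4; rewrite ler_norml => /andP[tl tu].
rewrite gauss_expR_sqr; last by lra.
rewrite lee_fin; have p0 : 0 < 1 - 2 * t by lra.
rewrite -[leRHS]invrK lef_pV2 ?posrE ?invr_gt0 ?expR_gt0 ?sqrtr_gt0// -expRN.
rewrite -[leLHS]ger0_norm ?expR_ge0// -sqrtr_sqr.
(* the claim becomes (1 - y) e^(y + y^2) >= 1 for y = 2 t; the second-order
   bound on the exponential is used for y >= 0, the first-order one for y < 0 *)
set y := 2 * t.
have -> : expR (- (t + 2 * t ^+ 2)) ^+ 2 = expR (- (y + y ^+ 2)).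
  by rewrite -expRM_natl; congr expR; rewrite /y; ring.
rewrite ler_wsqrtr//.
have yl : - (1/4) <= y by rewrite /y; lra.
have yu : y <= 1/4 by rewrite /y; lra.
rewrite expRN -[leLHS]mul1r ler_pdivrMr ?expR_gt0//.
have [y0|y0] := leP 0 y.
- have h : 0 <= y + y ^+ 2 by nra.
  have := expR_ge2 h.
  move=> /(ler_wpM2l (ltW p0)) /(le_trans _); apply.
  rewrite -/y; have h1 : 0 <= y ^+ 2 * ((1 - y) * (1 + y) ^+ 2 / 4 - y).
    by rewrite mulr_ge0 ?sqr_ge0//; nra.
  nra.
- have := expR_ge1Dx (y + y ^+ 2).
  move=> /(ler_wpM2l (ltW p0)) /(le_trans _); apply.
  rewrite -/y; have : 0 <= y ^+ 2 * - y by rewrite mulr_ge0 ?sqr_ge0//; lra.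
  lra.
Qed.

Local Notation Phi := (@Phi R).

Lemma gauss_fin (A : set R) : measurable A -> gauss A \is a fin_num.
Proof. by move=> mA; exact: fin_num_measure. Qed.

Lemma PhiE x : (Phi x)%:E = gauss `]-oo, x].
Proof. by rewrite fineK// gauss_fin. Qed.

Lemma Phi_itv x y : x <= y -> (Phi y - Phi x)%:E = gauss `]x, y].
Proof.
move=> xy; rewrite EFinB !PhiE.
have -> : `]-oo, y]%classic = `]-oo, x] `|` `]x, y].
  by rewrite -itv_bndbnd_setU.
rewrite measureU//.
  by rewrite addeAC subee ?add0e// gauss_fin.
apply/seteqP; split => z //= []; rewrite !in_itv/= => zx /andP[xz _].
by move: (lt_le_trans xz zx); rewrite ltxx.
Qed.

Lemma Phi_tail x : (1 - Phi x)%:E = gauss `]x, +oo[.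
Proof.
rewrite EFinB PhiE -[X in (X - _)%E](@probability_setT _ _ _ gauss).
have -> : [set: R] = `]-oo, x] `|` `]x, +oo[.
  by rewrite -itv_bndbnd_setU// set_itvE.
rewrite measureU//.
  by rewrite addeAC subee ?add0e// gauss_fin.
apply/seteqP; split => z //= []; rewrite !in_itv/= => zx; rewrite andbT => xz.
by move: (lt_le_trans xz zx); rewrite ltxx.
Qed.

(** The density decreases on the positive half-line, so on an interval it is at
    least its value at the far end. *)
Lemma gauss_itv_ge x y : 0 <= x -> x <= y ->
  ((normal_pdf 0 1 y * (y - x))%:E <= gauss `]x, y])%E.
Proof.
move=> x0 xy; rewrite /normal_prob.
apply: (@le_trans _ _ (\int[mu]_(u in `]x, y]) (cst (normal_pdf 0 1 y)%:E u))%E).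
  rewrite integral_cst//= lebesgue_measure_itv/= lte_fin.
  case: ltP => [_|yx]; first by rewrite -EFinB -EFinM.
  by rewrite mule0 lee_fin mulr_ge0_le0 ?normal_pdf_ge0// subr_le0.
apply: ge0_le_integral => //=.
- by move=> u _; rewrite lee_fin normal_pdf_ge0.
- apply: measurable_funTS; exact: measurable_pdfE.
- move=> u; rewrite in_itv/= => /andP[xu uy]; rewrite lee_fin !normal_pdfE//.
  rewrite ler_wpM2l ?normal_peak_ge0// /normal_fun ler_expR !subr0.
  rewrite ler_pM2r ?invr_gt0// lerN2 ler_sqr ?nnegrE//.
    by rewrite (le_trans x0)// ltW.
  by rewrite (le_trans x0).
Qed.

Lemma gauss_itv_le x y : x <= y ->
  (gauss `]x, y] <= (normal_peak 1 * (y - x))%:E)%E.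
Proof.
move=> xy; rewrite /normal_prob.
apply: (@le_trans _ _ (\int[mu]_(u in `]x, y]) (cst (normal_peak 1)%:E u))%E).
  apply: ge0_le_integral => //=.
  - by move=> u _; rewrite lee_fin normal_pdf_ge0.
  - apply: measurable_funTS; exact: measurable_pdfE.
  - by move=> u _; rewrite lee_fin normal_pdf_ub.
rewrite integral_cst//= lebesgue_measure_itv/= lte_fin.
case: ltP => [_|yx]; first by rewrite -EFinB -EFinM.
by rewrite mule0 lee_fin mulr_ge0 ?normal_peak_ge0// subr_ge0.
Qed.

Lemma Phi_mono x y : x < y -> Phi x < Phi y.
Proof.
move=> xy; rewrite -subr_gt0 -lte_fin Phi_itv ?(ltW xy)//.
(* the density is unimodal, so on the interval it is at least its smaller end value *)
rewrite /normal_prob.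
have pos (u : R) : 0 < normal_pdf 0 1 u.
  by rewrite normal_pdfE// mulr_gt0 ?expR_gt0 ?normal_peak_gt0.
pose m := Num.min (normal_pdf 0 1 x) (normal_pdf 0 1 y).
have m0 : 0 < m by rewrite lt_min !pos.
apply: (@lt_le_trans _ _ (\int[mu]_(u in `]x, y]) (cst m%:E u))%E).
  rewrite integral_cst//= lebesgue_measure_itv/= lte_fin xy.
  by rewrite -EFinB -EFinM lte_fin mulr_gt0// subr_gt0.
apply: ge0_le_integral => //=.
- by move=> u _; rewrite lee_fin ltW.
- apply: measurable_funTS; exact: measurable_pdfE.
- move=> u; rewrite in_itv/= => /andP[xu uy]; rewrite lee_fin ge_min.
  rewrite !normal_pdfE// !ler_pM2l ?normal_peak_gt0// /normal_fun !ler_expR.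
  rewrite !subr0 !ler_pM2r ?invr_gt0// !lerN2.
  have [u0|u0] := leP 0 u; apply/orP; [right|left]; nra.
Qed.

Lemma Phi_le x y : (Phi x <= Phi y) = (x <= y).
Proof. by apply: le_mono => u v; exact: Phi_mono. Qed.

Lemma Phi_lt x y : (Phi x < Phi y) = (x < y).
Proof. by apply: leW_mono => u v; exact: Phi_le. Qed.

(** Chernoff bound, with the exponential tilt t. *)
Lemma Phi_tail_le t : 0 <= t -> 1 - Phi t <= expR (- (t ^+ 2 / 2)).
Proof.
move=> t0; rewrite -lee_fin Phi_tail.
have -> : gauss `]t, +oo[ = (\int[gauss]_x (\1_(`]t, +oo[) x)%:E)%E.
  by rewrite integral_indic// setIT.
apply: (@le_trans _ _ (\int[gauss]_x ((expR (- t ^+ 2))%:E * (expR (t * x))%:E))%E).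
  apply: ge0_le_integral => //=.
  - exact: measurable_indicE.
  - exact: emeasurable_funM (measurable_exp_lin t).
  - move=> x _; rewrite -EFinM lee_fin indicE -expRD.
    case: (boolP (x \in _)) => [|_]; last exact: expR_ge0.
    rewrite inE/= in_itv/= andbT => tx.
    by rewrite -[leLHS]expR0 ler_expR; nra.
rewrite integral_scale.
- rewrite gauss_expR_lin -EFinM -expRD lee_fin ler_expR; lra.
- by rewrite lee_fin expR_ge0.
- exact: measurable_exp_lin.
- by move=> x; rewrite lee_fin expR_ge0.
Qed.

(** The tail contains an interval of length 1 on which the density is at least its
    value at t + 1. *)
Lemma Phi_tail_ge t : 0 <= t ->
  normal_peak 1 * expR (- ((t + 1) ^+ 2 / 2)) <= 1 - Phi t.
Proof.
move=> t0; rewrite -lee_fin.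
apply: (@le_trans _ _ (gauss `]t, t + 1])).
  apply: le_trans (@gauss_itv_ge t (t + 1) t0 _); last by rewrite lerDl.
  rewrite lee_fin addrAC subrr add0r mulr1 normal_pdfE// /normal_fun subr0.
  by rewrite expr1n mulNr.
rewrite Phi_tail; apply: le_measure; rewrite ?inE//.
by move=> x /=; rewrite !in_itv/= => /andP[-> _].
Qed.

Lemma measurable_preimage_opp (A : set R) :
  measurable A -> measurable ((-%R : R -> R) @^-1` A).
Proof.
move=> mA; rewrite -[X in measurable X]setTI.
exact: (measurable_funN (@measurable_id _ R setT)) measurableT _ mA.
Qed.

Lemma gauss_symE (A : set R) : measurable A -> gauss (-%R @^-1` A) = gauss A.
Proof.
move=> mA.
have mA' := measurable_preimage_opp mA.
have E B : measurable B -> gauss B = (\int[gauss]_x (\1_B x)%:E)%E.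
  by move=> mB; rewrite integral_indic// setIT.
rewrite (E _ mA') (E _ mA).
exact: (gauss_sym (measurable_indicE mA)).
Qed.

(** The opposite half-lines differ by one point, which is given mass 0 by
    enclosing it in small intervals. *)
Lemma PhiN x : Phi (- x) <= 1 - Phi x.
Proof.
rewrite -lee_fin PhiE -gauss_symE//.
have -> : (-%R : R -> R) @^-1` `]-oo, (- x)] = `[x, +oo[%classic.
  by apply/seteqP; split => y; rewrite /= !in_itv/= lerN2 andbT.
apply/lee_addgt0Pr => e e0.
have pk : 0 < normal_peak 1 :> R by rewrite normal_peak_gt0.
apply: (@le_trans _ _ (gauss `](x - e / normal_peak 1)%R, x] + gauss `]x, +oo[)%E).
  have -> : gauss `[x, +oo[ = (gauss `[x, x] + gauss `]x, +oo[)%E.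
    rewrite -measureU//; first by rewrite -itv_bndbnd_setU ?bnd_simp.
    apply/seteqP; split => z //= []; rewrite !in_itv/= => /andP[_ zx].
    by rewrite andbT => /(le_lt_trans zx); rewrite ltxx.
  rewrite leeD2r// le_measure ?inE//.
  move=> y /=; rewrite !in_itv/= => /andP[xy ->]; rewrite andbT.
  by rewrite (lt_le_trans _ xy)// ltrBlDr ltrDl divr_gt0.
rewrite addeC -Phi_tail leeD2l//.
apply: (le_trans (gauss_itv_le _)); first by rewrite gerBl divr_ge0// ltW.
by rewrite lee_fin opprB addrC subrK mulrC divfK// gt_eqF.
Qed.

Lemma gauss_two_sided t : (gauss [set x : R | (t < `|x|)%R] <= (2 * (1 - Phi t))%:E)%E.
Proof.
have -> : [set x | t < `|x|] = `]t, +oo[ `|` (-%R @^-1` `]t, +oo[).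
  apply/seteqP; split => x /=; rewrite !in_itv/= !andbT lter_normr.
    by move=> /orP[]; [left|right].
  by move=> [] ->; rewrite ?orbT.
have m1 : measurable ((-%R : R -> R) @^-1` `]t, +oo[) by exact: measurable_preimage_opp.
apply: (@le_trans _ _ (gauss `]t, +oo[ + gauss (-%R @^-1` `]t, +oo[))%E).
  exact: measureU2.
by rewrite gauss_symE// -Phi_tail -EFinD lee_fin mulr2n mulrDl !mul1r.
Qed.

Lemma Phi_continuous : continuous Phi.
Proof.
have lip x y : x <= y -> Phi y - Phi x <= normal_peak 1 * (y - x).
  by move=> xy; rewrite -lee_fin Phi_itv// gauss_itv_le.
have lip2 x y : `|Phi y - Phi x| <= normal_peak 1 * `|y - x|.
  have [xy|/ltW yx] := leP x y.
    by rewrite !ger0_norm ?subr_ge0 ?Phi_le// lip.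
  by rewrite distrC [X in _ * X]distrC !ger0_norm ?subr_ge0 ?Phi_le// lip.
move=> x; apply/cvgrPdist_le => e e0.
have pk : 0 < normal_peak 1 :> R by rewrite normal_peak_gt0.
have d0 : 0 < e / normal_peak 1 by rewrite divr_gt0.
have : \forall y \near x, `|x - y| <= e / normal_peak 1.
  by move: (@cvg_id _ (nbhs x)) => /cvgrPdist_le/(_ _ d0).
apply: filterS => y hy; apply: (le_trans (lip2 _ _)).
by rewrite mulrC -ler_pdivlMr.
Qed.

(** Intermediate value theorem between -t and t, for t so large that both tails
    are small. *)
Lemma Phi_surj u : 0 < u < 1 -> exists x, Phi x = u.
Proof.
move=> /andP[u0 u1].
have [t t0 tu] : exists2 t, 0 <= t & 1 - Phi t <= Num.min u (1 - u).
  set m := Num.min u (1 - u).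
  have m0 : 0 < m by rewrite lt_min u0 subr_gt0.
  exists (2 * m^-1 + 1); first by rewrite addr_ge0// mulr_ge0// invr_ge0 ltW.
  apply: (le_trans (Phi_tail_le _)).
    by rewrite addr_ge0// mulr_ge0// invr_ge0 ltW.
  have mi : 0 < m^-1 by rewrite invr_gt0.
  rewrite expRN -[leRHS]invrK lef_pV2 ?posrE ?expR_gt0//.
  apply: le_trans (expR_ge1Dx _); nra.
have : Phi (- t) <= u <= Phi t.
  have := PhiN t; move: tu; rewrite le_min => /andP[h1 h2] h3.
  by apply/andP; split; lra.
move=> hu; have tt : - t <= t by rewrite (le_trans (_ : - t <= 0)) ?oppr_le0.
have [||c _ <-] := @IVT R Phi (- t) t u tt; last by exists c.
  by apply: continuous_subspaceT => x; exact: Phi_continuous.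
by move/andP: hu => [h1 h2]; rewrite ge_min le_max h1 h2 orbT.
Qed.

Lemma Phi_invK u : 0 < u < 1 -> Phi (Phi_inv u) = u.
Proof.
move=> /Phi_surj[x xu]; rewrite /Phi_inv pinvK//.
by rewrite inE; exists x.
Qed.

Lemma Phi_inv_le u v : 0 < u -> u <= v -> v < 1 -> Phi_inv u <= Phi_inv v :> R.
Proof.
move=> u0 uv v1; rewrite -Phi_le !Phi_invK//.
  by rewrite v1 (lt_le_trans u0).
by rewrite u0 (le_lt_trans uv).
Qed.

Lemma Phi0 : Phi 0 <= 1 / 2.
Proof. have := PhiN 0; rewrite oppr0; lra. Qed.

Lemma Phi_inv_gt0 u : 1 / 2 < u -> u < 1 -> 0 < Phi_inv u :> R.
Proof.
move=> u2 u1; rewrite -Phi_lt Phi_invK ?u1 ?andbT//; last by lra.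
exact: le_lt_trans Phi0 u2.
Qed.

(** The Gaussian tail bound read as an upper bound on the quantile with upper
    tail probability v. *)
Lemma Phi_inv_upper (v : R) : 0 < v -> v < 1 / 2 ->
  Phi_inv (1 - v) ^+ 2 <= 2 * ln v^-1.
Proof.
move=> v0 v2; set g := Phi_inv (1 - v).
have g0 : 0 < g by apply: Phi_inv_gt0; lra.
have := Phi_tail_le (ltW g0); rewrite /g Phi_invK -/g; last by apply/andP; split; lra.
rewrite subKr => h.
have : ln v <= ln (expR (- (g ^+ 2 / 2))) by rewrite ler_ln ?posrE ?expR_gt0.
rewrite (@expRK R) lnV ?posrE//; lra.
Qed.

(** The matching lower bound on the quantile, written as a bound on the tail
    probability; the shift by 1 is harmless for large quantiles. *)
Lemma Phi_inv_lower (v : R) : 0 < v -> v < 1 / 2 ->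
  normal_peak 1 * expR (- ((Phi_inv (1 - v) + 1) ^+ 2 / 2)) <= v.
Proof.
move=> v0 v2; set g := Phi_inv (1 - v).
have g0 : 0 < g by apply: Phi_inv_gt0; lra.
by have := Phi_tail_ge (ltW g0); rewrite /g Phi_invK ?subKr//; apply/andP; split; lra.
Qed.

End GaussFacts.

(** * Independence and decoupling *)

Lemma measurable_sum_in d (T : measurableType d) (R : realType) (I : eqType)
    (r : seq I) (h : I -> T -> R) :
  (forall i, i \in r -> measurable_fun setT (h i)) ->
  measurable_fun setT (fun x => \sum_(i <- r) h i x).
Proof.
elim: r => [_|i r IH mh].
  rewrite (_ : (fun _ => _) = cst 0) //.
  by apply/funext => x; rewrite big_nil.
rewrite (_ : (fun _ => _) = (fun x => h i x + \sum_(j <- r) h j x)).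
  apply: measurable_funD; first by apply: mh; rewrite mem_head.
  by apply: IH => j jr; apply: mh; rewrite inE jr orbT.
by apply/funext => x; rewrite big_cons.
Qed.

Section Decouple.
Context d (T : measurableType d) (R : realType) (P : probability T R).
Local Open Scope ereal_scope.

(** If U and V are independent, the law of the pair is the product of the laws;
    Tonelli then lets V be replaced by a fresh copy living on a second sample. *)
Lemma decouple d1 d2 (T1 : measurableType d1) (T2 : measurableType d2)
    (U : T -> T1) (V : T -> T2) (F : T1 * T2 -> \bar R) :
  measurable_fun setT U -> measurable_fun setT V ->
  (forall A B, measurable A -> measurable B ->
    P (U @^-1` A `&` V @^-1` B) = P (U @^-1` A) * P (V @^-1` B)) ->
  measurable_fun setT F -> (forall x, 0 <= F x) ->
  \int[P]_w F (U w, V w) = \int[P]_w1 \int[P]_w2 F (U w1, V w2).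
Proof.
move=> mU mV ind mF F0.
pose U' : {mfun T >-> T1} := HB.pack U (isMeasurableFun.Build _ _ _ _ _ mU).
pose V' : {mfun T >-> T2} := HB.pack V (isMeasurableFun.Build _ _ _ _ _ mV).
have mUV : measurable_fun setT (fun w => (U w, V w)).
  exact: measurable_fun_pair.
pose UV : {mfun T >-> (T1 * T2)%type} :=
  HB.pack (fun w => (U w, V w)) (isMeasurableFun.Build _ _ _ _ _ mUV).
have E := @product_measure_unique _ _ T1 T2 R (distribution P U')
  (distribution P V') (distribution P UV).
transitivity (\int[distribution P UV]_x F x).
  by rewrite (ge0_integral_distribution UV mF F0).
transitivity (\int[(distribution P U' \x distribution P V')%E]_x F x).
  apply/esym/eq_measure_integral => A mA _; apply: E => // B C mB mC.
rewrite (fubini_tonelli1 F mF F0).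
rewrite (ge0_integral_distribution U'); last 2 first.
- exact: measurable_fun_fubini_tonelli_F.
- by move=> x; apply: integral_ge0.
apply: eq_integral => w1 _.
rewrite /= /fubini_F (ge0_integral_distribution V' (f := fun y => F (U w1, y)))//.
exact: (measurableT_comp mF (measurable_pair1 _)).
Qed.

End Decouple.

(** Disjointness of finite sets; the bracket notation denotes disjointness of
    classical sets here. *)
Local Notation disjS A B := (fintype.disjoint (mem A) (mem B)).

Section Groups.
Context d (T : measurableType d) (R : realType) (P : probability T R).
Variables (I : finType) (Y : I -> {RV P >-> R}).
Implicit Types J : {set I}.

(** Events depending on one variable of the subfamily J. *)
Definition sub_gen J : set (set T) :=
  \bigcup_(i in [set i | i \in J]) preimage_set_system setT (Y i) measurable.

Definition cylinders J : set (set T) :=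
  [set A | exists B : I -> set R, (forall i, measurable (B i)) /\
     A = \bigcap_(i in [set i | i \in J]) (Y i @^-1` B i)].

(** The sample space with the sigma-algebra of the subfamily J. A function is
    measurable from [SJ J] when it depends measurably on the variables of J only;
    in particular several of these sigma-algebras coexist on T. *)
Definition SJ J := g_sigma_algebraType (sub_gen J).

Lemma measurable_Y i (B : set R) : measurable B -> measurable (Y i @^-1` B).
Proof. by move=> mB; rewrite -[X in measurable X]setTI; exact: measurable_funPT. Qed.

Lemma sub_gen_measurable J : sub_gen J `<=` measurable.
Proof.
move=> A [i _ [B mB <-]]; rewrite setTI; exact: measurable_Y.
Qed.

Lemma sigma_sub_gen_measurable J : <<s sub_gen J >> `<=` measurable.
Proof.
apply: smallest_sub; [exact: sigma_algebra_measurable|exact: sub_gen_measurable].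
Qed.

Lemma cylinders_measurable J : cylinders J `<=` measurable.
Proof.
move=> A [B [mB ->]]; apply: fin_bigcap_measurable => // i _.
exact: measurable_Y.
Qed.

Lemma cylindersI J : setI_closed (cylinders J).
Proof.
move=> A A' [B [mB ->]] [B' [mB' ->]].
exists (fun i => B i `&` B' i); split; first by move=> i; exact: measurableI.
by rewrite -bigcapI.
Qed.

Lemma cylinders_setT J : cylinders J setT.
Proof.
exists (fun=> setT); split=> //.
by apply/esym; rewrite -subTset => x _ i _.
Qed.

Lemma sub_gen_cylinders J : <<s sub_gen J >> `<=` <<s cylinders J >>.
Proof.
apply: smallest_sub; first exact: smallest_sigma_algebra.
move=> A [i iJ [B mB <-]]; apply: sub_sigma_algebra.
exists (fun k => if k == i then B else setT); split.
  by move=> k; case: ifP.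
apply/seteqP; split=> x.
  by move=> [_ xB] k kJ /=; case: ifPn => [/eqP ->|].
by move=> /(_ i iJ) /=; rewrite eqxx => ?; split.
Qed.

Hypothesis indep : mutually_independent Y.

Lemma cylinders_indep J1 J2 A B : disjS (J1) (J2) ->
  cylinders J1 A -> cylinders J2 B -> P (A `&` B) = (P A * P B)%E.
Proof.
move=> dis [B1 [mB1 ->]] [B2 [mB2 ->]].
pose C i := if i \in J1 then B1 i else B2 i.
have mB i : measurable (C i) by rewrite /C; case: ifP.
rewrite (indep J1 mB1) (indep J2 mB2).
have -> : (\bigcap_(i in [set i | i \in J1]) Y i @^-1` B1 i) `&`
    (\bigcap_(i in [set i | i \in J2]) Y i @^-1` B2 i) =
    \bigcap_(i in [set i | i \in (J1 :|: J2)%SET]) Y i @^-1` C i.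
  apply/seteqP; split=> x.
    move=> [h1 h2] i /=; rewrite inE /C => /orP[iJ|iJ].
      by rewrite iJ; exact: h1.
    have /negbTE -> : i \notin J1 by rewrite (disjointFl dis).
    exact: h2.
  move=> h; split=> i /= iJ.
    by have := h i; rewrite /= inE iJ => /(_ isT); rewrite /C iJ.
  have := h i; rewrite /= inE iJ orbT => /(_ isT); rewrite /C.
  by rewrite (disjointFl dis).
rewrite (indep _ mB) (eq_bigl [predU J1 & J2]); last by move=> i; rewrite !inE.
rewrite bigU//=; congr (_ * _)%E; apply: eq_bigr => i iJ; rewrite /C.
  by rewrite iJ.
by rewrite (disjointFl dis).
Qed.

(** From the product rule for cylinders to generated sigma-algebras: for a fixed
    event on one side, both members of the rule are measures in the other event
    that agree on a generating pi-system. The argument is applied on each side in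
    turn. *)
Lemma groups_indep J1 J2 A B : disjS (J1) (J2) ->
  <<s sub_gen J1 >> A -> <<s sub_gen J2 >> B -> P (A `&` B) = (P A * P B)%E.
Proof.
move=> dis sA sB.
have step1 C : cylinders J2 C -> P (A `&` C) = (P A * P C)%E.
  move=> cC; have mC := cylinders_measurable cC.
  have fC : P C \is a fin_num by exact: fin_num_measure.
  have c0 : (0 <= fine (P C))%R by exact: fine_ge0.
  rewrite -[LHS]/(mrestr P mC A).
  rewrite [RHS]muleC -(fineK fC) -[RHS]/(mscale (NngNum c0) P A).
  apply: (@g_sigma_algebra_measure_unique _ _ _ (cylinders J1)
    (@cylinders_measurable J1) (fun=> setT)) => //.
  - by move=> _; exact: cylinders_setT.
  - by rewrite bigcup_const//; exists 0%N.
  - exact: cylindersI.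
  - move=> D cD; change (P (D `&` C) = ((fine (P C))%:E * P D)%E).
    rewrite (fineK fC) muleC.
    exact: (cylinders_indep dis cD cC).
  - move=> _; change (P (setT `&` C) < +oo)%E; rewrite setTI.
    by rewrite (le_lt_trans (probability_le1 _ _))// ltry.
  - exact: sub_gen_cylinders.
have mA := sigma_sub_gen_measurable sA.
have fA : P A \is a fin_num by exact: fin_num_measure.
have c0 : (0 <= fine (P A))%R by exact: fine_ge0.
rewrite setIC -[LHS]/(mrestr P mA B).
rewrite -(fineK fA) -[RHS]/(mscale (NngNum c0) P B).
apply: (@g_sigma_algebra_measure_unique _ _ _ (cylinders J2)
  (@cylinders_measurable J2) (fun=> setT)) => //.
- by move=> _; exact: cylinders_setT.
- by rewrite bigcup_const//; exists 0%N.
- exact: cylindersI.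
- move=> D cD; change (P (D `&` A) = ((fine (P A))%:E * P D)%E).
  rewrite (fineK fA) setIC.
  exact: step1.
- move=> _; change (P (setT `&` A) < +oo)%E; rewrite setTI.
  by rewrite (le_lt_trans (probability_le1 _ _))// ltry.
- exact: sub_gen_cylinders.
Qed.

Lemma SJ_id J : measurable_fun setT (idfun : T -> SJ J).
Proof.
move=> _ A mA; rewrite setTI; exact: (@sigma_sub_gen_measurable J A mA).
Qed.

Lemma SJ_Y J i : i \in J -> measurable_fun setT (Y i : SJ J -> R).
Proof.
move=> iJ _ B mB; rewrite setTI; apply: sub_sigma_algebra.
by exists i => //; exists B => //; rewrite setTI.
Qed.

Lemma SJ_sub J J' dd (V : measurableType dd) (f : T -> V) : J \subset J' ->
  measurable_fun setT (f : SJ J -> V) -> measurable_fun setT (f : SJ J' -> V).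
Proof.
move=> JJ mf mT A mA; rewrite setTI.
have : <<s sub_gen J >> (f @^-1` A).
  by have := mf measurableT A mA; rewrite setTI.
apply: smallest_sub; first exact: smallest_sigma_algebra.
move=> B [i iJ hB]; apply: sub_sigma_algebra; exists i => //.
exact: (fintype.subsetP JJ).
Qed.

Lemma SJ_T J dd (V : measurableType dd) (f : T -> V) :
  measurable_fun setT (f : SJ J -> V) -> measurable_fun setT f.
Proof.
by move=> mf; have := measurableT_comp mf (@SJ_id J).
Qed.

Local Open Scope ereal_scope.

(** Decoupling with the identity maps from the sample space to its two
    sub-sigma-algebras. *)
Lemma decouple_groups J1 J2 (F : SJ J1 * SJ J2 -> \bar R) : disjS (J1) (J2) ->
  measurable_fun setT F -> (forall x, 0 <= F x) ->
  \int[P]_w F (w, w) = \int[P]_w1 \int[P]_w2 F (w1, w2).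
Proof.
move=> dis mF F0.
apply: (@decouple _ _ _ P _ _ (SJ J1) (SJ J2) idfun idfun F) => //.
- exact: SJ_id.
- exact: SJ_id.
- move=> A B mA mB; exact: groups_indep dis mA mB.
Qed.

Lemma expectation_mul J1 J2 (f g : T -> \bar R) : disjS (J1) (J2) ->
  measurable_fun setT (f : SJ J1 -> \bar R) ->
  measurable_fun setT (g : SJ J2 -> \bar R) ->
  (forall w, 0 <= f w) -> (forall w, 0 <= g w) ->
  \int[P]_w (f w * g w) = (\int[P]_w f w) * \int[P]_w g w.
Proof.
move=> dis mf mg f0 g0.
have mfT := SJ_T mf; have mgT := SJ_T mg.
rewrite (@decouple_groups J1 J2 (fun x => f x.1 * g x.2) dis); last 2 first.
- apply: emeasurable_funM.
    exact: (measurableT_comp mf).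
  exact: (measurableT_comp mg).
- by move=> x; exact: mule_ge0.
transitivity (\int[P]_w1 ((\int[P]_w g w) * f w1)).
  apply: eq_integral => w1 _.
  by rewrite [RHS]muleC -(integral_scale P (f0 w1) mgT g0).
rewrite integral_scale// 1?muleC//.
exact: integral_ge0.
Qed.

Lemma expectation_prod (K : finType) (J_ : K -> {set I}) (f : K -> T -> R) (r : seq K) :
  uniq r ->
  (forall k l, k != l -> disjS (J_ k) (J_ l)) ->
  (forall k, measurable_fun setT (f k : SJ (J_ k) -> R)) ->
  (forall k w, (0 <= f k w)%R) ->
  \int[P]_w (\prod_(k <- r) f k w)%:E = \prod_(k <- r) \int[P]_w (f k w)%:E.
Proof.
move=> ur dis mf f0; elim: r ur => [_|k r IH /= /andP[kr ur]].
  rewrite big_nil; under eq_integral do rewrite big_nil.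
  by rewrite integral_cst//= probability_setT mule1.
rewrite big_cons -(IH ur).
under eq_integral do rewrite big_cons EFinM.
apply: (@expectation_mul (J_ k) (\bigcup_(l in r) J_ l)%SET).
- apply/finset.bigcup_disjointP => l lr; apply: dis.
  by apply: contraNneq kr => ->.
- exact/measurable_EFinP.
- apply/measurable_EFinP.
  apply: (@measurable_prod _ (SJ (\bigcup_(l in r) J_ l)%SET)) => l lr.
  by apply: (SJ_sub _ (mf l)); exact: (finset.bigcup_sup l).
- by move=> w; rewrite lee_fin.
- by move=> w; rewrite lee_fin prodr_ge0.
Qed.

Variable s : I -> R.
Hypothesis s0 : forall i, s i != 0%R.
Hypothesis law : forall i (B : set R), measurable B ->
  distribution P (Y i) B = normal_prob 0 (s i) B.

Lemma law_integral i (f : R -> \bar R) : measurable_fun setT f ->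
  (forall x, 0 <= f x) ->
  \int[P]_w f (Y i w) = \int[normal_prob 0 1]_x f (s i * x)%R.
Proof.
move=> mf f0.
have mY : measurable_fun setT (Y i : T -> measurableTypeR R).
  exact: (@measurable_funPT _ _ _ _ (Y i)).
transitivity (\int[pushforward P (Y i : T -> measurableTypeR R)]_x f x).
  by rewrite (ge0_integral_pushforward mY P (f := f)).
transitivity (\int[normal_prob 0 (s i)]_x f x).
  apply: (@eq_measure_integral _ (measurableTypeR R) R setT
    (normal_prob 0 (s i)) (pushforward P (Y i : T -> measurableTypeR R))).
  by move=> A mA _; exact: law.
rewrite (integral_normal_gauss 0 (s0 i) mf f0).
by apply: eq_integral => x _; rewrite addr0.
Qed.

(** Induction on the list: decouple one summand from the rest, and merge the two
    Gaussian variables by [gauss_rotation]. *)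
Lemma law_lincomb (a : I -> R) (r : seq I) (f : R -> \bar R) : uniq r ->
  measurable_fun setT f -> (forall x, 0 <= f x) ->
  \int[P]_w f (\sum_(i <- r) a i * Y i w)%R =
  \int[normal_prob 0 1]_x f (Num.sqrt (\sum_(i <- r) (a i * s i) ^+ 2) * x)%R.
Proof.
move=> ur; elim: r ur f => [_|i r IH /= /andP[ir ur]] f mf f0.
  under eq_integral do rewrite big_nil.
  under [RHS]eq_integral do rewrite big_nil sqrtr0 mul0r.
  by rewrite !integral_cst//= !probability_setT.
set t := Num.sqrt (\sum_(j <- r) (a j * s j) ^+ 2).
pose F (x : SJ [set i]%SET * SJ [set j in r]%SET) :=
  f (a i * Y i x.1 + \sum_(j <- r) a j * Y j x.2)%R.
have mr : measurable_fun setT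
  ((fun w => \sum_(j <- r) a j * Y j w)%R : SJ [set j in r]%SET -> R).
  apply: (@measurable_sum_in _ (SJ [set j in r]%SET)) => j jr.
  by apply: measurable_funM => //; apply: SJ_Y; rewrite inE.
have mF : measurable_fun setT F.
  apply: (measurableT_comp mf); apply: measurable_funD.
    apply: measurable_funM => //.
    have mi : measurable_fun setT (Y i : SJ [set i]%SET -> R).
      by apply: SJ_Y; rewrite inE.
    exact: (measurableT_comp mi).
  exact: (measurableT_comp mr).
transitivity (\int[P]_w F (w, w)).
  by apply: eq_integral => w _; rewrite big_cons.
have dis : disjS ([set i]%SET) ([set j in r]%SET).
  by rewrite disjoints1 inE.
rewrite (decouple_groups dis mF (fun x => f0 _)).
have mshift (c : R) : measurable_fun setT (fun x => f (c + x)%R).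
  by apply: (measurableT_comp mf); exact: measurable_funD.
transitivity (\int[P]_w1 \int[normal_prob 0 1]_x f (a i * Y i w1 + t * x)%R).
  apply: eq_integral => w1 _.
  exact: (IH ur (fun x => f (a i * Y i w1 + x)%R) (mshift _) (fun x => f0 _)).
pose G (y : R) := \int[normal_prob 0 1]_x f (a i * y + t * x)%R.
have mG2 : measurable_fun setT (fun yx : R * R => f (a i * yx.1 + t * yx.2)%R).
  apply: (measurableT_comp mf); apply: measurable_funD;
    by apply: measurable_funM.
have mG : measurable_fun setT G.
  exact: (@measurable_fun_fubini_tonelli_F _ _ R (measurableTypeR R) R (normal_prob 0 1) _ mG2 (fun x => f0 _)).
have G0 y : 0 <= G y by exact: integral_ge0.
rewrite (law_integral i mG G0) /G.
rewrite big_cons addrC.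
have tt : ((\sum_(j <- r) (a j * s j) ^+ 2) = t ^+ 2)%R.
  by rewrite sqr_sqrtr// sumr_ge0// => j _; exact: sqr_ge0.
rewrite tt -(gauss_rotation t (a i * s i) mf f0).
apply: eq_integral => y _; apply: eq_integral => x _.
by rewrite mulrA addrC.
Qed.

End Groups.

(** * Concentration of sums of squares *)


Section Markov.
Context d (T : measurableType d) (R : realType) (P : probability T R).

Lemma markov_ge0 (F : T -> R) (a b : R) : 0 < a ->
  measurable_fun setT F -> (forall w, 0 <= F w) ->
  (\int[P]_w (F w)%:E <= b%:E)%E ->
  (P [set w | (a <= F w)%R] <= (b / a)%:E)%E.
Proof.
move=> a0 mF F0 Fb.
have mA : measurable [set w | a <= F w].
  rewrite -[X in measurable X]setTI.
  rewrite (_ : [set w | _] = F @^-1` `[a, +oo[).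
    exact: mF.
  by apply/seteqP; split => w; rewrite /= in_itv/= andbT.
have h : (a%:E * P [set w | (a <= F w)%R] <= b%:E)%E.
  apply: le_trans Fb.
  have i0 w : (0%E <= (\1_[set w | (a <= F w)%R] w : R)%:E)%E by rewrite lee_fin.
  have -> : P [set w | (a <= F w)%R] =
      (\int[P]_w (\1_[set w | (a <= F w)%R] w)%:E)%E.
    by rewrite integral_indic// setIT.
  rewrite -(integral_scale P (ltW _ : 0%E <= a%:E)%E (measurable_indicE mA) i0)//.
  apply: ge0_le_integral => //.
  - by move=> w _; rewrite -EFinM lee_fin mulr_ge0// ltW.
  - by apply: emeasurable_funM => //; exact: measurable_indicE.
  - exact/measurable_EFinP.
  - move=> w _; rewrite -EFinM lee_fin indicE.
    case: (boolP (w \in _)); last by rewrite mulr0.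
    by rewrite inE/= mulr1.
have fP : P [set w | (a <= F w)%R] \is a fin_num by exact: fin_num_measure.
move: h; rewrite -(fineK fP) -EFinM !lee_fin => h.
by rewrite ler_pdivlMr// mulrC.
Qed.

End Markov.

(** Linear forms in disjoint groups of independent centred Gaussian variables, all
    of the same variance v. They cover both the coordinates of A u, whose groups
    are the rows, and the correlations of the columns with u, whose groups are
    the columns. *)
Section LinForms.
Context d (T : measurableType d) (R : realType) (P : probability T R).
Variables (I K : finType) (Y : I -> {RV P >-> R}).
Hypothesis indep : mutually_independent Y.
Variable s : I -> R.
Hypothesis s0 : forall i, s i != 0%R.
Hypothesis law : forall i (B : set R), measurable B ->
  distribution P (Y i) B = normal_prob 0 (s i) B.
Variables (r : K -> seq I) (a : I -> R) (v : R).
Hypothesis ur : forall k, uniq (r k).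
Hypothesis dis : forall k l, k != l -> disjS [set x in r k]%SET [set x in r l]%SET.
Hypothesis var : forall k, \sum_(i <- r k) (a i * s i) ^+ 2 = v.

Definition linform k w : R := \sum_(i <- r k) a i * Y i w.

Lemma linform_SJ k :
  measurable_fun setT (linform k : SJ Y [set x in r k]%SET -> R).
Proof.
apply: (@measurable_sum_in _ (SJ Y [set x in r k]%SET)) => i ir.
by apply: measurable_funM => //; apply: SJ_Y; rewrite inE.
Qed.

Lemma linform_prod (g : K -> R -> R) (ks : seq K) : uniq ks ->
  (forall k, measurable_fun setT (g k)) -> (forall k x, 0 <= g k x) ->
  (\int[P]_w (\prod_(k <- ks) g k (linform k w))%:E =
   \prod_(k <- ks) \int[normal_prob 0 1]_x (g k (Num.sqrt v * x))%:E)%E.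
Proof.
move=> uks mg g0.
rewrite (@expectation_prod _ _ _ P I Y indep K
  (fun k => [set x in r k]%SET) (fun k w => g k (linform k w)))//.
  apply: eq_bigr => k _; rewrite -(var k).
  apply: (law_lincomb indep s0 law a (f := fun x => (g k x)%:E) (ur k)).
    exact/measurable_EFinP.
  by move=> x; rewrite lee_fin.
by move=> k; apply: (measurableT_comp (mg k)); exact: linform_SJ.
Qed.

Hypothesis v0 : 0 < v.

(** The linear forms use disjoint groups of variables, so the exponential moment of
    the sum of squares factors. *)
Lemma chi2_mgf (t : R) : `|t| <= 1 / 8 ->
  (\int[P]_w (expR (t / v * \sum_k linform k w ^+ 2))%:E <=
   (expR (#|K|%:R * (t + 2 * t ^+ 2)))%:E)%E.
Proof.
move=> t8.
have E w : expR (t / v * \sum_k linform k w ^+ 2) =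
    \prod_(k <- index_enum K) expR (t / v * linform k w ^+ 2).
  by rewrite mulr_sumr expR_sum.
under eq_integral do rewrite E.
have mg (k : K) : measurable_fun setT (fun x : R => expR (t / v * x ^+ 2)).
  apply: (measurableT_comp (@measurable_expR R)).
  by apply: measurable_funM => //; exact: measurable_funX.
have g0 (k : K) (x : R) : 0 <= expR (t / v * x ^+ 2) by exact: expR_ge0.
rewrite (linform_prod (index_enum_uniq K) mg g0).
have one : (\int[normal_prob 0 1]_x (expR (t / v * (Num.sqrt v * x) ^+ 2))%:E
    <= (expR (t + 2 * t ^+ 2))%:E)%E.
  apply: le_trans (gauss_expR_sqr_le t8).
  rewrite le_eqVlt; apply/orP; left; apply/eqP; apply: eq_integral => x _.
  by rewrite exprMn sqr_sqrtr ?ltW// mulrA divfK// gt_eqF.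
apply: (@le_trans _ _ (\prod_(k <- index_enum K) (expR (t + 2 * t ^+ 2))%:E)%E).
  elim: (index_enum K) => [|k l IH]; first by rewrite !big_nil.
  rewrite !big_cons; apply: lee_pmul => //.
    by apply: integral_ge0 => x _; rewrite lee_fin expR_ge0.
  elim: l {IH} => [|k' l IH]; rewrite ?big_nil ?lee_fin// big_cons mule_ge0//.
  by apply: integral_ge0 => x _; rewrite lee_fin expR_ge0.
rewrite prodEFin lee_fin prodr_const.
by rewrite -expRM_natl.
Qed.

Let N : R := #|K|%:R.
Let Q w := \sum_k linform k w ^+ 2.

Let mQ : measurable_fun setT Q.
Proof.
apply: measurable_sum => k; apply: measurable_funX.
exact: SJ_T (@linform_SJ k).
Qed.

Let mE (t : R) : measurable_fun setT (fun w => expR (t / v * Q w)).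
Proof. by apply: (measurableT_comp (@measurable_expR R)); exact: measurable_funM. Qed.

(** Chernoff bound at the exponent dl / 4. *)
Lemma chi2_upper (dl : R) : 0 < dl -> dl <= 1/2 ->
  (P [set w | ((1 + dl) * N * v <= \sum_k linform k w ^+ 2)%R] <=
   (expR (- (dl ^+ 2 / 8 * N)))%:E)%E.
Proof.
move=> d0 d1; pose t := dl / 4.
have t8 : `|t| <= 1 / 8 by rewrite ger0_norm /t; lra.
have := markov_ge0 (expR_gt0 (t * (1 + dl) * N)) (mE t) (fun w => expR_ge0 _) (chi2_mgf t8).
rewrite -expRB => h; apply: le_trans (_ : _ <= _)%E _; last first.
  apply: (le_trans h); rewrite lee_fin ler_expR -/N le_eqVlt; apply/orP; left.
  by apply/eqP; rewrite /t; field.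
rewrite le_eqVlt; apply/orP; left; apply/eqP; congr (P _).
apply/seteqP; split => w /=; rewrite ler_expR.
  move=> hw; rewrite -/(Q w) in hw.
  have : (1 + dl) * N <= Q w / v by rewrite ler_pdivlMr.
  by move=> /(@ler_wpM2l _ t); rewrite mulrA => /(_ _); rewrite [_ / v * _]mulrAC mulrA; apply; rewrite /t; lra.
move=> hw; rewrite -/(Q w) -ler_pdivlMr//.
have t0 : 0 < t by rewrite /t; lra.
by rewrite -(ler_pM2l t0) mulrA (mulrA t) [t * Q w / v]mulrAC.
Qed.

Lemma chi2_lower (dl : R) : 0 < dl -> dl <= 1/2 ->
  (P [set w | (\sum_k linform k w ^+ 2 <= (1 - dl) * N * v)%R] <=
   (expR (- (dl ^+ 2 / 8 * N)))%:E)%E.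
Proof.
move=> d0 d1; pose t := dl / 4.
have t8 : `|- t| <= 1 / 8 by rewrite normrN ger0_norm /t; lra.
have := markov_ge0 (expR_gt0 (- t * (1 - dl) * N)) (mE (- t)) (fun w => expR_ge0 _) (chi2_mgf t8).
rewrite -expRB => h; apply: le_trans (_ : _ <= _)%E _; last first.
  apply: (le_trans h); rewrite lee_fin ler_expR -/N le_eqVlt; apply/orP; left.
  by apply/eqP; rewrite /t; field.
have t0 : 0 < t by rewrite /t; lra.
have key w : (- t * (1 - dl) * N <= - t / v * Q w) = (Q w <= (1 - dl) * N * v).
  rewrite !mulNr lerN2 [t / v * _]mulrAC -!mulrA ler_pM2l// mulrA.
  by rewrite ler_pdivrMr// -!mulrA ler_pM2l// invr_gt0.
rewrite le_eqVlt; apply/orP; left; apply/eqP; congr (P _).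
by apply/seteqP; split => w /=; rewrite ler_expR -/(Q w) key.
Qed.

End LinForms.

(** * Restricted isometry of the Gaussian design *)


Section Net.
Context {R : realType}.
Variables (p s N : nat).
Hypotheses (s_gt0 : (0 < s)%N) (N_gt0 : (0 < N)%N).

Let NR : 0 < N%:R :> R. Proof. by rewrite ltr0n. Qed.

(** A net point is coded by s pairs (coordinate, grid level); the level m stands for
    m / N - 1, so that level N contributes 0 and serves as padding. The code
    counts the net without discussing supports. *)
Definition net_index := {ffun 'I_s -> 'I_p * 'I_(2 * N).+1}.

Definition net_vec (f : net_index) : 'cV[R]_p :=
  \col_j \sum_(l | (f l).1 == j) ((f l).2%:R / N%:R - 1).

(** The grid of step 1 / N approximates every s-sparse vector with entries in
    [-1, 1] from below on its support, and exactly outside. *)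
Lemma net_round (h : 'cV[R]_p) : (0 < p)%N -> (#|supp h| <= s)%N ->
  (forall j, `|h j ord0| <= 1) ->
  exists f, forall j, 0 <= h j ord0 - net_vec f j ord0 <= N%:R^-1 /\
    (j \notin supp h -> net_vec f j ord0 = 0).
Proof.
move=> p0 hs h1; pose j0 := Ordinal p0; pose e := enum (supp h).
have e_s : (size e <= s)%N by rewrite -cardE.
pose a j := Num.truncn ((h j ord0 + 1) * N%:R).
have aP j : (a j)%:R <= (h j ord0 + 1) * N%:R < (a j).+1%:R.
  apply: truncn_itv; rewrite mulr_ge0// ?(ltW NR)//.
  by have := h1 j; rewrite ler_norml => /andP[+ _]; lra.
have a2 j : (a j < (2 * N).+1)%N.
  rewrite ltnS -(ler_nat R) natrM; have /andP[ha _] := aP j.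
  apply: (le_trans ha); rewrite ler_wpM2r// ?(ltW NR)//.
  by have := h1 j; rewrite ler_norml => /andP[_]; lra.
have N2 : (N < (2 * N).+1)%N by rewrite ltnS leq_pmull.
pose f : net_index := [ffun l : 'I_s => if (l < size e)%N
  then (nth j0 e l, Ordinal (a2 (nth j0 e l))) else (j0, Ordinal N2)].
have f2 (l : 'I_s) : ~~ (l < size e)%N -> ((f l).2%:R / N%:R - 1 : R) = 0.
  by move=> /negbTE el; rewrite /f ffunE el/= divff ?subrr// gt_eqF.
exists f => j; rewrite mxE.
have [jS|jS] := boolP (j \in supp h); last first.
  have -> : \sum_(l | (f l).1 == j) ((f l).2%:R / N%:R - 1 : R) = 0.
    rewrite big1// => l; case: (boolP (l < size e)%N) => [le|/f2 ->//].
    rewrite /f ffunE le/= => /eqP ej; move: jS; rewrite -ej.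
    by rewrite -mem_enum mem_nth.
  move: jS; rewrite inE negbK => /eqP ->; rewrite subr0 lexx invr_ge0.
  by split; [rewrite ltW|].
have je : (index j e < size e)%N by rewrite index_mem mem_enum.
pose l0 := Ordinal (leq_trans je e_s).
have fl0 : f l0 = (j, Ordinal (a2 j)).
  by rewrite /f ffunE /= je nth_index// mem_enum.
have z : \sum_(l | ((f l).1 == j) && (l != l0)) ((f l).2%:R / N%:R - 1 : R) = 0.
  rewrite big1// => l /andP[/eqP fl ll0].
  case: (boolP (l < size e)%N) => [le|/f2 ->//].
  move: fl; rewrite /f ffunE le/= => fl.
  exfalso; move/eqP: ll0; apply; apply/val_inj => /=.
  by rewrite -fl index_uniq// enum_uniq.
rewrite (bigD1 l0) ?fl0//= z addr0.
split; last by [].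
have /andP[lo hi] := aP j.
have -> : h j ord0 - ((a j)%:R / N%:R - 1) =
    ((h j ord0 + 1) * N%:R - (a j)%:R) / N%:R.
  by field; rewrite gt_eqF.
apply/andP; split; first by rewrite divr_ge0 ?(ltW NR) ?subr_ge0.
rewrite ler_pdivrMr// mulVf ?gt_eqF//.
by move: hi; rewrite -natr1 => hi; lra.
Qed.

(** The unit vectors belong to the net, so that the columns of A have controlled
    norms. *)
Lemma net_delta (j : 'I_p) : exists f, net_vec f = delta_mx j ord0.
Proof.
have N2 : (N < (2 * N).+1)%N by rewrite ltnS leq_pmull.
pose l0 := Ordinal s_gt0.
exists [ffun l => if l == l0 then (j, ord_max) else (j, Ordinal N2)].
apply/colP => i; rewrite !mxE eqxx andbT.
have [->|ij] := eqVneq i j.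
  rewrite (bigD1 l0) ?ffunE ?eqxx//= big1 ?addr0.
    by rewrite natrM mulfK ?gt_eqF//; lra.
  by move=> l /andP[_ ll]; rewrite ffunE (negbTE ll)/= divff ?subrr// gt_eqF.
by rewrite big1// => l; rewrite ffunE; case: ifP => _ /=; rewrite eq_sym (negbTE ij).
Qed.

(** Near isometry on the net passes to all s-sparse vectors. By homogeneity take h of
    norm 1 and round it to a net point; the rounding error e has l1 norm at most
    s / N <= dl, and since the columns of A have norm at most 1 + dl, the image
    of e is as small as e. *)
Lemma net_rip n (A : 'M[R]_(n, p)) (dl : R) : 0 < dl -> dl <= 1/4 ->
  s%:R <= dl * N%:R ->
  (forall f, (1 - dl) * dot (net_vec f) (net_vec f) <=
      dot (A *m net_vec f) (A *m net_vec f) /\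
      dot (A *m net_vec f) (A *m net_vec f) <=
      (1 + dl) * dot (net_vec f) (net_vec f)) ->
  forall h : 'cV[R]_p, (#|supp h| <= s)%N ->
  (1 - 4 * dl) * enorm h <= enorm (A *m h) /\
  enorm (A *m h) <= (1 + 4 * dl) * enorm h.
Proof.
move=> d0 d4 sN hnet.
have up f : enorm (A *m net_vec f) <= (1 + dl) * enorm (net_vec f).
  have d1 : 0 <= 1 + dl by lra.
  rewrite -ler_sqr ?nnegrE ?mulr_ge0 ?enorm_ge0// exprMn !enorm_sqr.
  apply: (le_trans (hnet f).2); rewrite ler_wpM2r ?dot_ge0//; nra.
have lo f : (1 - dl) * enorm (net_vec f) <= enorm (A *m net_vec f).
  have d1 : 0 <= 1 - dl by lra.
  rewrite -ler_sqr ?nnegrE ?mulr_ge0 ?enorm_ge0// exprMn !enorm_sqr.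
  apply: le_trans (hnet f).1; rewrite ler_wpM2r ?dot_ge0//; nra.
have colA j : enorm (A *m delta_mx j ord0) <= 1 + dl.
  have [f fE] := net_delta j; have := up f; rewrite fE.
  have -> : enorm (delta_mx j ord0 : 'cV[R]_p) = 1.
    rewrite enormE /dot (bigD1 j)//= big1 ?addr0.
      by rewrite mxE !eqxx mulr1 sqrtr1.
    by move=> i /negbTE ij; rewrite mxE ij mul0r.
  by rewrite mulr1.
have unit h : (#|supp h| <= s)%N -> enorm h = 1 ->
    1 - 4 * dl <= enorm (A *m h) /\ enorm (A *m h) <= 1 + 4 * dl.
  move=> hs h1.
  have p0 : (0 < p)%N.
    rewrite lt0n; apply/eqP => p0; move: h1.
    have -> : h = 0 by apply/colP => -[i ip]; exfalso; move: ip; rewrite p0.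
    by rewrite enorm0 => /esym/eqP; rewrite oner_eq0.
  have hle j : `|h j ord0| <= 1 by rewrite -h1 coord_le_enorm.
  have [f fP] := net_round p0 hs hle.
  set u := net_vec f in fP; pose e := h - u.
  have eE j : e j ord0 = h j ord0 - u j ord0 by rewrite !mxE.
  have e_l1 : \sum_j `|e j ord0| <= dl.
    apply: (@le_trans _ _ (\sum_(j in supp h) N%:R^-1)).
      rewrite [leRHS]big_mkcond ler_sum// => j _; have [/andP[g1 g2] g3] := fP j.
      case: ifPn => jS; first by rewrite eE ger0_norm.
      rewrite eE g3//; move: jS; rewrite inE negbK => /eqP ->.
      by rewrite subr0 normr0.
    rewrite sumr_const -[leLHS]mulr_natl ler_pdivrMr//.
    by apply: le_trans sN; rewrite ler_nat.
  have e_sum : e = \sum_j e j ord0 *: delta_mx j ord0.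
    apply/colP => i; rewrite summxE (bigD1 i)//= big1 ?addr0.
      by rewrite !mxE !eqxx mulr1.
    by move=> j /negbTE ij; rewrite !mxE eq_sym ij mulr0.
  have e_norm : enorm e <= dl.
    apply: le_trans e_l1; rewrite [in leLHS]e_sum.
    apply: (le_trans (enorm_sum _ _ _)); apply: ler_sum => j _.
    rewrite enormZ -[leRHS]mulr1 ler_wpM2l//.
    rewrite enormE /dot (bigD1 j)//= big1 ?addr0.
      by rewrite mxE !eqxx mulr1 sqrtr1.
    by move=> i /negbTE ij; rewrite mxE ij mul0r.
  have Ae : enorm (A *m e) <= (1 + dl) * dl.
    rewrite [in leLHS]e_sum mulmx_sumr.
    apply: (le_trans (enorm_sum _ _ _)).
    apply: (@le_trans _ _ (\sum_j (1 + dl) * `|e j ord0|)).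
      apply: ler_sum => j _; rewrite -scalemxAr enormZ mulrC.
      by rewrite ler_wpM2r.
    by rewrite -mulr_sumr ler_wpM2l//; lra.
  have hE : h = u + e by rewrite addrC subrK.
  have uu : enorm u <= 1 + dl.
    have -> : u = h - e by rewrite hE addrK.
    by rewrite (le_trans (enormB _ _))// h1 lerD2l.
  have ul : 1 - dl <= enorm u.
    by have := enormD u e; rewrite -hE h1; lra.
  have A1 := enormD (A *m u) (A *m e); have A2 := enormB (A *m h) (A *m e).
  rewrite -mulmxDr -hE in A1.
  have hu : A *m h - A *m e = A *m u by rewrite -mulmxBr hE addrK.
  rewrite hu in A2.
  have upf := up f; have lof := lo f; rewrite -/u in upf lof.
  by split; nra.
move=> h hs; have [->|hN0] := eqVneq h 0.
  by rewrite mulmx0 !enorm0 !mulr0 lexx.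
have hpos : 0 < enorm h.
  rewrite lt_neqAle enorm_ge0 andbT eq_sym; apply: contraNneq hN0 => /enorm_eq0 ->.
  exact: eqxx.
have := unit ((enorm h)^-1 *: h).
have -> : supp ((enorm h)^-1 *: h) = supp h.
  by apply/finset.setP => j; rewrite !inE mxE mulf_eq0 invr_eq0 gt_eqF.
rewrite enormZ ger0_norm ?invr_ge0 ?enorm_ge0// mulVf ?gt_eqF// => /(_ hs erefl).
rewrite -scalemxAr enormZ ger0_norm ?invr_ge0 ?enorm_ge0//.
by rewrite ler_pdivlMl// ler_pdivrMl// ![enorm h * _]mulrC.
Qed.

End Net.

Section RipProb.
Context d (T : measurableType d) (R : realType) (P : probability T R).
Variables (n p : nat) (X : 'I_n * 'I_p -> {RV P >-> R}).
Hypothesis n_gt0 : (0 < n)%N.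
Hypothesis X_iid : iid_normal 0 (Num.sqrt n%:R^-1) X.

Let nR : 0 < n%:R :> R. Proof. by rewrite ltr0n. Qed.
Let s0 (i : 'I_n * 'I_p) : Num.sqrt n%:R^-1 != 0 :> R.
Proof. by rewrite gt_eqF// sqrtr_gt0 invr_gt0. Qed.

Let rowseq (i : 'I_n) := [seq (i, j) | j <- enum 'I_p].

Lemma measureU_le (F : finType) (rr : seq F) (B : F -> set T) (b : R) :
  (forall f, measurable (B f)) -> (forall f, (P (B f) <= b%:E)%E) ->
  measurable (\big[setU/set0]_(f <- rr) B f) /\
  (P (\big[setU/set0]_(f <- rr) B f) <= ((size rr)%:R * b)%:E)%E.
Proof.
move=> mB Pb; elim: rr => [|f rr [mU IH]].
  by rewrite big_nil measure0 /= mul0r.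
rewrite big_cons; split; first exact: measurableU.
apply: (@le_trans _ _ (P (B f) + P (\big[setU/set0]_(f <- rr) B f))%E).
  exact: measureU2.
by rewrite /= -natr1 mulrDl mul1r addrC EFinD leeD.
Qed.

Lemma design_mul (u : 'cV[R]_p) i w :
  (design X w *m u) i ord0 = \sum_(x <- rowseq i) u x.2 ord0 * X x w.
Proof.
rewrite mxE /rowseq big_map big_enum/=; apply: eq_bigr => j _.
by rewrite mxE mulrC.
Qed.

(** The coordinates of A u are linear forms in distinct rows with variance
    |u|^2 / n, so that |A u|^2 is a chi-square variable. *)
Lemma design_concentration (u : 'cV[R]_p) (dl : R) : 0 < dl -> dl <= 1/2 ->
  exists2 B : set T, measurable B &
    (P B <= (2 * expR (- (dl ^+ 2 / 8 * n%:R)))%:E)%E /\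
    forall w, ~ B w ->
      (1 - dl) * dot u u <= dot (design X w *m u) (design X w *m u) /\
      dot (design X w *m u) (design X w *m u) <= (1 + dl) * dot u u.
Proof.
move=> d0 d1.
have [u0|uN0] := eqVneq (dot u u) 0.
  exists set0 => //; split.
    by rewrite measure0 lee_fin mulr_ge0// expR_ge0.
  move=> w _; have -> : u = 0 by apply: enorm_eq0; rewrite enormE u0 sqrtr0.
  by rewrite mulmx0 /dot !big1 ?mulr0// => i _; rewrite mxE mul0r.
have up : 0 < dot u u by rewrite lt_neqAle eq_sym uN0 dot_ge0.
pose a (x : 'I_n * 'I_p) := u x.2 ord0.
have ur i : uniq (rowseq i).
  by rewrite map_inj_uniq ?enum_uniq// => x y [].
have dis i l : i != l -> disjS [set x in rowseq i]%SET [set x in rowseq l]%SET.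
  move=> il; rewrite -finset.setI_eq0; apply/eqP/finset.setP => x; rewrite !inE.
  by apply/negP => /andP[/mapP[j _ ->] /mapP[j' _ [/eqP]]]; rewrite (negbTE il).
have var i : \sum_(x <- rowseq i) (a x * Num.sqrt n%:R^-1) ^+ 2 = dot u u / n%:R.
  rewrite /rowseq big_map big_enum/= /dot mulr_suml; apply: eq_bigr => j _.
  by rewrite /a exprMn sqr_sqrtr ?invr_ge0// expr2.
have v0 : 0 < dot u u / n%:R by rewrite divr_gt0.
have law i (B : set R) : measurable B -> distribution P (X i) B =
    normal_prob 0 (Num.sqrt n%:R^-1) B by move=> mB; exact: X_iid.2.
have U := chi2_upper X_iid.1 s0 law ur dis var v0 d0 d1.
have L := chi2_lower X_iid.1 s0 law ur dis var v0 d0 d1.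
have E w : \sum_k linform X rowseq a k w ^+ 2 =
    dot (design X w *m u) (design X w *m u).
  by apply: eq_bigr => i _; rewrite expr2 !design_mul.
have cn : #|'I_n|%:R * (dot u u / n%:R) = dot u u.
  by rewrite card_ord mulrC divfK// gt_eqF.
have mQ : measurable_fun setT (fun w => \sum_k linform X rowseq a k w ^+ 2).
  apply: measurable_sum => k; apply: measurable_funX.
  by apply: measurable_sum => i; apply: measurable_funM.
set B1 := [set w | _] in U; set B2 := [set w | _] in L.
have mB1 : measurable B1.
  rewrite -[X in measurable X]setTI.
  rewrite (_ : B1 = (fun w => \sum_k linform X rowseq a k w ^+ 2) @^-1`
    `[(1 + dl) * #|'I_n|%:R * (dot u u / n%:R), +oo[); first exact: mQ.
  by apply/seteqP; split => w; rewrite /B1/= in_itv/= andbT.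
have mB2 : measurable B2.
  rewrite -[X in measurable X]setTI.
  rewrite (_ : B2 = (fun w => \sum_k linform X rowseq a k w ^+ 2) @^-1`
    `]-oo, (1 - dl) * #|'I_n|%:R * (dot u u / n%:R)]); first exact: mQ.
  by apply/seteqP; split => w; rewrite /B2/= in_itv/=.
exists (B1 `|` B2); first exact: measurableU.
rewrite card_ord in U L; split.
  apply: (le_trans (measureU2 _ mB1 mB2)).
  by rewrite mulr2n mulrDl mul1r EFinD leeD.
move=> w nB; rewrite -E; split; apply/ltW; rewrite ltNge; apply/negP => h; apply: nB.
  by right; rewrite /B2/= -mulrA cn.
by left; rewrite /B1/= -mulrA cn.
Qed.

(** Union bound over the net. *)
Lemma rip_prob (s N : nat) (dl : R) : (0 < s)%N -> (0 < N)%N ->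
  0 < dl -> dl <= 1/4 -> s%:R <= dl * N%:R ->
  exists2 B : set T, measurable B &
    (P B <= ((p * (2 * N).+1)%:R ^+ s * (2 * expR (- (dl ^+ 2 / 8 * n%:R))))%:E)%E /\
    forall w, ~ B w -> forall h : 'cV[R]_p, (#|supp h| <= s)%N ->
      (1 - 4 * dl) * enorm h <= enorm (design X w *m h) /\
      enorm (design X w *m h) <= (1 + 4 * dl) * enorm h.
Proof.
move=> sp Np d0 d4 sN.
have d2 : dl <= 1 / 2 by lra.
have /choice[Bf BfP] : forall f : net_index p s N, exists B : set T,
    [/\ measurable B,
    (P B <= (2 * expR (- (dl ^+ 2 / 8 * n%:R)))%:E)%E &
    forall w, ~ B w -> let u : 'cV[R]_p := net_vec f in
      (1 - dl) * dot u u <= dot (design X w *m u) (design X w *m u) /\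
      dot (design X w *m u) (design X w *m u) <= (1 + dl) * dot u u].
  move=> f; have [B mB [PB hB]] := design_concentration (net_vec f) d0 d2.
  by exists B; split.
have mBf f : measurable (Bf f) by have [] := BfP f.
have PBf f : (P (Bf f) <= (2 * expR (- (dl ^+ 2 / 8 * n%:R)))%:E)%E.
  by have [] := BfP f.
have [mU PU] := measureU_le (enum (net_index p s N)) mBf PBf.
exists (\big[setU/set0]_(f <- enum (net_index p s N)) Bf f) => //; split.
  apply: (le_trans PU); rewrite -cardT card_ffun card_prod !card_ord natrX.
  exact: lexx.
move=> w nB; apply: (net_rip sp Np d0 d4 sN) => f.
have [_ _ hf] := BfP f; apply: hf => hB; apply: nB.
by rewrite -bigcup_seq; exists f => //=; rewrite mem_enum.
Qed.

End RipProb.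

(** * Gaussian correlations: moments, excesses and ranks *)


Section GaussMoments.
Context {R : realType}.
Local Notation gauss := (@normal_prob R 0 1).

Lemma gauss_le (f g : R -> R) (b : R) :
  measurable_fun setT f -> measurable_fun setT g ->
  (forall x, 0 <= f x) -> (forall x, f x <= g x) ->
  (\int[gauss]_x (g x)%:E <= b%:E)%E -> (\int[gauss]_x (f x)%:E <= b%:E)%E.
Proof.
move=> mf mg f0 fg; apply: le_trans.
have mf' : measurable_fun setT (fun x => (f x)%:E) by exact/measurable_EFinP.
have mg' : measurable_fun setT (fun x => (g x)%:E) by exact/measurable_EFinP.
apply: (ge0_le_integral gauss measurableT _ mf' mg').
  by move=> x _; rewrite lee_fin.
by move=> x _; rewrite lee_fin.
Qed.

(** An explicit bound for the second moment, from x^2 <= 8 exp (x^2 / 8). *)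
Definition second_moment : R := 8 * expR (1 / 8 + 2 * (1 / 8) ^+ 2).

Lemma gauss_sqr_le (t M : R) : 0 <= t -> t <= M ->
  (\int[gauss]_x ((t * x) ^+ 2)%:E <= (M ^+ 2 * second_moment)%:E)%E.
Proof.
move=> t0 tM.
have mlin : measurable_fun setT (fun x : R => t * x) by exact: measurable_funM.
have m2 : measurable_fun setT (fun x : R => expR (1 / 8 * x ^+ 2)).
  apply: (measurableT_comp (@measurable_expR R)).
  by apply: measurable_funM => //; exact: measurable_funX.
apply: (@gauss_le _ (fun x => M ^+ 2 * 8 * expR (1 / 8 * x ^+ 2))).
- exact: measurable_funX.
- exact: measurable_funM.
- by move=> x; exact: sqr_ge0.
- move=> x; rewrite exprMn.
  have h := expR_ge1Dx (1 / 8 * x ^+ 2).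
  have x2 : 0 <= x ^+ 2 := sqr_ge0 x.
  have tM2 : t ^+ 2 <= M ^+ 2 by rewrite ler_sqr ?nnegrE// (le_trans t0).
  have M2 : 0 <= M ^+ 2 := sqr_ge0 M.
  rewrite -mulrA; apply: (le_trans (ler_wpM2r x2 tM2)); rewrite ler_wpM2l//; lra.
- under eq_integral do rewrite EFinM.
  have E0 (x : R) : (0%E <= (expR (1 / 8 * x ^+ 2))%:E)%E by rewrite lee_fin expR_ge0.
  have k0 : (0%E <= (M ^+ 2 * 8)%:E)%E by rewrite lee_fin mulr_ge0// sqr_ge0.
  have m2' : measurable_fun setT (fun x : R => (expR (1 / 8 * x ^+ 2))%:E).
    exact/measurable_EFinP.
  have := integral_scale gauss k0 m2' E0 => ->.
  rewrite /second_moment mulrA [X in (_ <= X)%E]EFinM lee_wpmul2l//.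
  by apply: gauss_expR_sqr_le; rewrite ger0_norm; lra.
Qed.

(** Pointwise, max (y, 0)^2 <= 2 / th^2 exp (th y); the exponential moments are
    explicit. *)
Lemma gauss_excess_le (t M ell th : R) : 0 <= t -> t <= M -> 0 < th ->
  (\int[gauss]_x (Num.max (`|t * x| - ell) 0 ^+ 2)%:E <=
   (4 / th ^+ 2 * expR (- (th * ell) + (th * M) ^+ 2 / 2))%:E)%E.
Proof.
move=> t0 tM th0.
have mlin c : measurable_fun setT (fun x : R => c * x) by exact: measurable_funM.
have mexp c : measurable_fun setT (fun x : R => expR (c * x)).
  exact: (measurableT_comp (@measurable_expR R)).
pose K := 2 / th ^+ 2 * expR (- (th * ell)).
have K0 : 0 <= K by rewrite mulr_ge0 ?expR_ge0// divr_ge0// sqr_ge0.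
apply: (@gauss_le _ (fun x => K * (expR (th * t * x) + expR (- (th * t) * x)))).
- apply: measurable_funX; apply: measurable_maxr => //.
  apply: measurable_funB => //.
  by apply: (measurableT_comp _ (mlin t)).
- by apply: measurable_funM => //; exact: measurable_funD.
- by move=> x; exact: sqr_ge0.
- move=> x; set y := `|t * x| - ell.
  have h1 : Num.max y 0 ^+ 2 <= 2 / th ^+ 2 * expR (th * y).
    have th2 : 0 < th ^+ 2 by rewrite exprn_gt0.
    have [y0|y0] := leP y 0; first by rewrite expr0n/= mulr_ge0 ?expR_ge0// divr_ge0// ltW.
    have := @expR_ge1Dxn R (th * y) 1 (mulr_ge0 (ltW th0) (ltW y0)).
    rewrite exprMn (_ : (2`!%:R : R) = 2)// => h.
    rewrite [leRHS]mulrAC ler_pdivlMr//; lra.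
  apply: (le_trans h1); rewrite /K -!mulrA ler_wpM2l//.
  rewrite ler_wpM2l// ?invr_ge0 ?sqr_ge0//.
  have -> : th * y = - (th * ell) + th * `|t * x| by rewrite /y; ring.
  rewrite expRD ler_wpM2l ?expR_ge0//.
  have [tx|tx] := leP 0 (t * x).
    by rewrite ger0_norm// mulrA lerDl expR_ge0.
  by rewrite ltr0_norm// mulrN mulrA mulNr lerDr expR_ge0.
- have D : (\int[gauss]_x (expR (th * t * x) + expR (- (th * t) * x))%:E =
      (2 * expR ((th * t) ^+ 2 / 2))%:E)%E.
    under eq_integral do rewrite EFinD.
    have e0 c (x : R) : (0%E <= (expR (c * x))%:E)%E by rewrite lee_fin expR_ge0.
    have me c : measurable_fun setT (fun x : R => (expR (c * x))%:E).
      exact/measurable_EFinP.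
    rewrite (ge0_integralD gauss measurableT (fun x _ => e0 _ x) (me _)
      (fun x _ => e0 _ x) (me _)).
    by rewrite !gauss_expR_lin sqrrN -EFinD; congr EFin; ring.
  under eq_integral do rewrite EFinM.
  have E0 (x : R) : (0%E <= (expR (th * t * x) + expR (- (th * t) * x))%:E)%E.
    by rewrite lee_fin addr_ge0 ?expR_ge0.
  have k0 : (0%E <= K%:E)%E by rewrite lee_fin.
  have m2' : measurable_fun setT (fun x : R =>
      (expR (th * t * x) + expR (- (th * t) * x))%:E).
    by apply/measurable_EFinP; exact: measurable_funD.
  have := integral_scale gauss k0 m2' E0 => ->.
  rewrite D -EFinM lee_fin /K.
  have -> : 2 / th ^+ 2 * expR (- (th * ell)) * (2 * expR ((th * t) ^+ 2 / 2)) =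
    4 / th ^+ 2 * expR (- (th * ell) + (th * t) ^+ 2 / 2) by rewrite expRD; ring.
  rewrite ler_wpM2l ?divr_ge0 ?sqr_ge0// ler_expR lerD2l ler_pM2r//.
  rewrite ler_sqr ?nnegrE ?mulr_ge0 ?(ltW th0)//; last exact: le_trans tM.
  by rewrite ler_wpM2l// ltW.
Qed.

(** The product of these weights over a family is kap to the number of entries that
    exceed t, the exponential of a binomial count. *)
Definition tail_weight (kap t x : R) : R := if t < `|x| then kap else 1.

Lemma measurable_tail_weight (kap t : R) : measurable_fun setT (tail_weight kap t).
Proof.
apply: measurable_fun_if => //.
by apply: measurable_fun_ltr => //; exact: measurableT_comp.
Qed.

Lemma gauss_tail_weight_le (kap t tau M : R) : 1 <= kap -> 0 <= tau -> tau <= M -> 0 < M ->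
  (\int[gauss]_x (tail_weight kap t (tau * x))%:E <=
   (1 + (kap - 1) * (2 * (1 - Phi (t / M))))%:E)%E.
Proof.
move=> k1 tau0 tauM M0.
pose A := [set x : R | (t / M < `|x|)%R].
have mA : measurable A.
  rewrite /A -[X in measurable X]setTI.
  rewrite (_ : [set x | _] = (fun x : R => `|x|) @^-1` `]t / M, +oo[).
    exact: (@normr_measurable R setT).
  by apply/seteqP; split => w; rewrite /= in_itv/= andbT.
have mI : measurable_fun setT (\1_A : R -> R) by exact: measurable_indic.
apply: (@gauss_le _ (fun x => 1 + (kap - 1) * \1_A x)).
- apply: (measurableT_comp (measurable_tail_weight kap t)); exact: measurable_funM.
- by apply: measurable_funD => //; exact: measurable_funM.
- by move=> x; rewrite /tail_weight; case: ifP => // _; rewrite (le_trans _ k1).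
- move=> x; rewrite /tail_weight indicE; case: ifPn => tx.
    have -> : (x \in A) = true.
      apply/mem_set; rewrite /A/= ltr_pdivrMr// (lt_le_trans tx)// normrM mulrC.
      by rewrite ler_wpM2l// ger0_norm.
    by rewrite mulr1 addrC subrK.
  by rewrite lerDl mulr_ge0// subr_ge0.
- have e0 (x : R) : (0%E <= ((kap - 1) * \1_A x)%:E)%E.
    by rewrite lee_fin mulr_ge0// subr_ge0.
  under eq_integral do rewrite EFinD.
  have m1 : measurable_fun setT (fun x : R => ((kap - 1) * \1_A x)%:E).
    by apply/measurable_EFinP; exact: measurable_funM.
  have o0 (x : R) : (0%E <= 1%:E :> \bar R)%E by rewrite lee_fin.
  rewrite (ge0_integralD gauss measurableT (fun x _ => o0 x) (measurable_cst _)
      (fun x _ => e0 x) m1).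
  rewrite integral_cst//= probability_setT mule1 EFinD leeD2l//.
  under eq_integral do rewrite EFinM.
  have i0 (x : R) : (0%E <= (\1_A x : R)%:E)%E by rewrite lee_fin.
  have k0 : (0%E <= (kap - 1)%:E)%E by rewrite lee_fin subr_ge0.
  have := integral_scale gauss k0 (measurable_indicE mA) i0 => ->.
  rewrite integral_indic// setIT EFinM lee_wpmul2l//.
  exact: gauss_two_sided.
Qed.

End GaussMoments.

Section Rank.
Context {R : realType}.

(** If the entry of rank i exceeds t, so do the i entries ranked before it. *)
Lemma rank_prod (I : Type) (x0 : I) (g f : I -> R) (kap t : R) (s : seq I) i :
  1 <= kap -> (forall x, 1 <= f x) -> (forall x, t < g x -> f x = kap) ->
  sorted >=%R (map g s) -> (i < size s)%N -> t < g (nth x0 s i) ->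
  kap ^+ i.+1 <= \prod_(x <- s) f x.
Proof.
move=> k1 f1 fk; elim: s i => [//|x s IH] i srt i_s ti.
have f0 (l : seq I) : 1 <= \prod_(y <- l) f y.
  elim: l => [|y l IHl]; rewrite ?big_nil// big_cons.
  apply: (le_trans (f1 y)); rewrite ler_peMr//.
  exact: le_trans ler01 (f1 y).
have tr : transitive (>=%R : rel R) by move=> u v w /= uv vw; exact: le_trans vw uv.
have xt : t < g x.
  case: i i_s ti => [//|i] /= i_s ti; apply: (lt_le_trans ti).
  move: srt; rewrite /= path_sortedE// => /andP[/allP h _].
  have [y0 _] : exists y0 : I, True by exists x0.
  have := h (nth (g x0) (map g s) i); rewrite (nth_map x0)//; apply.
  by rewrite -(nth_map x0 (g x0))// mem_nth// size_map.
rewrite big_cons (fk _ xt) exprS ler_wpM2l//; first exact: le_trans k1.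
case: i i_s ti => [|i] /= i_s ti; first by rewrite expr0 f0.
by apply: IH => //; exact: path_sorted srt.
Qed.

End Rank.

(** * Measurability of the fitted values *)

(** The fitted values are a measurable function of the data, although no
    regularity of the selection of a minimizer is assumed. The optimal value of
    the objective is convex in y and lies below a parabola that touches it at a
    given point, so it is differentiable in y with gradient the residual y - A bhat; as an infimum over
    a countable dense set of coefficients the optimal value is measurable, hence
    so are its derivatives. *)
Section FitMeasurable.
Context {R : realType}.
Variables (n p : nat) (lam : nat -> R).
Hypothesis dec : noninc (lam \o succn) p.
Hypothesis lam_ge0 : forall i, (i < p)%N -> 0 <= lam i.+1.
Variable bhat : 'M[R]_(n, p) -> 'cV[R]_n -> 'cV[R]_p.
Hypothesis bhat_min : forall A y, is_slope_estimate lam A y (bhat A y).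

Definition slope_value A y : R := slope_objective lam A y (bhat A y).

Lemma dot_add m (u v : 'cV[R]_m) :
  dot (u + v) (u + v) = dot u u + 2 * dot u v + dot v v.
Proof. rewrite dotDl !dotDr (dotC v u); ring. Qed.

Lemma dot_half m (u v : 'cV[R]_m) :
  dot (2^-1 *: u + 2^-1 *: v) (2^-1 *: u + 2^-1 *: v) <=
  2^-1 * dot u u + 2^-1 * dot v v.
Proof.
rewrite dot_add !dotZl !dotZr.
have := dot_ge0 (u - v); rewrite dotBl !dotBr (dotC v u); lra.
Qed.

(** Keep the minimizer of y and perturb the data. *)
Lemma value_upper A y h :
  slope_value A (y + h) <=
  slope_value A y + dot h (y - A *m bhat A y) + 2^-1 * dot h h.
Proof.
apply: le_trans (bhat_min A (y + h) (bhat A y)) _.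
rewrite /slope_value !slope_objectiveE !enorm_sqr.
set r := y - A *m bhat A y.
have -> : y + h - A *m bhat A y = r + h by rewrite addrAC.
rewrite dot_add (dotC r h); lra.
Qed.

Lemma J_ge0 (b : 'cV[R]_p) : 0 <= J lam b.
Proof.
have := JD dec lam_ge0 b (- b); rewrite subrr JN => h.
have : 0 <= J lam (0 : 'cV[R]_p).
  rewrite (J_eq lam (perm_refl _)).
    rewrite wsumE big_nat sumr_ge0// => i /andP[_]; rewrite size_map => ip.
    have x0 : 'I_p by move: ip; case: (enum _).
    by rewrite (nth_map x0)// mxE normr0 mulr0.
  by elim: (enum _) => //= j s; case: s => //= a s ->; rewrite !mxE normr0 lexx.
lra.
Qed.

Lemma value_convex A y h :
  2 * slope_value A y <= slope_value A (y + h) + slope_value A (y - h).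
Proof.
set b1 := bhat A (y + h); set b2 := bhat A (y - h).
have := bhat_min A y (2^-1 *: b1 + 2^-1 *: b2).
rewrite /slope_value !slope_objectiveE !enorm_sqr -/b1 -/b2.
have := @JD_scaled _ _ _ dec lam_ge0 2^-1 2^-1 b1 b2.
rewrite invr_ge0 => /(_ (ler0n _ _) (ler0n _ _)).
set r1 := y + h - A *m b1; set r2 := y - h - A *m b2.
have -> : y - A *m (2^-1 *: b1 + 2^-1 *: b2) = 2^-1 *: r1 + 2^-1 *: r2.
  rewrite mulmxDr -!scalemxAr /r1 /r2; move: (A *m b1) (A *m b2) => u1 u2.
  apply/colP => i; rewrite !mxE; lra.
have := dot_half r1 r2; lra.
Qed.

(** Convexity turns the upper bound at -h into a lower bound at h. *)
Lemma value_lower A y h :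
  slope_value A y + dot h (y - A *m bhat A y) - 2^-1 * dot h h <=
  slope_value A (y + h).
Proof.
have := value_convex A y h; have := value_upper A y (- h).
rewrite [dot (- h) (- h)]dotNl dotNr opprK dotNl; lra.
Qed.

Variables (d : measure_display) (T : measurableType d).

Definition mx_measurable m1 m2 (A : T -> 'M[R]_(m1, m2)) :=
  forall i j, measurable_fun setT (fun t => A t i j).

Lemma objective_measurable (A : T -> 'M[R]_(n, p)) (y : T -> 'cV[R]_n)
    (b : 'cV[R]_p) :
  mx_measurable A -> mx_measurable y ->
  measurable_fun setT (fun t => slope_objective lam (A t) (y t) b).
Proof.
move=> mA my.
rewrite (_ : (fun _ => _) = (fun t =>
  2^-1 * (\sum_i (y t i ord0 - \sum_j A t i j * b j ord0) ^+ 2) + J lam b)).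
  apply: measurable_funD => //; apply: measurable_funM => //.
  apply: measurable_sum => i; apply: measurable_funX; apply: measurable_funB => //.
  by apply: measurable_sum => j; apply: measurable_funM.
apply/funext => t; rewrite slope_objectiveE enorm_sqr; congr (_ * _ + _).
by apply: eq_bigr => i _; rewrite !mxE expr2.
Qed.

(** The objective is continuous in b: the squared error and the penalty of a small
    perturbation are controlled by its sup norm. *)
Lemma objective_dense (A : 'M[R]_(n, p)) (y : 'cV[R]_n) (b : 'cV[R]_p) (c : R) :
  slope_objective lam A y b < c ->
  exists q : 'cV[rat]_p,
    slope_objective lam A y (map_mx ratr q) < c.
Proof.
move=> bc.
set r := y - A *m b; pose K := \sum_j enorm (col j A).
pose M := enorm r * K + 2^-1 * K ^+ 2 + J lam (const_mx 1 : 'cV[R]_p).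
have K0 : 0 <= K by apply: sumr_ge0 => j _; exact: enorm_ge0.
have M0 : 0 <= M.
  apply: addr_ge0; last exact: J_ge0.
  by apply: addr_ge0; apply: mulr_ge0; rewrite ?enorm_ge0 ?sqr_ge0 ?invr_ge0.
pose g := c - slope_objective lam A y b; have g0 : 0 < g by rewrite subr_gt0.
pose t := Num.min 1 (g / (2 * (M + 1))).
have M1 : 0 < 2 * (M + 1) by lra.
have t0 : 0 < t by rewrite lt_min ltr01 divr_gt0.
have t1 : t <= 1 by rewrite ge_min lexx.
have tM : t * M < g.
  have : t <= g / (2 * (M + 1)) by rewrite ge_min lexx orbT.
  rewrite ler_pdivlMr// => h; nra.
have /choice[q qP] : forall j, exists q : rat, b j ord0 < ratr q < b j ord0 + t.
  move=> j; have : b j ord0 < b j ord0 + t by rewrite ltrDl.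
  by move=> /rat_in_itvoo[q]; rewrite in_itv/= => h; exists q.
exists (\col_j q j); set e : 'cV[R]_p := map_mx ratr (\col_j q j) - b.
have -> : map_mx ratr (\col_j q j) = b + e by rewrite addrC subrK.
have et j : `|e j ord0| <= t.
  rewrite !mxE; have /andP[h1 h2] := qP j.
  by rewrite ger0_norm; lra.
have Ae : enorm (A *m e) <= t * K.
  have -> : A *m e = \sum_j e j ord0 *: col j A.
    apply/colP => i; rewrite mxE summxE; apply: eq_bigr => j _.
    by rewrite !mxE mulrC.
  rewrite (le_trans (enorm_sum _ _ _))// mulr_sumr ler_sum// => j _.
  by rewrite enormZ ler_wpM2r ?enorm_ge0.
have Je : J lam e <= t * J lam (const_mx 1 : 'cV[R]_p).
  have := @JD_scaled _ _ _ dec lam_ge0 t 0 (const_mx 1) 0 (ltW t0) (lexx 0).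
  rewrite mul0r addr0 scale0r addr0; apply: le_trans.
  apply: (J_mono dec lam_ge0) => j.
  have -> : (t *: const_mx 1 : 'cV[R]_p) j ord0 = t by rewrite !mxE mulr1.
  by rewrite (ger0_norm (ltW t0)).
rewrite slope_objectiveE.
have -> : y - A *m (b + e) = r - A *m e by rewrite mulmxDr opprD addrA.
have rb : enorm (r - A *m e) ^+ 2 <= enorm r ^+ 2 + 2 * (enorm r * (t * K)) + t * K ^+ 2.
  have := @dot_subZ _ _ 1 r (A *m e); rewrite !scale1r -!enorm_sqr => ->.
  have := dot_ge r (A *m e).
  have h1 : enorm r * enorm (A *m e) <= enorm r * (t * K).
    by rewrite ler_wpM2l ?enorm_ge0.
  have h2 : enorm (A *m e) ^+ 2 <= t * K ^+ 2.
    apply: (@le_trans _ _ ((t * K) ^+ 2)).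
      by rewrite ler_sqr ?nnegrE ?enorm_ge0// mulr_ge0// ltW.
    rewrite exprMn ler_wpM2r ?sqr_ge0//; nra.
  lra.
have := JD dec lam_ge0 b e.
have gE : slope_objective lam A y b = c - g by rewrite /g subKr.
move: gE; rewrite slope_objectiveE -/r => gE.
rewrite /M in tM; lra.
Qed.

Lemma value_measurable (A : T -> 'M[R]_(n, p)) (y : T -> 'cV[R]_n) :
  mx_measurable A -> mx_measurable y ->
  measurable_fun setT (fun t => slope_value (A t) (y t)).
Proof.
move=> mA my mT; apply: (measurability _ (RGenInftyO.measurableE R)) => //.
move=> _ [_ [a ->] <-]; rewrite setTI.
rewrite [X in measurable X](_ : _ = \bigcup_k
  (if unpickle k is Some q then
    [set t | slope_objective lam (A t) (y t) (map_mx ratr (q : 'cV[rat]_p)) < a]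
   else set0)).
  apply: bigcupT_measurable => k; case: (unpickle k) => [q|] //.
  have mB : measurable ((fun t => slope_objective lam (A t) (y t)
      (map_mx ratr q)) @^-1` `]-oo, a[).
    rewrite -[X in measurable X]setTI.
    exact: (objective_measurable (map_mx ratr q) mA my).
  rewrite (_ : [set t | _] = (fun t => slope_objective lam (A t) (y t)
      (map_mx ratr q)) @^-1` `]-oo, a[)//.
apply/seteqP; split => t.
  rewrite /= in_itv/= => /objective_dense[q qa].
  by exists (pickle q) => //=; rewrite pickleK.
move=> [k _]; case: (unpickle k) => // q /= qa; rewrite in_itv/=.
exact: le_lt_trans (bhat_min _ _ _) qa.
Qed.

(** The residual is the limit of difference quotients of the optimal value: by
    [value_upper] and [value_lower] the quotient with step s is within s / 2. *)
Lemma fit_measurable (A : T -> 'M[R]_(n, p)) (y : T -> 'cV[R]_n) :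
  mx_measurable A -> mx_measurable y ->
  mx_measurable (fun t => A t *m bhat (A t) (y t)).
Proof.
move=> mA my i j; rewrite ord1.
pose u (k : nat) : 'cV[R]_n := k.+1%:R^-1 *: delta_mx i ord0.
pose D k t := k.+1%:R * (slope_value (A t) (y t + u k) - slope_value (A t) (y t)).
have mD k : measurable_fun setT (D k).
  apply: measurable_funM => //; apply: measurable_funB; apply: value_measurable => //.
  move=> i' j'; rewrite (_ : (fun _ => _) = (fun t => y t i' j' + u k i' j')).
    exact: measurable_funD.
  by apply/funext => t; rewrite mxE.
have mg : measurable_fun setT (fun t => (y t - A t *m bhat (A t) (y t)) i ord0).
  apply: (@measurable_fun_cvg _ _ _ _ D) => // t _.
  set f := y t - _; set l := f i ord0.
  have dist k : `|l - D k t| <= k.+1%:R^-1.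
    have k0 : 0 < k.+1%:R :> R by rewrite ltr0n.
    have up := value_upper (A t) (y t) (u k).
    have lo := value_lower (A t) (y t) (u k).
    have e1 : dot (u k) f = k.+1%:R^-1 * l.
      rewrite /u dotZl; congr (_ * _); rewrite /dot (bigD1 i)//= big1.
        by rewrite addr0 mxE !eqxx mul1r.
      by move=> x /negbTE xi; rewrite mxE xi mul0r.
    have e2 : dot (u k) (u k) = k.+1%:R^-1 ^+ 2.
      rewrite {1}/u dotZl /u dotZr expr2; congr (_ * _); rewrite -[RHS]mulr1.
      congr (_ * _); rewrite /dot (bigD1 i)//= big1.
        by rewrite addr0 mxE !eqxx mul1r.
      by move=> x /negbTE xi; rewrite mxE xi mul0r.
    rewrite -/f e1 e2 in up lo.
    set dv := slope_value (A t) (y t + u k) - slope_value (A t) (y t).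
    have up' : dv <= k.+1%:R^-1 * l + 2^-1 * k.+1%:R^-1 ^+ 2
      by rewrite /dv lerBlDl addrA.
    have lo' : k.+1%:R^-1 * l - 2^-1 * k.+1%:R^-1 ^+ 2 <= dv
      by rewrite /dv lerBrDl addrA.
    rewrite /D -/dv.
    have kk : k.+1%:R * k.+1%:R^-1 = 1 :> R by rewrite divff// gt_eqF.
    set s := k.+1%:R^-1 in up' lo' kk *.
    have s0 : 0 < s by rewrite /s invr_gt0.
    have h1 := ler_wpM2l (ltW k0) up'; have h2 := ler_wpM2l (ltW k0) lo'.
    have z1 : k.+1%:R * (s * l + 2^-1 * s ^+ 2) = l + 2^-1 * s.
      by rewrite mulrDr mulrA kk mul1r expr2 mulrCA (mulrA _ s s) kk mul1r.
    have z2 : k.+1%:R * (s * l - 2^-1 * s ^+ 2) = l - 2^-1 * s.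
      by rewrite mulrBr mulrA kk mul1r expr2 mulrCA (mulrA _ s s) kk mul1r.
    rewrite z1 in h1; rewrite z2 in h2.
    rewrite ler_norml; apply/andP; split; lra.
  apply/cvgrPdist_le => e e0.
  have := @cvg_harmonic R; move=> /cvgrPdist_le/(_ e e0); apply: filterS => k.
  rewrite /harmonic/= sub0r normrN ger0_norm ?invr_ge0// => ke.
  exact: le_trans (dist k) ke.
rewrite (_ : (fun _ => _) = (fun t => y t i ord0 -
    (y t - A t *m bhat (A t) (y t)) i ord0)).
  exact: measurable_funB.
apply/funext => t; move: (A t *m _) => u0.
have -> : (y t - u0) i ord0 = y t i ord0 - u0 i ord0 by rewrite !mxE.
by rewrite subKr.
Qed.

End FitMeasurable.

(** * Correlations of the columns with the noise and the residual *)


Section Columns.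
Context d (T : measurableType d) (R : realType) (P : probability T R).
Variables (n p : nat) (X : 'I_n * 'I_p -> {RV P >-> R}).
Hypothesis n_gt0 : (0 < n)%N.
Hypothesis X_iid : iid_normal 0 (Num.sqrt n%:R^-1) X.

Let nR : 0 < n%:R :> R. Proof. by rewrite ltr0n. Qed.
Let s0 (i : 'I_n * 'I_p) : Num.sqrt n%:R^-1 != 0 :> R.
Proof. by rewrite gt_eqF// sqrtr_gt0 invr_gt0. Qed.

Definition corr (u : 'cV[R]_n) (j : 'I_p) (w : T) : R :=
  dot (col j (design X w)) u.

Lemma corrE u j w : corr u j w = \sum_i u i ord0 * X (i, j) w.
Proof. by apply: eq_bigr => i _; rewrite !mxE mulrC. Qed.

Lemma measurable_corr u j : measurable_fun setT (corr u j).
Proof.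
rewrite (_ : corr u j = (fun w => \sum_i u i ord0 * X (i, j) w)); last first.
  by apply/funext => w; rewrite corrE.
by apply: measurable_sum => i; apply: measurable_funM.
Qed.

(** The columns are independent, and the correlation of a column with a fixed u is
    Gaussian of variance |u|^2 / n. *)
Lemma corr_prod (u : 'cV[R]_n) (ks : seq 'I_p) (g : R -> R) : uniq ks ->
  measurable_fun setT g -> (forall x, 0 <= g x) ->
  (\int[P]_w (\prod_(j <- ks) g (corr u j w))%:E =
   \prod_(j <- ks) \int[normal_prob 0 1]_x (g (Num.sqrt (dot u u / n%:R) * x))%:E)%E.
Proof.
move=> uks mg g0.
pose cols (j : 'I_p) := [seq (i, j) | i <- enum 'I_n].
pose a (x : 'I_n * 'I_p) := u x.1 ord0.
have ur j : uniq (cols j) by rewrite map_inj_uniq ?enum_uniq// => x y [].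
have dis j l : j != l -> disjS [set x in cols j]%SET [set x in cols l]%SET.
  move=> jl; rewrite -finset.setI_eq0; apply/eqP/finset.setP => x; rewrite !inE.
  by apply/negP => /andP[/mapP[i _ ->] /mapP[i' _ [_ /eqP]]]; rewrite (negbTE jl).
have var j : \sum_(x <- cols j) (a x * Num.sqrt n%:R^-1) ^+ 2 = dot u u / n%:R.
  rewrite big_map big_enum/= /dot mulr_suml; apply: eq_bigr => i _.
  by rewrite /a exprMn sqr_sqrtr ?invr_ge0// expr2.
have law i (B : set R) : measurable B -> distribution P (X i) B =
    normal_prob 0 (Num.sqrt n%:R^-1) B by move=> mB; exact: X_iid.2.
have := linform_prod X_iid.1 s0 law ur dis var uks (fun=> mg) (fun=> g0).
move=> <-; apply: eq_integral => w _; congr EFin; apply: eq_bigr => j _.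
by rewrite /linform big_map big_enum/= corrE.
Qed.

Lemma corr_sum (u : 'cV[R]_n) (ks : seq 'I_p) (g : R -> R) (b : R) :
  measurable_fun setT g -> (forall x, 0 <= g x) ->
  (\int[normal_prob 0 1]_x (g (Num.sqrt (dot u u / n%:R) * x))%:E <= b%:E)%E ->
  (\int[P]_w (\sum_(j <- ks) g (corr u j w))%:E <= ((size ks)%:R * b)%:E)%E.
Proof.
move=> mg g0 gb.
under eq_integral do rewrite -sumEFin.
have mgc j : measurable_fun setT (fun w => (g (corr u j w))%:E).
  by apply/measurable_EFinP; exact: (measurableT_comp mg (measurable_corr u j)).
rewrite (ge0_integral_sum P measurableT mgc); last first.
  by move=> j w _; rewrite lee_fin.
elim: ks => [|j ks IH]; first by rewrite big_nil mul0r.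
rewrite big_cons /= -natr1 mulrDl mul1r addrC EFinD leeD//.
have := @corr_prod u [:: j] g isT mg g0.
rewrite big_seq1 => /esym h; apply: le_trans gb; rewrite h.
by under [X in (_ <= X)%E]eq_integral do rewrite big_seq1.
Qed.

End Columns.

Section Joint.
Context d (T : measurableType d) (R : realType) (P : probability T R).
Variables (n p : nat) (X : 'I_n * 'I_p -> {RV P >-> R}) (z : 'I_n -> {RV P >-> R}).
Hypothesis X_indep : mutually_independent X.
Hypothesis z_indep : mutually_independent z.
Hypothesis Xz_indep : independent_families X z.

Definition joint (x : 'I_n * 'I_p + 'I_n) : {RV P >-> R} :=
  match x with inl ij => X ij | inr i => z i end.

Lemma sigma_of_cap (I : finType) (Y : I -> {RV P >-> R}) (J : {set I})
    (B : I -> set R) : (forall i, measurable (B i)) ->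
  sigma_of Y (\bigcap_(i in [set i | i \in J]) (Y i @^-1` B i)).
Proof.
move=> mB; pose G := \bigcup_i preimage_set_system setT (Y i) measurable.
apply: (@fin_bigcap_measurable _ (g_sigma_algebraType G)) => // i _.
apply: sub_sigma_algebra; exists i => //; exists (B i) => //.
by rewrite setTI.
Qed.

(** Cylinders of the joint family split into an event of X and an event of z. *)
Lemma joint_indep : mutually_independent joint.
Proof.
move=> J B mB.
pose J1 := [set x | inl x \in J]%SET; pose J2 := [set x | inr x \in J]%SET.
have -> : \bigcap_(i in [set i | i \in J]) (joint i @^-1` B i) =
   (\bigcap_(x in [set x | x \in J1]) (X x @^-1` B (inl x))) `&`
   (\bigcap_(x in [set x | x \in J2]) (z x @^-1` B (inr x))).
  apply/seteqP; split=> w.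
    by move=> h; split=> x /=; rewrite inE => xJ; [exact: (h (inl x))|exact: (h (inr x))].
  by move=> [h1 h2] [x|x] xJ; [apply: h1|apply: h2]; rewrite /= inE.
rewrite Xz_indep; try by apply: sigma_of_cap => x; exact: mB.
rewrite (X_indep J1 (fun x => mB (inl x))) (z_indep J2 (fun x => mB (inr x))).
rewrite big_sumType; congr (_ * _)%E.
- by apply: eq_bigl => x; rewrite inE.
- by apply: eq_bigl => x; rewrite inE.
Qed.

(** Markov's inequality conditionally on U: a vector U depending on the group J1 may
    be treated as fixed when the variables of J2 are integrated. The bound on the
    inner integral is required only where the squared norm of U is at most M, so
    F is set to 0 elsewhere. *)
Lemma decoupled_markov (J1 J2 : {set 'I_n * 'I_p + 'I_n}) (U : T -> 'cV[R]_n)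
    (F : T * T -> R) (M b : R) : disjS J1 J2 ->
  (forall i j, measurable_fun setT ((fun w => U w i j) : SJ joint J1 -> R)) ->
  measurable_fun setT (F : SJ joint J1 * SJ joint J2 -> R) ->
  (forall x, 0 <= F x) -> 0 <= b ->
  (forall w1, dot (U w1) (U w1) <= M -> (\int[P]_w2 (F (w1, w2))%:E <= b%:E)%E) ->
  exists B, [/\ measurable B, (P B <= b%:E)%E &
    forall w, ~ B w -> dot (U w) (U w) <= M -> F (w, w) < 1].
Proof.
move=> dis mU mF F0 b0 Fb.
have mdot : measurable_fun setT ((fun w => dot (U w) (U w)) : SJ joint J1 -> R).
  by apply: measurable_sum => i; exact: measurable_funM.
pose F1 (x : T * T) : R := if dot (U x.1) (U x.1) <= M then F x else 0.
have mF1 : measurable_fun setT (F1 : SJ joint J1 * SJ joint J2 -> R).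
  apply: measurable_fun_if => //.
    apply: measurable_fun_ler => //.
    exact: (measurableT_comp mdot).
  exact: measurable_funTS.
have F10 x : 0 <= F1 x by rewrite /F1; case: ifP.
have mF1' : measurable_fun setT ((fun x => (F1 x)%:E) : SJ joint J1 * SJ joint J2 -> \bar R).
  exact/measurable_EFinP.
have E := decouple_groups joint_indep dis mF1' (fun x => F10 x : (0 <= (F1 x)%:E)%E).
have mF1T : measurable_fun setT (fun x : T * T => (F1 x)%:E).
  have mid : measurable_fun setT
      ((fun x : T * T => (x.1, x.2)) : T * T -> SJ joint J1 * SJ joint J2).
    apply: measurable_fun_pair.
      exact: (measurableT_comp (@SJ_id _ _ _ _ _ joint J1) measurable_fst).
    exact: (measurableT_comp (@SJ_id _ _ _ _ _ joint J2) measurable_snd).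
  have := measurableT_comp mF1' mid; congr measurable_fun.
  by apply/funext => -[].
have mdiag : measurable_fun setT (fun w => F1 (w, w)).
  have mid : measurable_fun setT
      ((fun w : T => (w, w)) : T -> SJ joint J1 * SJ joint J2).
    by apply: measurable_fun_pair; exact: SJ_id.
  exact: (measurableT_comp mF1 mid).
have le1 : (\int[P]_w (F1 (w, w))%:E <= b%:E)%E.
  rewrite E; apply: (@le_trans _ _ (\int[P]_w (cst b%:E w))%E); last first.
    by rewrite integral_cst//= probability_setT mule1.
  apply: ge0_le_integral => //.
  - by move=> w _; apply: integral_ge0 => w2 _; rewrite lee_fin.
  - exact: (measurable_fun_fubini_tonelli_F (fun x => (F1 x)%:E) mF1T
      (fun x => F10 x : (0 <= (F1 x)%:E)%E)).
  - move=> w1 _; have [h|/negbTE h] := boolP (dot (U w1) (U w1) <= M).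
      under eq_integral do rewrite /F1/= h.
      exact: Fb.
    under eq_integral do rewrite /F1/= h.
    by rewrite integral_cst//= mul0e lee_fin.
exists [set w | 1 <= F1 (w, w)]; split.
- rewrite -[X in measurable X]setTI.
  rewrite (_ : [set w | _] = (fun w => F1 (w, w)) @^-1` `[1, +oo[).
    exact: mdiag.
  by apply/seteqP; split => w; rewrite /= in_itv/= andbT.
- have := markov_ge0 ltr01 mdiag (fun w => F10 _) le1.
  by rewrite divr1.
- move=> w nB Uw; rewrite ltNge; apply/negP => h; apply: nB.
  by rewrite /F1/= Uw.
Qed.

End Joint.


Section NoiseEvents.
Context d (T : measurableType d) (R : realType) (P : probability T R).
Variables (n p : nat) (X : 'I_n * 'I_p -> {RV P >-> R}) (z : 'I_n -> {RV P >-> R}).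
Hypothesis n_gt0 : (0 < n)%N.
Hypothesis X_iid : iid_normal 0 (Num.sqrt n%:R^-1) X.
Hypothesis z_indep : mutually_independent z.
Hypothesis Xz_indep : independent_families X z.

Let nR : 0 < n%:R :> R. Proof. by rewrite ltr0n. Qed.
Let W := joint X z.
Let dec := @decoupled_markov _ T R P n p X z X_iid.1 z_indep Xz_indep.

Lemma measurable_corr_prod (J1 J2 : {set 'I_n * 'I_p + 'I_n}) (U : T -> 'cV[R]_n) j :
  (forall i k, measurable_fun setT ((fun w => U w i k) : SJ W J1 -> R)) ->
  (forall i, inl (i, j) \in J2) ->
  measurable_fun setT
    ((fun x : T * T => corr X (U x.1) j x.2) : SJ W J1 * SJ W J2 -> R).
Proof.
move=> mU jJ.
rewrite (_ : (fun _ => _) = (fun x : T * T => \sum_i U x.1 i ord0 * X (i, j) x.2)).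
  apply: measurable_sum => i; apply: measurable_funM.
    exact: (measurableT_comp (mU i ord0) measurable_fst).
  have mX : measurable_fun setT (X (i, j) : SJ W J2 -> R) by exact: (@SJ_Y _ _ _ _ _ W J2 (inl (i, j)) (jJ i)).
  exact: (measurableT_comp mX measurable_snd).
by apply/funext => x; rewrite corrE.
Qed.

Lemma sqrt_le_M (u : 'cV[R]_n) (M : R) : 0 < M -> dot u u <= n%:R * M ^+ 2 ->
  Num.sqrt (dot u u / n%:R) <= M.
Proof.
move=> M0 h; rewrite -[leRHS](ger0_norm (ltW M0)) -sqrtr_sqr ler_wsqrtr//.
by rewrite ler_pdivrMr// mulrC.
Qed.

(** The noise is independent of the design: Markov's inequality for the squared
    correlations, the noise being fixed. *)
Lemma signal_noise_event (S : {set 'I_p}) (M nz : R) : 0 < M -> 0 < nz ->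
  exists B, [/\ measurable B,
    (P B <= (#|S|%:R * (M ^+ 2 * second_moment) / nz ^+ 2)%:E)%E &
    forall w, ~ B w -> dot (noise z w) (noise z w) <= n%:R * M ^+ 2 ->
      \sum_(j in S) dot (col j (design X w)) (noise z w) ^+ 2 <= nz ^+ 2].
Proof.
move=> M0 nz0; have nz2 : 0 < nz ^+ 2 by rewrite exprn_gt0.
pose J1 := [set x : 'I_n * 'I_p + 'I_n | if x is inl _ then false else true]%SET.
pose J2 := [set x : 'I_n * 'I_p + 'I_n | if x is inl _ then true else false]%SET.
have dis : disjS J1 J2.
  by rewrite -finset.setI_eq0; apply/eqP/finset.setP => -[x|x]; rewrite !inE.
have mU i j : measurable_fun setT ((fun w => noise z w i j) : SJ W J1 -> R).
  rewrite (_ : (fun _ => _) = (z i : T -> R)); last by apply/funext => w; rewrite mxE.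
  by apply: (@SJ_Y _ _ _ _ _ W J1 (inr i)); rewrite inE.
pose F (x : T * T) : R := \sum_(j <- enum S) corr X (noise z x.1) j x.2 ^+ 2 / nz ^+ 2.
have mF : measurable_fun setT (F : SJ W J1 * SJ W J2 -> R).
  apply: measurable_sum => j; apply: measurable_funM => //; apply: measurable_funX.
  by apply: measurable_corr_prod => // i; rewrite inE.
have F0 x : 0 <= F x.
  by apply: sumr_ge0 => j _; rewrite divr_ge0 ?sqr_ge0// ltW.
have m20 : 0 <= second_moment :> R by rewrite mulr_ge0// expR_ge0.
have b0 : 0 <= #|S|%:R * (M ^+ 2 * second_moment) / nz ^+ 2.
  by apply: divr_ge0 (ltW nz2); apply: mulr_ge0 => //; exact: mulr_ge0 (sqr_ge0 _) m20.
have Fb w1 : dot (noise z w1) (noise z w1) <= n%:R * M ^+ 2 ->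
    (\int[P]_w2 (F (w1, w2))%:E <=
     (#|S|%:R * (M ^+ 2 * second_moment) / nz ^+ 2)%:E)%E.
  move=> hM; rewrite cardE -mulrA.
  rewrite /F /=; apply: (corr_sum n_gt0 X_iid (u := noise z w1) (enum S) (g := fun x => x ^+ 2 / nz ^+ 2)).
  - by apply: measurable_funM => //; exact: measurable_funX.
  - by move=> x; rewrite divr_ge0 ?sqr_ge0// ltW.
  - have mlin (t : R) : measurable_fun setT (fun x : R => ((t * x) ^+ 2)%:E).
      by apply/measurable_EFinP; apply: measurable_funX; exact: measurable_funM.
    under eq_integral do rewrite mulrC EFinM.
    set t := Num.sqrt _.
    have e0 (x : R) : (0%E <= ((t * x) ^+ 2)%:E)%E by rewrite lee_fin sqr_ge0.
    have k0 : (0%E <= (nz ^+ 2)^-1%:E :> \bar R)%E by rewrite lee_fin invr_ge0 ltW.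
    have := integral_scale (@normal_prob R 0 1) k0 (mlin t) e0 => ->.
    rewrite mulrC EFinM lee_wpmul2l//.
    by apply: gauss_sqr_le; [exact: sqrtr_ge0|exact: sqrt_le_M].
have [B [mB PB hB]] := dec dis mU mF F0 b0 Fb.
exists B; split => // w nB hw; have := hB w nB hw; rewrite /F/=.
rewrite big_enum/= -mulr_suml ltr_pdivrMr// mul1r => /ltW; apply: le_trans.
exact: lexx.
Qed.

Variables (lam : nat -> R) (beta : 'cV[R]_p).
Let S := supp beta.
Hypothesis lam_dec : noninc (lam \o succn) p.
Hypothesis lam_ge0 : forall i, (i < p)%N -> 0 <= lam i.+1.
Variable bhat : 'M[R]_(n, p) -> 'cV[R]_n -> 'cV[R]_p.
Hypothesis bhat_min : forall A y, is_slope_estimate lam A y (bhat A y).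

Definition residual (w : T) : 'cV[R]_n :=
  let A := design X w in let y := A *m beta + noise z w in
  y - A *m restr S (bhat (restrcol S A) y).

(** The oracle residual w is a function of z and of the columns in S, hence
    independent of the other columns. Given w, the correlations with these columns
    are independent centred Gaussian variables of standard deviation at most M.
    One application of [decoupled_markov] to a sum controls two effects. The
    excesses above [ell] have a small sum of squares on average; this serves the
    ranks below r0. For a rank r >= r0, the number of correlations above t r is
    binomial with mean at most q1 r; with the weight 1 / q1 per exceedance, the
    event that r of them occur has probability at most (q1 exp (1 - q1))^r, which
    is Chernoff's bound. Sorting the columns by correlation gives [s2]. *)
Lemma residual_event (M ell E0 th c q1 : R) (t : nat -> R) (r0 : nat) :
  0 < M -> 0 < E0 -> 0 < th -> 0 < q1 -> q1 < 1 ->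
  (forall r, (0 < r)%N -> (r <= p - #|S|)%N ->
    (if (r0 <= r)%N then t r else ell) <= lam (#|S| + r)%N - c) ->
  (forall r, (0 < r)%N -> (r <= p - #|S|)%N -> (r0 <= r)%N ->
    p%:R * (2 * (1 - Phi (t r / M))) <= q1 * r%:R) ->
  exists B, [/\ measurable B,
    (P B <= (p%:R * (4 / th ^+ 2 * expR (- (th * ell) + (th * M) ^+ 2 / 2)) / E0 +
       \sum_(r0 <= r < (p - #|S|).+1 | (0 < r)%N) (q1 * expR (1 - q1)) ^+ r)%:E)%E &
    forall w, ~ B w -> dot (residual w) (residual w) <= n%:R * M ^+ 2 ->
      let e j := Num.max (`|corr X (residual w) j w| - ell) 0 in
      \sum_(j in (~: S)%SET) e j ^+ 2 <= E0 /\
      exists2 s2, perm_eq s2 (enum (~: S)%SET) &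
        forall x0 i, (i < size s2)%N ->
        `|corr X (residual w) (nth x0 s2 i) w| <=
        lam (#|S| + i).+1 + (e (nth x0 s2 i) - c)].
Proof.
move=> M0 E00 th0 q10 q11 Hlam Hphi.
pose J1 := [set x : 'I_n * 'I_p + 'I_n | if x is inl ij then ij.2 \in S else true]%SET.
pose J2 := [set x : 'I_n * 'I_p + 'I_n | if x is inl ij then ij.2 \notin S else false]%SET.
have dis : disjS J1 J2.
  rewrite -finset.setI_eq0; apply/eqP/finset.setP => -[x|x]; rewrite !inE//.
  by rewrite andbN.
have mAS : mx_measurable ((fun w => restrcol S (design X w)) : SJ W J1 -> 'M[R]_(n, p)).
  move=> i j; case: (boolP (j \in S)) => jS.
    rewrite (_ : (fun _ => _) = (X (i, j) : T -> R)).
      by apply: (@SJ_Y _ _ _ _ _ W J1 (inl (i, j))); rewrite inE.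
    by apply/funext => w; rewrite !mxE jS.
  rewrite (_ : (fun _ => _) = cst 0)//.
  by apply/funext => w; rewrite !mxE (negbTE jS).
have yE w : design X w *m beta = restrcol S (design X w) *m beta.
  by rewrite restrcolM restr_supp.
have my : mx_measurable ((fun w => design X w *m beta + noise z w) : SJ W J1 -> 'cV[R]_n).
  move=> i k; rewrite (_ : (fun _ => _) = (fun w =>
    \sum_j restrcol S (design X w) i j * beta j k + z i w)).
    apply: measurable_funD.
      by apply: measurable_sum => j; apply: measurable_funM => //; exact: mAS.
    by apply: (@SJ_Y _ _ _ _ _ W J1 (inr i)); rewrite inE.
  by apply/funext => w; rewrite yE mxE [X in X + _]mxE [X in _ + X]mxE.
have mU i k : measurable_fun setT ((fun w => residual w i k) : SJ W J1 -> R).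
  have mf := fit_measurable lam_dec lam_ge0 bhat_min mAS my.
  rewrite (_ : (fun _ => _) = (fun w => (design X w *m beta + noise z w) i k -
     (restrcol S (design X w) *m bhat (restrcol S (design X w))
       (design X w *m beta + noise z w)) i k)).
    by apply: measurable_funB; [exact: my|exact: mf].
  apply/funext => w; rewrite /residual -restrcolM.
  move: (restrcol S _ *m bhat _ _) => v1; move: (design X w *m beta + _) => v2.
  by rewrite !mxE.
(* the optimal exponential tilt for a binomial count exceeding its mean by 1 / q1 *)
pose kap := q1^-1; have kap1 : 1 <= kap by rewrite /kap invf_ge1// ltW.
pose Sc := enum (~: S)%SET.
pose H1 (f : 'I_p -> R) := \sum_(j <- Sc) (Num.max (`|f j| - ell) 0 ^+ 2 / E0).
pose H2 (f : 'I_p -> R) r := q1 ^+ r * \prod_(j <- Sc) tail_weight kap (t r) (f j).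
pose rs := [seq r <- index_iota r0 (p - #|S|).+1 | (0 < r)%N].
pose F (x : T * T) : R := let f j := corr X (residual x.1) j x.2 in
  H1 f + \sum_(r <- rs) H2 f r.
have tail_weight0 tt x : 0 <= tail_weight kap tt x by rewrite /tail_weight; case: ifP => // _; rewrite (le_trans ler01).
have H10 f : 0 <= H1 f.
  by apply: sumr_ge0 => j _; rewrite divr_ge0 ?sqr_ge0// ltW.
have H20 f r : 0 <= H2 f r.
  by rewrite mulr_ge0 ?exprn_ge0 ?(ltW q10)// prodr_ge0.
have F0 x : 0 <= F x by rewrite addr_ge0// sumr_ge0.
have mcorr j : j \in Sc -> measurable_fun setT
    ((fun x : T * T => corr X (residual x.1) j x.2) : SJ W J1 * SJ W J2 -> R).
  rewrite mem_enum inE => jS; apply: measurable_corr_prod => // i.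
  by rewrite inE.
have mexc : measurable_fun setT (fun x : R => Num.max (`|x| - ell) 0 ^+ 2 / E0).
  apply: measurable_funM => //; apply: measurable_funX.
  apply: measurable_maxr => //; apply: measurable_funB => //.
have mF : measurable_fun setT (F : SJ W J1 * SJ W J2 -> R).
  apply: measurable_funD.
    apply: measurable_sum_in => j jS; exact: (measurableT_comp mexc (mcorr j jS)).
  apply: measurable_sum => r; apply: measurable_funM => //.
  apply: measurable_prod => j jS.
  exact: (measurableT_comp (measurable_tail_weight kap (t r)) (mcorr j jS)).
pose ex := 4 / th ^+ 2 * expR (- (th * ell) + (th * M) ^+ 2 / 2).
have ex0 : 0 <= ex by rewrite mulr_ge0 ?expR_ge0// divr_ge0// sqr_ge0.
set b := _ + _.
have sumE : b = p%:R * (ex / E0) + \sum_(r <- rs) (q1 * expR (1 - q1)) ^+ r.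
  by rewrite /b /rs big_filter /index_iota -mulrA.
have b0 : 0 <= b.
  rewrite sumE; apply: addr_ge0.
    by apply: mulr_ge0 => //; rewrite divr_ge0// ltW.
  by apply: sumr_ge0 => r _; rewrite exprn_ge0// mulr_ge0 ?expR_ge0// ltW.
have sizeSc : (size Sc <= p)%N by rewrite -cardE -[leqRHS]card_ord max_card.
have Fb w1 : dot (residual w1) (residual w1) <= n%:R * M ^+ 2 ->
    (\int[P]_w2 (F (w1, w2))%:E <= b%:E)%E.
  move=> hM; set u := residual w1 in hM *.
  set tau := Num.sqrt (dot u u / n%:R).
  have tau0 : 0 <= tau by exact: sqrtr_ge0.
  have tauM : tau <= M by exact: sqrt_le_M.
  have mcu j : measurable_fun setT (corr X u j) := measurable_corr X u j.
  have mH1 : measurable_fun setT (fun w2 => H1 (fun j => corr X u j w2)).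
    by apply: measurable_sum => j; exact: (measurableT_comp mexc).
  have mH2 r : measurable_fun setT (fun w2 => H2 (fun j => corr X u j w2) r).
    apply: measurable_funM => //; apply: measurable_prod => j _.
    exact: (measurableT_comp (measurable_tail_weight kap (t r))).
  have FE : (\int[P]_w2 (F (w1, w2))%:E =
    \int[P]_w2 (H1 (fun j => corr X u j w2))%:E +
    \sum_(r <- rs) \int[P]_w2 (H2 (fun j => corr X u j w2) r)%:E)%E.
    rewrite -(ge0_integral_sum P measurableT); last 2 first.
    - by move=> r; exact/measurable_EFinP.
    - by move=> r w2 _; rewrite lee_fin.
    rewrite -(ge0_integralD P measurableT).
    - by apply: eq_integral => w2 _; rewrite /F/= EFinD -(sumEFin rs).
    - by move=> w2 _; rewrite lee_fin.
    - exact/measurable_EFinP.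
    - by move=> w2 _; apply: sume_ge0 => r _; rewrite lee_fin.
    - by apply: emeasurable_sum => r; exact/measurable_EFinP.
  rewrite FE sumE EFinD; apply: leeD.
    apply: (@le_trans _ _ ((size Sc)%:R * (ex / E0))%:E); last first.
      rewrite lee_fin; apply: ler_wpM2r; last by rewrite ler_nat.
      exact: divr_ge0 ex0 (ltW E00).
    apply: (corr_sum n_gt0 X_iid Sc mexc) => [x|].
      by rewrite divr_ge0 ?sqr_ge0// ltW.
    rewrite -/u -/tau.
    under eq_integral do rewrite mulrC EFinM.
    have e0 (x : R) : (0%E <= (Num.max (`|tau * x| - ell) 0 ^+ 2)%:E)%E.
      by rewrite lee_fin sqr_ge0.
    have k0 : (0%E <= E0^-1%:E :> \bar R)%E by rewrite lee_fin invr_ge0 ltW.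
    have me : measurable_fun setT (fun x : R => (Num.max (`|tau * x| - ell) 0 ^+ 2)%:E).
      apply/measurable_EFinP; apply: measurable_funX; apply: measurable_maxr => //.
      apply: measurable_funB => //.
      by apply: measurableT_comp => //; exact: measurable_funM.
    have := integral_scale (@normal_prob R 0 1) k0 me e0 => ->.
    rewrite mulrC EFinM lee_wpmul2l//.
    exact: gauss_excess_le.
  rewrite -sumEFin big_seq [X in (_ <= X)%E]big_seq; apply: lee_sum => r.
  rewrite mem_filter mem_index_iota ltnS => /andP[r_gt0 /andP[rr0 rp]].
  have mb := measurable_tail_weight kap (t r).
  rewrite /H2; under eq_integral do rewrite EFinM.
  have k0 : (0%E <= (q1 ^+ r)%:E :> \bar R)%E by rewrite lee_fin exprn_ge0// ltW.
  have e0 w : (0%E <= (\prod_(j <- Sc) tail_weight kap (t r) (corr X u j w))%:E)%E.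
    by rewrite lee_fin prodr_ge0.
  have me : measurable_fun setT
      (fun w => (\prod_(j <- Sc) tail_weight kap (t r) (corr X u j w))%:E).
    apply/measurable_EFinP; apply: measurable_prod => j _.
    exact: (measurableT_comp mb).
  rewrite (integral_scale P k0 me e0) exprMn EFinM lee_wpmul2l//.
  rewrite (corr_prod n_gt0 X_iid u (enum_uniq _) mb (tail_weight0 _)) -/tau.
  set pi := 2 * (1 - Phi (t r / M)).
  have pi0 : 0 <= pi.
    by rewrite mulr_ge0// -lee_fin Phi_tail.
  have one := gauss_tail_weight_le (t r) kap1 tau0 tauM M0.
  apply: (@le_trans _ _ ((1 + (kap - 1) * pi) ^+ size Sc)%:E).
    rewrite /Sc; elim: (enum (~: S)%SET) => [|j l IH]; first by rewrite big_nil expr0.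
    rewrite big_cons /= exprS EFinM; apply: lee_pmul => //.
      by apply: integral_ge0 => x _; rewrite lee_fin.
    elim: l {IH} => [|k l IH]; rewrite ?big_nil ?lee_fin// big_cons mule_ge0//.
    by apply: integral_ge0 => x _; rewrite lee_fin.
  rewrite lee_fin.
  have k10 : 0 <= kap - 1 by rewrite subr_ge0.
  apply: (@le_trans _ _ (expR ((kap - 1) * pi) ^+ size Sc)).
    have kpi := mulr_ge0 k10 pi0; have h := expR_ge1Dx ((kap - 1) * pi).
    by apply: lerXn2r; rewrite ?nnegrE ?expR_ge0// addr_ge0.
  rewrite -!expRM_natl ler_expR.
  apply: (@le_trans _ _ ((kap - 1) * (p%:R * pi))).
    rewrite mulrCA ler_wpM2l// ler_wpM2r// ler_nat//.
  apply: (le_trans (ler_wpM2l k10 (Hphi r r_gt0 rp rr0))).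
  rewrite le_eqVlt; apply/orP; left; apply/eqP; rewrite /kap; field.
  by rewrite gt_eqF.
have [B [mB PB hB]] := dec dis mU mF F0 b0 Fb.
exists B; split => // w nB hw e.
have := hB w nB hw; rewrite /F/=; set f := (fun j => corr X (residual w) j w).
move=> Flt; split.
  have : H1 f < 1 by apply: le_lt_trans Flt; rewrite lerDl sumr_ge0.
  by rewrite /H1 big_enum/= -mulr_suml ltr_pdivrMr// mul1r => /ltW.
exists (sort (fun i j => `|f i| >= `|f j|) Sc); first by rewrite perm_sort.
set s2 := sort _ _; move=> x0 i i_s.
have s2perm : perm_eq s2 Sc by rewrite perm_sort.
have srt : sorted >=%R [seq `|f j| | j <- s2].
  rewrite sorted_map; apply: sort_sorted => a b'.
  exact: (le_total `|f b'| `|f a|).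
have ip : (i.+1 <= p - #|S|)%N.
  rewrite (leq_trans i_s)// (perm_size s2perm) -cardE -[p in (p - _)%N]card_ord.
  by rewrite -(cardsC S) addKn.
have := Hlam i.+1 isT ip; rewrite addnS.
have e_ge : 0 <= e (nth x0 s2 i) by rewrite /e le_max lexx orbT.
have e_ge' : `|f (nth x0 s2 i)| - ell <= e (nth x0 s2 i) by rewrite /e le_max lexx.
rewrite -/(f _); case: ifPn => [rr|_] hl; last by lra.
suff : `|f (nth x0 s2 i)| <= t i.+1 by lra.
rewrite leNgt; apply/negP => big.
have := rank_prod (f := fun j => tail_weight kap (t i.+1) (f j)) (g := fun j => `|f j|)
  (kap := kap) (t := t i.+1) (s := s2) kap1.
move=> /(_ x0 i) h.
have hp : kap ^+ i.+1 <= \prod_(x <- s2) tail_weight kap (t i.+1) (f x).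
  apply: h => //.
  - by move=> x; rewrite /tail_weight; case: ifP.
  - by move=> x; rewrite /tail_weight => ->.
have : 1 <= H2 f i.+1.
  rewrite /H2 -(perm_big _ s2perm)/=.
  apply: le_trans (ler_wpM2l _ hp); last by rewrite exprn_ge0// ltW.
  by rewrite -exprMn /kap divff ?expr1n// gt_eqF.
apply/negP; rewrite -ltNge; apply: le_lt_trans Flt.
have irs : i.+1 \in rs by rewrite mem_filter mem_index_iota rr /=; exact: ip.
rewrite (big_rem _ irs)/= addrCA lerDl addr_ge0// sumr_ge0//.
Qed.

End NoiseEvents.

(** * The SLOPE weights *)

Section Quantiles.
Context {R : realType}.
Variables (q : R) (p : nat).
Hypotheses (q_gt0 : 0 < q) (q_lt1 : q < 1) (p_gt0 : (0 < p)%N).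

Let pR : 0 < p%:R :> R. Proof. by rewrite ltr0n. Qed.

Definition quantile (m : nat) : R := Phi_inv (1 - m%:R * q / (2 * p%:R)).

Lemma level_gt0 m : (0 < m)%N -> 0 < m%:R * q / (2 * p%:R) :> R.
Proof. by move=> m0; rewrite divr_gt0 ?mulr_gt0// ltr0n. Qed.

Lemma level_lt m : (m <= p)%N -> m%:R * q / (2 * p%:R) < 1 / 2 :> R.
Proof.
move=> mp; rewrite ltr_pdivrMr ?mulr_gt0//.
have : m%:R <= p%:R :> R by rewrite ler_nat.
move: pR q_gt0 q_lt1; nra.
Qed.

Lemma level_le m m' : (m <= m')%N ->
  m%:R * q / (2 * p%:R) <= m'%:R * q / (2 * p%:R) :> R.
Proof.
move=> mm; rewrite ler_wpM2r ?invr_ge0 ?mulr_ge0 ?(ltW pR)//.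
by rewrite ler_wpM2r ?(ltW q_gt0)// ler_nat.
Qed.

Lemma quantile_noninc m m' : (0 < m)%N -> (m <= m')%N -> (m' <= p)%N ->
  quantile m' <= quantile m.
Proof.
move=> m0 mm mp; have := level_gt0 m0; have := level_lt mp; have := level_le mm.
move=> h1 h2 h3; apply: Phi_inv_le; lra.
Qed.

Lemma quantile_gt0 m : (0 < m)%N -> (m <= p)%N -> 0 < quantile m.
Proof.
move=> m0 mp; have := level_gt0 m0; have := level_lt mp => h1 h2.
by apply: Phi_inv_gt0; lra.
Qed.

Lemma quantile_tail m : (0 < m)%N -> (m <= p)%N ->
  1 - Phi (quantile m) = m%:R * q / (2 * p%:R).
Proof.
move=> m0 mp; have := level_gt0 m0; have := level_lt mp => h1 h2.
by rewrite Phi_invK; [ring|apply/andP; split; lra].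
Qed.

Lemma quantile_last : quantile p = Phi_inv (1 - q / 2).
Proof.
by rewrite /quantile; congr (Phi_inv (1 - _)); field; rewrite gt_eqF.
Qed.

Lemma quantile_ge (x : R) m : (0 < m)%N -> (m <= p)%N ->
  m%:R * q / (2 * p%:R) <= 1 - Phi x -> x <= quantile m.
Proof.
move=> m0 mp h; rewrite -Phi_le; have := quantile_tail m0 mp; lra.
Qed.

(** The bound k! >= (k / e)^k in logarithmic form. *)
Lemma sum_ln_ge k : k%:R * ln k%:R - k%:R <= \sum_(0 <= i < k) ln i.+1%:R :> R.
Proof.
elim: k => [|k IH]; first by rewrite big_nil mul0r subr0.
rewrite big_nat_recr//=.
have [->|k0] := posnP k.
  rewrite big_nil ln1 mul1r; lra.
have kR : 0 < k%:R :> R by rewrite ltr0n.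
have E : ln k.+1%:R = ln k%:R + ln (1 + k%:R^-1) :> R.
  rewrite -lnM ?posrE ?addr_gt0 ?invr_gt0//; congr ln.
  by rewrite -natr1; field; rewrite gt_eqF.
have L : k%:R * ln (1 + k%:R^-1) <= 1 :> R.
  have : ln (1 + k%:R^-1) <= k%:R^-1 :> R.
    by apply: le_ln1Dx; rewrite (lt_trans (ltrN10 _))// invr_gt0.
  move=> /(ler_wpM2l (ltW kR)) h; apply: (le_trans h).
  by rewrite divff// gt_eqF.
move: IH; rewrite E -natr1; set s := \sum_(0 <= i < k) _.
move: L; set l := ln (1 + _); set lk := ln k%:R; lra.
Qed.

(** The squared quantile of level i is at most 2 ln (2 p / (i q)); the average of
    ln (p / i) over i <= k is at most ln (p / k) + 1. This is the source of the
    rate 2 k ln (p / k). *)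
Lemma sum_quantile_sqr k : (0 < k)%N -> (k <= p)%N ->
  \sum_(0 <= i < k) quantile i.+1 ^+ 2 <=
  2 * k%:R * (ln (p%:R / k%:R) + ln (2 / q) + 1).
Proof.
move=> k0 kp.
have kR : 0 < k%:R :> R by rewrite ltr0n.
have H i : (0 <= i < k)%N -> quantile i.+1 ^+ 2 <= 2 * (ln (2 / q) + ln p%:R - ln i.+1%:R).
  move=> /andP[_ ik]; have ip : (i.+1 <= p)%N by apply: leq_trans kp.
  apply: (le_trans (Phi_inv_upper (level_gt0 (ltn0Sn i)) (level_lt ip))).
  rewrite ler_pM2l//.
  have -> : (i.+1%:R * q / (2 * p%:R))^-1 = (2 / q) * p%:R / i.+1%:R :> R.
    by field; rewrite !gt_eqF//= ltr0n.
  have h2 : 0 < 2 / q by rewrite divr_gt0.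
  have i0 : 0 < i.+1%:R :> R by rewrite ltr0n.
  rewrite (@ln_div _ (2 / q * p%:R)) ?posrE ?(mulr_gt0 h2 pR)//.
  by rewrite (@lnM _ (2 / q)) ?posrE.
apply: (le_trans (ler_sum_nat H)).
rewrite -mulr_sumr -mulrA ler_pM2l// sumrB.
rewrite [X in X - _]big_const_nat subn0 iter_addr addr0 -[X in X - _]mulr_natl.
have := sum_ln_ge k; set s := \sum_(0 <= i < k) ln _.
rewrite (@ln_div _ p%:R) ?posrE//; lra.
Qed.

End Quantiles.

Section Weights.
Context {R : realType}.
Variables (sigma eps q : R) (p : nat).
Hypotheses (sigma_gt0 : 0 < sigma) (eps_gt0 : 0 < eps).
Hypotheses (q_gt0 : 0 < q) (q_lt1 : q < 1) (p_gt0 : (0 < p)%N).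
Let lam := slope_weight sigma eps q p.

Let s0 : 0 < sigma * (1 + eps). Proof. by rewrite mulr_gt0// addr_gt0. Qed.

Lemma slope_weight_noninc : noninc (lam \o succn) p.
Proof.
move=> i j /andP[ij jp] /=; apply: ler_wpM2l; first exact: ltW.
exact: quantile_noninc.
Qed.

Lemma slope_weight_ge0 i : (i < p)%N -> 0 <= lam i.+1.
Proof.
by move=> ip; rewrite ltW// mulr_gt0//; exact: quantile_gt0.
Qed.

End Weights.

(** The strict inequality 1 + y < exp y for y = x - 1, which is not 0. *)
Lemma chernoff_rate_lt1 (R : realType) (x : R) : x < 1 -> x * expR (1 - x) < 1.
Proof.
move=> x1; have h : 0 < expR (x - 1) by exact: expR_gt0.
rewrite -(ltr_pM2r h) -mulrA -expRD (_ : 1 - x + (x - 1) = 0); last by ring.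
rewrite expR0 mulr1 mul1r; have := @expR_gt1Dx R (x - 1).
rewrite subr_eq0 lt_eqF// => /(_ isT); lra.
Qed.

Lemma geometric_tail (R : realFieldType) (rho : R) (a b : nat) :
  0 <= rho -> rho < 1 ->
  \sum_(a <= r < b | (0 < r)%N) rho ^+ r <= rho ^+ a / (1 - rho).
Proof.
move=> r0 r1; have r1' : 0 < 1 - rho by rewrite subr_gt0.
apply: (@le_trans _ _ (\sum_(a <= r < b) rho ^+ r)).
  rewrite big_mkcond; apply: ler_sum => i _; case: ifP => // _.
  exact: exprn_ge0.
rewrite ler_pdivlMr// mulr_suml.
have [ab|ba] := leqP a b; last by rewrite big_geq ?exprn_ge0// ltnW.
rewrite (eq_bigr (fun r => (- rho ^+ r.+1) - (- rho ^+ r))); last first.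
  by move=> i _; rewrite exprS; ring.
rewrite telescope_sumr//.
have := exprn_ge0 b r0; lra.
Qed.

(** * The risk in fixed dimensions *)

Lemma sqrt_le (R : rcfType) (x y : R) : 0 <= y -> x <= y ^+ 2 -> Num.sqrt x <= y.
Proof.
by move=> y0 h; rewrite -[leRHS](ger0_norm y0) -sqrtr_sqr ler_wsqrtr.
Qed.

Lemma noise_norm_event d (T : measurableType d) (R : realType) (P : probability T R)
    (n : nat) (z : 'I_n -> {RV P >-> R}) (sigma tau : R) :
  0 < sigma -> iid_normal 0 sigma z -> 0 < tau -> tau <= 1 / 2 ->
  exists B, [/\ measurable B, (P B <= (expR (- (tau ^+ 2 / 8 * n%:R)))%:E)%E &
    forall w, ~ B w -> dot (noise z w) (noise z w) <= (1 + tau) * n%:R * sigma ^+ 2].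
Proof.
move=> sg [ind law] t0 t2.
have s0 (i : 'I_n) : sigma != 0 by rewrite gt_eqF.
have ur (i : 'I_n) : uniq [:: i] by [].
have dis (i j : 'I_n) : i != j ->
    fintype.disjoint (mem [set x in [:: i]]%SET) (mem [set x in [:: j]]%SET).
  move=> ij; rewrite -finset.setI_eq0; apply/eqP/finset.setP => x; rewrite !inE.
  by apply/negP => /andP[/eqP-> /eqP ji]; rewrite ji eqxx in ij.
have var (i : 'I_n) : \sum_(x <- [:: i]) (1 * sigma) ^+ 2 = sigma ^+ 2.
  by rewrite big_seq1 mul1r.
have v0 : 0 < sigma ^+ 2 by rewrite exprn_gt0.
have := chi2_upper ind s0 law ur dis var v0 t0 t2.
have -> : [set w | ((1 + tau) * #|'I_n|%:R * sigma ^+ 2 <=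
      \sum_k linform z (fun i => [:: i]) (fun=> 1) k w ^+ 2)%R] =
    [set w | ((1 + tau) * n%:R * sigma ^+ 2 <= dot (noise z w) (noise z w))%R].
  apply/funext => w; rewrite /= card_ord; congr (is_true (_ <= _)).
  by apply: eq_bigr => i _; rewrite /linform big_seq1 mul1r !mxE expr2.
rewrite card_ord => PB.
eexists; split; [|exact: PB|].
- have mN : measurable_fun setT (fun w => dot (noise z w) (noise z w)).
    apply: measurable_sum => i.
    by under [X in measurable_fun _ X]eq_fun do rewrite !mxE; exact: measurable_funM.
  rewrite -[X in measurable X]setTI.
  rewrite (_ : [set w | _] = (fun w => dot (noise z w) (noise z w)) @^-1`
     `[(1 + tau) * n%:R * sigma ^+ 2, +oo[).
    exact: mN.
  by apply/seteqP; split => w; rewrite /= in_itv/= andbT.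
- by move=> w /negP; rewrite -ltNge => /ltW.
Qed.

(** The slack eps (1 - eps) = (1 + 3 eps) - (1 + eps)^2 leaves room for the relative
    errors of order dl: the squared bracket is at most (1 + eps + 22 dl)^2, and
    the choice of dl spends less than the slack. *)
Lemma constant_bound (R : realFieldType) (eps dl : R) : 0 < eps -> eps < 1 ->
  dl = eps * (1 - eps) / 128 ->
  [/\ 0 < dl, dl <= 1 / 512 & ((dl + (1 + eps) * (1 + dl)) / (1 - 4 * dl) + dl) ^+ 2
    <= 1 + 3 * eps].
Proof.
move=> e0 e1 dlE.
have d0 : 0 < dl by rewrite dlE divr_gt0// mulr_gt0// subr_gt0.
have d1 : dl <= 1 / 512.
  by rewrite dlE ler_pdivrMr//; have := sqr_ge0 (eps - 1 / 2); rewrite expr2; lra.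
split => //.
have h : (dl + (1 + eps) * (1 + dl)) / (1 - 4 * dl) <= 1 + eps + 21 * dl.
  rewrite ler_pdivrMr; last by lra.
  have : eps * dl <= dl by rewrite ler_piMl// ltW.
  have : 0 <= eps * dl by rewrite mulr_ge0// ltW.
  have : dl * dl <= 1 / 512 * dl by rewrite ler_wpM2r// ltW.
  rewrite (_ : (1 + eps + 21 * dl) * (1 - 4 * dl) =
    1 + eps + 17 * dl - 4 * (eps * dl) - 84 * (dl * dl)); last by ring.
  rewrite (_ : dl + (1 + eps) * (1 + dl) = 1 + eps + 2 * dl + eps * dl); last by ring.
  lra.
have x0 : 0 <= (dl + (1 + eps) * (1 + dl)) / (1 - 4 * dl) + dl.
  rewrite addr_ge0 ?(ltW d0)// divr_ge0//; last by lra.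
  by rewrite addr_ge0 ?(ltW d0)// mulr_ge0// ltW// addr_gt0.
apply: (@le_trans _ _ ((1 + eps + 22 * dl) ^+ 2)).
  rewrite ler_sqr ?nnegrE//; last by rewrite !addr_ge0// ?mulr_ge0// ltW.
  lra.
have E : eps - eps * eps = 128 * dl by rewrite dlE; field.
have : eps * dl <= dl by rewrite ler_piMl// ltW.
have : dl * dl <= 1 / 512 * dl by rewrite ler_wpM2r// ltW.
rewrite (_ : (1 + eps + 22 * dl) ^+ 2 =
  1 + 2 * eps + eps * eps + 44 * dl + 44 * (eps * dl) + 484 * (dl * dl)); last by ring.
lra.
Qed.

(** The problem at fixed (k, n, p). The derived constants are variables with
    defining equations. The deviation of the noise is inflated from sigma to
    M = sigma (1 + eps / 3), the thresholds for the correlations are the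
    quantiles times sigma (1 + 2 eps / 3), and the weights of SLOPE carry
    the factor 1 + eps: the first gap provides decaying tails, the second one
    the margin c between thresholds and weights. *)
Section RiskEvent.
Context d (T : measurableType d) (R : realType) (P : probability T R).
Variables (k n p : nat) (sigma eps q : R).
Hypotheses (k_gt0 : (0 < k)%N) (n_gt0 : (0 < n)%N).
Hypotheses (sigma_gt0 : 0 < sigma) (eps_gt0 : 0 < eps) (eps_lt1 : eps < 1).
Hypotheses (q_gt0 : 0 < q) (q_lt1 : q < 1).
Variables (X : 'I_n * 'I_p -> {RV P >-> R}) (z : 'I_n -> {RV P >-> R}).
Hypothesis X_iid : iid_normal 0 (Num.sqrt n%:R^-1) X.
Hypothesis z_iid : iid_normal 0 sigma z.
Hypothesis Xz_indep : independent_families X z.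
Variable bhat : 'M[R]_(n, p) -> 'cV[R]_n -> 'cV[R]_p.
Hypothesis bhat_min : forall A y,
  is_slope_estimate (slope_weight sigma eps q p) A y (bhat A y).
Variable beta : 'cV[R]_p.
Hypothesis Sk : (#|supp beta| <= k)%N.
Variables (L N0 : nat) (rho0 tau M dl Lp q1 ell c : R).
Hypotheses (tauE : tau = eps / 6) (ME : M = sigma * (1 + 2 * tau)).
Hypotheses (dlE : dl = eps * (1 - eps) / 128) (LpE : Lp = ln (p%:R / k%:R)).
Hypotheses (q1E : q1 = (1 + q) / 2) (ellE : ell = sigma * (1 + 4 * tau) * quantile q p (L.+1 * k)).
Hypotheses (cE : c = eps / 3 * sigma * quantile q p p).
Hypotheses (Lkp : (L.+1 * k <= p)%N).
Hypotheses (N0_gt0 : (0 < N0)%N) (N0_dl : 1 <= dl * N0%:R).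
Hypotheses (L_q : q <= (q1 - q) * L%:R).
Hypotheses (rho0_gt0 : 0 < rho0) (rho0_le1 : rho0 <= 1) (rho0_c : rho0 <= (20^-1 * c) ^+ 2).
Hypotheses (Lp_q : 1 + ln (2 / q) <= dl * Lp) (Lp_sigma : 2 <= dl ^+ 2 * sigma ^+ 2 * Lp).
Hypotheses (n_large : 32 * (k%:R * Lp) <= tau ^+ 2 * n%:R).

Let lam := slope_weight sigma eps q p.

(** The five terms bound the probabilities of the failures of restricted isometry
    at sparsity 2 k, of the bound on |z|, of the bound on the correlations of the
    noise with the support, and of the two estimates of [residual_event]. *)
Definition rip_term : R :=
  (p * (2 * (2 * k * N0)).+1)%:R ^+ (2 * k) * (2 * expR (- (dl ^+ 2 / 8 * n%:R))).
Definition noise_term : R := expR (- (tau ^+ 2 / 8 * n%:R)).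
Definition signal_term : R :=
  k%:R * (M ^+ 2 * second_moment) / (dl ^+ 2 * (2 * sigma ^+ 2 * k%:R * Lp)).
Definition excess_term : R :=
  p%:R * (4 / (ell / M ^+ 2) ^+ 2 *
    expR (- (ell / M ^+ 2 * ell) + (ell / M ^+ 2 * M) ^+ 2 / 2)) / (rho0 * k%:R).
Definition rank_term : R :=
  (q1 * expR (1 - q1)) ^+ (L * k) / (1 - q1 * expR (1 - q1)).

Let p_gt0 : (0 < p)%N.
Proof. by apply: leq_trans Lkp; rewrite muln_gt0. Qed.
Let kp : (k <= p)%N.
Proof. by apply: leq_trans Lkp; rewrite leq_pmull. Qed.
Let kR : 0 < k%:R :> R. Proof. by rewrite ltr0n. Qed.
Let nR : 0 < n%:R :> R. Proof. by rewrite ltr0n. Qed.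
Let tau_gt0 : 0 < tau. Proof. by rewrite tauE divr_gt0. Qed.
Let tau_le : tau <= 1 / 6. Proof. rewrite tauE; move: eps_lt1; lra. Qed.
Let M_gt0 : 0 < M.
Proof. by rewrite ME mulr_gt0//; move: tau_gt0; lra. Qed.
Let c_gt0 : 0 < c.
Proof.
rewrite cE mulr_gt0 ?quantile_gt0// mulr_gt0//; move: eps_gt0; lra.
Qed.
Let ell_gt0 : 0 < ell.
Proof.
rewrite ellE mulr_gt0 ?quantile_gt0 ?muln_gt0// mulr_gt0//; move: tau_gt0; lra.
Qed.
Let q1_gt0 : 0 < q1. Proof. rewrite q1E; move: q_gt0; lra. Qed.
Let q1_lt1 : q1 < 1. Proof. rewrite q1E; move: q_lt1; lra. Qed.
Let lam_dec : noninc (lam \o succn) p.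
Proof. exact: slope_weight_noninc. Qed.
Let lam_ge0 i : (i < p)%N -> 0 <= lam i.+1.
Proof. exact: slope_weight_ge0. Qed.
Let dl_bounds := constant_bound eps_gt0 eps_lt1 dlE.
Let dl_gt0 : 0 < dl. Proof. by case: dl_bounds. Qed.
Let dl_le : dl <= 1 / 512. Proof. by case: dl_bounds. Qed.
Let Lp_gt0 : 0 < Lp.
Proof.
have h : 0 < dl ^+ 2 * sigma ^+ 2 by rewrite mulr_gt0 ?exprn_gt0.
by rewrite -(pmulr_rgt0 _ h); apply: lt_le_trans Lp_sigma.
Qed.

Let rho_lt1 : q1 * expR (1 - q1) < 1.
Proof.
exact: chernoff_rate_lt1.
Qed.

Let D : R := Num.sqrt (2 * sigma ^+ 2 * k%:R * Lp).
Let D_arg : 0 < 2 * sigma ^+ 2 * k%:R * Lp.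
Proof. by rewrite !mulr_gt0// exprn_gt0. Qed.
Let D2 : D ^+ 2 = 2 * sigma ^+ 2 * k%:R * Lp.
Proof. by rewrite sqr_sqrtr// ltW. Qed.
Let D_gt0 : 0 < D. Proof. by rewrite sqrtr_gt0. Qed.

Let lamk : R := (1 + eps) * (1 + dl) * D.

Let lam_sum : \sum_(0 <= i < k) lam i.+1 ^+ 2 <= lamk ^+ 2.
Proof.
have -> : \sum_(0 <= i < k) lam i.+1 ^+ 2 =
   (sigma * (1 + eps)) ^+ 2 * \sum_(0 <= i < k) quantile q p i.+1 ^+ 2.
  by rewrite mulr_sumr; apply: eq_bigr => i _; rewrite -exprMn.
have se : 0 < sigma * (1 + eps) by rewrite mulr_gt0// addr_gt0.
apply: (le_trans (ler_wpM2l (sqr_ge0 _) (sum_quantile_sqr q_gt0 q_lt1 p_gt0 k_gt0 kp))).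
have -> : lamk ^+ 2 = (sigma * (1 + eps)) ^+ 2 * (2 * k%:R * ((1 + dl) ^+ 2 * Lp)).
  by rewrite /lamk exprMn D2; ring.
rewrite -LpE.
rewrite ler_wpM2l ?sqr_ge0// ler_wpM2l ?mulr_ge0//.
have : 0 <= dl ^+ 2 * Lp by rewrite mulr_ge0 ?sqr_ge0// ltW.
have -> : (1 + dl) ^+ 2 * Lp = Lp + 2 * (dl * Lp) + dl ^+ 2 * Lp by ring.
have : 0 <= dl * Lp by rewrite mulr_ge0// ltW.
move: Lp_q; set l := ln _; lra.
Qed.

Let E0 : R := rho0 * k%:R.

Let E0_small : Num.sqrt E0 <= 20^-1 * c * Num.sqrt k%:R.
Proof.
apply: sqrt_le; first by rewrite !mulr_ge0 ?sqrtr_ge0// ltW.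
by rewrite exprMn sqr_sqrtr// ler_wpM2r.
Qed.

Let E0_D : 2 * Num.sqrt E0 <= dl * D.
Proof.
have h : Num.sqrt E0 <= dl * D / 2.
  apply: sqrt_le; first by rewrite !mulr_ge0// ltW.
  have -> : (dl * D / 2) ^+ 2 = dl ^+ 2 * sigma ^+ 2 * Lp / 2 * k%:R.
    by rewrite exprMn exprMn D2; field.
  rewrite ler_wpM2r// (le_trans rho0_le1)//; move: Lp_sigma; lra.
move: h; lra.
Qed.

Let nz : R := dl * D.

(** Outside the exceptional event the hypotheses of [deterministic_bound] hold with
    nz = dl D, lamk = (1 + eps) (1 + dl) D and 2 sqrt E <= dl D, where
    D^2 = 2 sigma^2 k ln (p / k). *)
Lemma risk_event : exists B, [/\ measurable B,
  (P B <= (rip_term + noise_term + signal_term + (excess_term + rank_term))%:E)%E &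
  forall w, ~ B w ->
    enorm (design X w *m bhat (design X w) (design X w *m beta + noise z w) -
           design X w *m beta) ^+ 2 <=
    (1 + 3 * eps) * (2 * sigma ^+ 2 * k%:R * Lp)].
Proof.
have s_gt0 : (0 < 2 * k)%N by rewrite muln_gt0.
have N_gt0 : (0 < 2 * k * N0)%N by rewrite muln_gt0 s_gt0.
have dl4 : dl <= 1 / 4 by move: dl_le; lra.
have sN : (2 * k)%:R <= dl * (2 * k * N0)%:R :> R.
  have -> : dl * (2 * k * N0)%:R = (2 * k)%:R * (dl * N0%:R) :> R.
    by rewrite [in LHS]natrM; ring.
  by rewrite ler_peMr.
have nz_gt0 : 0 < nz by rewrite mulr_gt0.
have [B1 mB1 [PB1 hB1]] := rip_prob n_gt0 X_iid s_gt0 N_gt0 dl_gt0 dl4 sN.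
have tau2 : tau <= 1 / 2 by move: tau_le; lra.
have [B2 [mB2 PB2 hB2]] := noise_norm_event sigma_gt0 z_iid tau_gt0 tau2.
have [B3 [mB3 PB3 hB3]] :=
  signal_noise_event n_gt0 X_iid z_iid.1 Xz_indep (supp beta) M_gt0 nz_gt0.
pose t r := sigma * (1 + 4 * tau) * quantile q p (#|supp beta| + r).
have th_gt0 : 0 < ell / M ^+ 2 by rewrite divr_gt0// exprn_gt0.
have E0_gt0 : 0 < E0 by rewrite mulr_gt0.
have sum_le r : (r <= p - #|supp beta|)%N -> (#|supp beta| + r <= p)%N.
  by move=> h; rewrite -leq_subRL// (leq_trans Sk).
have st_gt0 : 0 < sigma * (1 + 4 * tau) by rewrite mulr_gt0//; move: tau_gt0; lra.
have Hlam r : (0 < r)%N -> (r <= p - #|supp beta|)%N ->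
    (if (L * k <= r)%N then t r else ell) <= lam (#|supp beta| + r)%N - c.
  move=> r_gt0 rp; have srp := sum_le r rp.
  have sr_gt0 : (0 < #|supp beta| + r)%N by rewrite addn_gt0 r_gt0 orbT.
  have tc : t r <= lam (#|supp beta| + r)%N - c.
    have gp := quantile_noninc q_gt0 q_lt1 p_gt0 sr_gt0 srp (leqnn p).
    rewrite /t /lam /slope_weight -/(quantile q p _) cE tauE.
    move: gp; set g := quantile q p (_ + _); set g' := quantile q p p => gp.
    have : sigma * eps * g' <= sigma * eps * g by rewrite ler_wpM2l// mulr_ge0// ltW.
    lra.
  case: leqP => // rL; apply: le_trans tc; rewrite ellE /t ler_wpM2l ?(ltW st_gt0)//.
  apply: quantile_noninc => //.
  by rewrite mulSn leq_add// ltnW.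
have Hphi r : (0 < r)%N -> (r <= p - #|supp beta|)%N -> (L * k <= r)%N ->
    p%:R * (2 * (1 - Phi (t r / M))) <= q1 * r%:R.
  move=> r_gt0 rp rL; have srp := sum_le r rp.
  have sr_gt0 : (0 < #|supp beta| + r)%N by rewrite addn_gt0 r_gt0 orbT.
  have g0 := quantile_gt0 q_gt0 q_lt1 p_gt0 sr_gt0 srp.
  have tail := quantile_tail q_gt0 q_lt1 p_gt0 sr_gt0 srp.
  have tM : quantile q p (#|supp beta| + r) <= t r / M.
    rewrite ler_pdivlMr// /t ME mulrC ler_wpM2r ?(ltW g0)// ler_wpM2l ?(ltW sigma_gt0)//.
    move: tau_gt0; lra.
  have pR : 0 < p%:R :> R by rewrite ltr0n.
  apply: (@le_trans _ _ (p%:R * (2 * ((#|supp beta| + r)%:R * q / (2 * p%:R))))).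
    rewrite ler_pM2l// ler_pM2l// -tail lerB// Phi_le//.
  have -> : p%:R * (2 * ((#|supp beta| + r)%:R * q / (2 * p%:R))) =
      (#|supp beta| + r)%:R * q :> R by field; rewrite gt_eqF.
  rewrite natrD.
  have sk : #|supp beta|%:R <= k%:R :> R by rewrite ler_nat.
  have Lr : L%:R * k%:R <= r%:R :> R by rewrite -natrM ler_nat.
  have q1q : 0 <= q1 - q by rewrite q1E; move: q_lt1; lra.
  have h1 := ler_wpM2r (ltW q_gt0) sk.
  have h2 := ler_wpM2r (ltW kR) L_q.
  have h3 := ler_wpM2l q1q Lr.
  move: h1 h2 h3; lra.
have [B4 [mB4 PB4 hB4]] := residual_event n_gt0 X_iid z_iid.1 Xz_indep
  lam_dec lam_ge0 bhat_min M_gt0 E0_gt0 th_gt0 q1_gt0 q1_lt1 Hlam Hphi.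
exists (B1 `|` B2 `|` B3 `|` B4); split.
- by do 3 apply: measurableU => //.
- rewrite EFinD; apply: (le_trans (measureU2 _ _ _)) => //.
    by do 2 apply: measurableU => //.
  apply: leeD; last first.
    apply: (le_trans PB4); rewrite lee_fin lerD2l; apply: geometric_tail => //.
    by rewrite mulr_ge0 ?expR_ge0// ltW.
  rewrite EFinD; apply: (le_trans (measureU2 _ _ _)) => //.
    exact: measurableU.
  apply: leeD; last first.
    apply: (le_trans PB3); rewrite lee_fin /signal_term /nz exprMn D2.
    rewrite ler_wpM2r//.
      by rewrite invr_ge0 mulr_ge0 ?sqr_ge0// ltW.
    rewrite ler_wpM2r ?ler_nat// mulr_ge0 ?sqr_ge0//.
    by rewrite /second_moment mulr_ge0// expR_ge0.
  rewrite EFinD; apply: (le_trans (measureU2 _ _ _)) => //.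
  exact: leeD.
move=> w nB; pose A := design X w; pose y : 'cV[R]_n := A *m beta + noise z w.
rewrite -/A -/y.
have nB1 : ~ B1 w by move=> h; apply: nB; left; left; left.
have nB2 : ~ B2 w by move=> h; apply: nB; left; left; right.
have nB3 : ~ B3 w by move=> h; apply: nB; left; right.
have nB4 : ~ B4 w by move=> h; apply: nB; right.
have rip := hB1 w nB1.
have dl4_ge0 : 0 <= 4 * dl by rewrite mulr_ge0// ltW.
have dl4_le : 4 * dl <= 1 / 4 by move: dl_le; lra.
have lamk_gt0 : 0 < lamk.
  by rewrite mulr_gt0// mulr_gt0// addr_gt0.
have z_norm := hB2 w nB2.
have z_dot : dot (noise z w) (noise z w) <= n%:R * M ^+ 2.
  apply: (le_trans z_norm).
  have -> : n%:R * M ^+ 2 = (1 + 2 * tau) ^+ 2 * n%:R * sigma ^+ 2 by rewrite ME; ring.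
  rewrite ler_wpM2r ?sqr_ge0// ler_wpM2r//.
  by have := sqr_ge0 tau; move: tau_gt0; rewrite !expr2; lra.
have Hnz := hB3 w nB3 z_dot.
have bt0_min := bhat_min (restrcol (supp beta) A) y.
have oracle := oracle_error lam_dec lam_ge0 Sk bt0_min dl4_le rip (ltW nz_gt0)
  (ltW lamk_gt0) Hnz lam_sum.
have res_dot : dot (residual X z beta bhat w) (residual X z beta bhat w) <= n%:R * M ^+ 2.
  set h := A *m restr (supp beta) (bhat (restrcol (supp beta) A) y) - A *m beta in oracle.
  have -> : residual X z beta bhat w = noise z w - h.
    rewrite /residual -/A -/y /h /y.
    move: (A *m beta) (noise z w) (A *m restr _ _) => a b a'.
    by rewrite opprB addrCA addrA.
  have sn : 0 <= sigma * Num.sqrt n%:R by rewrite mulr_ge0 ?sqrtr_ge0// ltW.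
  have z_le : enorm (noise z w) <= (1 + tau) * (sigma * Num.sqrt n%:R).
    rewrite enormE; apply: sqrt_le; first by rewrite mulr_ge0// addr_ge0// ltW.
    rewrite !exprMn sqr_sqrtr ?(ltW nR)//; apply: (le_trans z_norm).
    have sn2 : 0 <= sigma ^+ 2 * n%:R by exact: mulr_ge0 (sqr_ge0 _) (ltW nR).
    rewrite -mulrA [n%:R * _]mulrC; apply: ler_wpM2r => //.
    by rewrite expr2 ler_peMr; move: tau_gt0; lra.
  have D_le : 4 * D <= tau * (sigma * Num.sqrt n%:R).
    rewrite -ler_sqr ?nnegrE ?mulr_ge0 ?sqrtr_ge0 ?(ltW sigma_gt0) ?(ltW tau_gt0)//.
    rewrite [leLHS]exprMn D2 !exprMn sqr_sqrtr ?(ltW nR)//.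
    have := ler_wpM2l (sqr_ge0 sigma) n_large; lra.
  have h_le : enorm h <= 4 * D.
    have d34 : 0 < 1 - 4 * dl by move: dl_le; lra.
    rewrite -(ler_pM2l d34); apply: (le_trans oracle).
    rewrite /nz /lamk -mulrDl mulrA ler_wpM2r ?(ltW D_gt0)//.
    have : eps * dl <= dl by rewrite ler_piMl// ltW.
    by move: dl_le eps_lt1; lra.
  rewrite -enorm_sqr.
  have -> : n%:R * M ^+ 2 = ((1 + 2 * tau) * (sigma * Num.sqrt n%:R)) ^+ 2.
    by rewrite !exprMn sqr_sqrtr ?(ltW nR)// ME; ring.
  rewrite ler_sqr ?nnegrE ?enorm_ge0//; last first.
    by rewrite mulr_ge0//; move: tau_gt0; lra.
  by have := enormB (noise z w) h; move: z_le D_le h_le; lra.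
have [HE [s2 ps2 noise_ok]] := hB4 w nB4 res_dot.
have := deterministic_bound k_gt0 kp lam_dec lam_ge0 Sk (bhat_min A y) bt0_min
  dl4_ge0 dl4_le rip (ltW nz_gt0) (ltW lamk_gt0) Hnz lam_sum ps2 c_gt0 noise_ok HE E0_small.
move=> bound.
have [_ _ cb] := dl_bounds.
rewrite -D2; apply: (@le_trans _ _ ((((dl + (1 + eps) * (1 + dl)) / (1 - 4 * dl) + dl) * D) ^+ 2)).
  rewrite ler_sqr ?nnegrE ?enorm_ge0//.
    apply: (le_trans bound).
    have -> : ((dl + (1 + eps) * (1 + dl)) / (1 - 4 * dl) + dl) * D =
        (nz + lamk) / (1 - 4 * dl) + nz by rewrite /nz /lamk; ring.
    by rewrite lerD2l E0_D.
  rewrite mulr_ge0 ?(ltW D_gt0)// addr_ge0 ?(ltW dl_gt0)// divr_ge0//; last by move: dl_le; lra.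
  by rewrite addr_ge0 ?(ltW dl_gt0)// mulr_ge0// addr_ge0// ltW.
by rewrite exprMn ler_wpM2r ?sqr_ge0.
Qed.

End RiskEvent.

(** * Choice of the constants *)

Lemma seq_bound (R : realDomainType) (s : seq R) :
  exists2 K : R, 0 < K & forall a, a \in s -> a <= K.
Proof.
elim: s => [|x s [K K0 IH]]; first by exists 1.
exists (Num.max x K); first by rewrite lt_max K0 orbT.
by move=> a; rewrite inE => /orP[/eqP->|/IH h]; rewrite le_max ?lexx ?h ?orbT.
Qed.

Lemma nat_above (R : realType) (x : R) : exists2 N : nat, (0 < N)%N & x <= N%:R.
Proof.
exists (Num.bound `|x|).+1 => //.
have := archi_boundP (normr_ge0 x) => /ltW h.
by rewrite (le_trans (ler_norm x))// (le_trans h)// ler_nat.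
Qed.

Lemma expr_small (R : realType) (rho e : R) : 0 <= rho -> rho < 1 -> 0 < e ->
  exists N, forall m, (N <= m)%N -> rho ^+ m <= e.
Proof.
move=> r0 r1 e0.
have : (rho ^+ m @[m --> \oo] --> 0)%classic by apply: cvg_expr; rewrite ger0_norm.
move=> /cvgrPdist_le /(_ e e0) [N _ h]; exists N => m Nm.
by have := h m Nm; rewrite sub0r normrN ger0_norm// exprn_ge0.
Qed.

(** By [Phi_inv_lower], p / k is at most a constant times exp ((G + 1)^2 / 2), where
    G is the quantile of level (L + 1) k. The expected excess is p / k times
    exp (- (b G)^2 / 2) up to a constant, and b > 1 makes the difference of the
    exponents tend to minus infinity with G. *)
Lemma excess_small (R : realType) (k p L : nat) (q M b G rho0 ell : R) :
  (0 < k)%N -> 0 < q -> 0 < M -> 1 < b -> 0 < rho0 -> ell = b * M * G ->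
  1 <= G -> 4 / (b ^+ 2 - 1) <= G ->
  normal_peak 1 * expR (- ((G + 1) ^+ 2 / 2)) <= (L.+1 * k)%:R * q / (2 * p%:R) ->
  (0 < p)%N ->
  excess_term k p rho0 M ell <=
  4 * M ^+ 2 * L.+1%:R * q / (normal_peak 1 * rho0) / G.
Proof.
move=> k0 q0 M0 b1 rho00 ellE G1 Gb tail p0.
have kR : 0 < k%:R :> R by rewrite ltr0n.
have pR : 0 < p%:R :> R by rewrite ltr0n.
have G0 : 0 < G by lra.
have peak0 : 0 < normal_peak 1 :> R by exact: normal_peak_gt0 (oner_neq0 R).
set peak := normal_peak 1 in tail peak0 *.
pose Q := b ^+ 2 * G ^+ 2.
have b2 : 0 < b ^+ 2 - 1 by rewrite subr_gt0 exprn_egt1.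
have Q_ge : (G + 1) ^+ 2 + G <= Q.
  have : 4 * G <= (b ^+ 2 - 1) * G * G.
    rewrite ler_wpM2r ?(ltW G0)//; move: Gb; rewrite ler_pdivrMr//; lra.
  rewrite /Q !expr2; lra.
have Q1 : 1 <= Q by have := sqr_ge0 (G + 1); lra.
have Q0 : 0 < Q by lra.
have -> : excess_term k p rho0 M ell =
   p%:R * (4 * M ^+ 2 / Q * expR (- (Q / 2))) / (rho0 * k%:R).
  rewrite /excess_term; congr (_ * (_ * expR _) / _).
    by rewrite ellE /Q; field; rewrite !gt_eqF//; lra.
  by rewrite ellE /Q; field; rewrite !gt_eqF.
pose e1 := expR ((G + 1) ^+ 2 / 2) : R.
have e10 : 0 < e1 by exact: expR_gt0.
have p_le : p%:R <= L.+1%:R * k%:R * q / (2 * peak) * e1.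
  rewrite mulrAC ler_pdivlMr ?mulr_gt0//.
  move: tail; rewrite expRN -/e1 ler_pdivrMr// mulrAC ler_pdivlMr ?mulr_gt0// natrM.
  lra.
have dec : e1 * expR (- (Q / 2)) <= 2 / G.
  rewrite -expRD; apply: (@le_trans _ _ (expR (- (G / 2)))).
    by rewrite ler_expR; lra.
  rewrite expRN -[leRHS]invrK lef_pV2 ?posrE ?invr_gt0 ?divr_gt0 ?expR_gt0//.
  by rewrite invf_div; have := expR_ge1Dx (G / 2); lra.
have Y_le : 4 * M ^+ 2 / Q * expR (- (Q / 2)) <= 4 * M ^+ 2 * expR (- (Q / 2)).
  rewrite ler_wpM2r ?expR_ge0// ler_pdivrMr// ler_peMr// mulr_ge0// sqr_ge0.
  by [].
have Y0 : 0 <= 4 * M ^+ 2 / Q * expR (- (Q / 2)).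
  by rewrite mulr_ge0 ?expR_ge0// divr_ge0 ?(ltW Q0)// mulr_ge0// sqr_ge0.
have rk : 0 < rho0 * k%:R by rewrite mulr_gt0.
rewrite ler_pdivrMr//.
apply: (le_trans (ler_pM (ltW pR) Y0 p_le Y_le)).
have -> : L.+1%:R * k%:R * q / (2 * peak) * e1 * (4 * M ^+ 2 * expR (- (Q / 2))) =
  L.+1%:R * k%:R * q / (2 * peak) * (4 * M ^+ 2) * (e1 * expR (- (Q / 2))) by ring.
have -> : 4 * M ^+ 2 * L.+1%:R * q / (peak * rho0) / G * (rho0 * k%:R) =
  L.+1%:R * k%:R * q / (2 * peak) * (4 * M ^+ 2) * (2 / G).
  by field; rewrite !gt_eqF.
apply: ler_wpM2l dec.
apply: mulr_ge0; last by rewrite mulr_ge0// sqr_ge0.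
by rewrite ltW// divr_gt0 ?mulr_gt0 ?ltr0n.
Qed.


Lemma expR_lnV (R : realType) (k p : nat) : (0 < k)%N -> (0 < p)%N -> 0 <= ln p%:R :> R ->
  expR (- (k%:R * ln p%:R)) <= p%:R^-1 :> R.
Proof.
move=> k0 p0 l0.
have pR : 0 < p%:R :> R by rewrite ltr0n.
rewrite -[leRHS]lnK ?posrE ?invr_gt0// ler_expR lnV ?posrE// lerN2.
by rewrite ler_peMl// ler1n.
Qed.

(** The net has at most (p^3)^(2 k) = exp (6 k ln p) points, and the concentration
    exponent exceeds 7 k ln p. *)
Lemma rip_term_le (R : realType) (k n p N0 : nat) (dl : R) :
  (0 < k)%N -> (0 < N0)%N -> (k <= p)%N -> (5 * N0 <= p)%N -> 
  7 * (k%:R * ln p%:R) <= dl ^+ 2 / 8 * n%:R ->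
  rip_term k n p N0 dl <= 2 / p%:R.
Proof.
move=> k0 N00 kp Np h.
have p0 : (0 < p)%N by apply: leq_trans kp.
have pR : 0 < p%:R :> R by rewrite ltr0n.
have l0 : 0 <= ln p%:R :> R by rewrite ln_ge0// ler1n.
rewrite /rip_term.
have le3 : (p * (2 * (2 * k * N0)).+1)%:R <= p%:R ^+ 3 :> R.
  rewrite -natrX ler_nat expnS leq_mul2l; apply/orP; right.
  have h1 : ((2 * (2 * k * N0)).+1 <= k * (5 * N0))%N.
    have : (0 < k * N0)%N by rewrite muln_gt0 k0.
    have -> : (2 * (2 * k * N0) = 4 * (k * N0))%N by rewrite !mulnA.
    have -> : (k * (5 * N0) = 5 * (k * N0))%N by rewrite mulnCA.
    by move: (k * N0)%N => m m0; rewrite (mulSn 4) -addn1 addnC leq_add2r.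
  by apply: (leq_trans h1); rewrite leq_mul.
have E : (p%:R ^+ 3) ^+ (2 * k) = expR (6 * (k%:R * ln p%:R)) :> R.
  rewrite -exprM (_ : (3 * (2 * k) = 6 * k)%N); last by rewrite mulnA.
  have -> : 6 * (k%:R * ln p%:R) = (6 * k)%:R * ln p%:R :> R by rewrite natrM; ring.
  by rewrite expRM_natl lnK.
apply: (@le_trans _ _ (expR (6 * (k%:R * ln p%:R)) * (2 * expR (- (dl ^+ 2 / 8 * n%:R))))).
  apply: ler_wpM2r; first by rewrite mulr_ge0 ?expR_ge0.
  by rewrite -E lerXn2r ?nnegrE ?exprn_ge0.
rewrite mulrCA -expRD ler_pM2l//.
apply: le_trans (expR_lnV k0 p0 l0); rewrite ler_expR.
move: h; set a := k%:R * ln p%:R; lra.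
Qed.

(** The quantifiers matter: L (the number of top ranks treated by the excess) and the
    net fineness N0 depend only on eps, q, sigma and eta, then the quantile
    threshold Gs and the lower bound La on ln (p / k), and finally K. Each of the
    five terms of [risk_event] is made at most eta / 5. *)
Theorem uniform_risk (R : realType) (sigma eps q eta : R) :
  0 < sigma -> 0 < eps -> eps < 1 -> 0 < q -> q < 1 -> 0 < eta ->
  exists2 K : R, 0 < K & forall k n p : nat, (0 < k)%N -> (0 < n)%N -> (0 < p)%N ->
    K * k%:R <= p%:R -> K * (k%:R * ln p%:R) <= n%:R ->
    0 < ln (p%:R / k%:R) :> R /\
    forall d (T : measurableType d) (P : probability T R)
      (X : 'I_n * 'I_p -> {RV P >-> R}) (z : 'I_n -> {RV P >-> R}),
    iid_normal 0 (Num.sqrt n%:R^-1) X -> iid_normal 0 sigma z ->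
    independent_families X z ->
    forall bhat, (forall A y, is_slope_estimate (slope_weight sigma eps q p) A y (bhat A y)) ->
    forall beta : 'cV[R]_p, (#|supp beta| <= k)%N ->
    exists B, [/\ measurable B, (P B <= eta%:E)%E & forall w, ~ B w ->
      enorm (design X w *m bhat (design X w) (design X w *m beta + noise z w) -
           design X w *m beta) ^+ 2 <=
      (1 + 3 * eps) * (2 * sigma ^+ 2 * k%:R * ln (p%:R / k%:R))].
Proof.
move=> sigma0 eps0 eps1 q0 q1 eta0.
have [tau tauE] : exists tau : R, tau = eps / 6 by eexists.
have [M ME] : exists M : R, M = sigma * (1 + 2 * tau) by eexists.
have [dl dlE] : exists dl : R, dl = eps * (1 - eps) / 128 by eexists.
have [q' q'E] : exists q' : R, q' = (1 + q) / 2 by eexists.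
have [c cE] : exists c : R, c = eps / 3 * sigma * Phi_inv (1 - q / 2) by eexists.
have tau0 : 0 < tau by rewrite tauE divr_gt0.
have M0 : 0 < M by rewrite ME mulr_gt0//; lra.
have [dl0 _ _] := constant_bound eps0 eps1 dlE.
have c0 : 0 < c.
  rewrite cE mulr_gt0//; first by rewrite mulr_gt0// divr_gt0.
  by apply: Phi_inv_gt0; lra.
have [rho0 [rho00 rho01 rho0c]] :
    exists rho0 : R, [/\ 0 < rho0, rho0 <= 1 & rho0 <= (20^-1 * c) ^+ 2].
  exists (Num.min 1 ((20^-1 * c) ^+ 2)); split; last 2 first.
  - by rewrite ge_min lexx.
  - by rewrite ge_min lexx orbT.
  - by rewrite lt_min ltr01 exprn_gt0// mulr_gt0// invr_gt0.
have q'0 : 0 < q' by rewrite q'E; lra.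
have q'1 : q' < 1 by rewrite q'E; lra.
have [rho [rhoE rho_ge0 rho_lt1]] : exists rho : R,
    [/\ rho = q' * expR (1 - q'), 0 <= rho & rho < 1].
  eexists; split; [reflexivity|by rewrite mulr_ge0 ?expR_ge0// ltW|].
  exact: chernoff_rate_lt1.
have rho1 : 0 < 1 - rho by rewrite subr_gt0.
have e50 : 0 < eta / 5 by rewrite divr_gt0.
have [L0 HL0] := expr_small rho_ge0 rho_lt1 (mulr_gt0 e50 rho1).
have [L1 L1_gt0 HL1] := nat_above (q / (q' - q)).
pose L := (L0 + L1)%N.
have q'q : 0 < q' - q by rewrite q'E; lra.
have L_q : q <= (q' - q) * L%:R.
  rewrite mulrC -ler_pdivrMr//; apply: (le_trans HL1).
  by rewrite ler_nat leq_addl.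
have [N0 N0_gt0 HN0] := nat_above dl^-1.
have N0_dl : 1 <= dl * N0%:R by rewrite mulrC -ler_pdivrMr// div1r.
pose b := (1 + 4 * tau) / (1 + 2 * tau).
have b1 : 1 < b by rewrite /b ltr_pdivlMr; lra.
have peak0 : 0 < normal_peak 1 :> R by exact: normal_peak_gt0 (oner_neq0 R).
pose C := 4 * M ^+ 2 * L.+1%:R * q / (normal_peak 1 * rho0).
have [Gs [Gs1 Gsb GsC]] : exists G : R, [/\ 1 <= G, 4 / (b ^+ 2 - 1) <= G & C / (eta / 5) <= G].
  have [G _ h] := seq_bound [:: 1; 4 / (b ^+ 2 - 1); C / (eta / 5)].
  by exists G; split; apply: h; rewrite !inE eqxx ?orbT.
pose v := 1 - Phi Gs.
have v0 : 0 < v.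
  have : Phi Gs < Phi (Gs + 1) by rewrite Phi_lt ltrDl.
  have : 0 <= 1 - Phi (Gs + 1) by rewrite -lee_fin Phi_tail.
  rewrite /v; lra.
have [La [La1 La2 La3]] : exists La : R, [/\ (1 + ln (2 / q)) / dl <= La,
    2 / (dl ^+ 2 * sigma ^+ 2) <= La &
    M ^+ 2 * second_moment / (2 * dl ^+ 2 * sigma ^+ 2) / (eta / 5) <= La].
  have [G _ h] := seq_bound [:: (1 + ln (2 / q)) / dl; 2 / (dl ^+ 2 * sigma ^+ 2);
     M ^+ 2 * second_moment / (2 * dl ^+ 2 * sigma ^+ 2) / (eta / 5)].
  by exists G; split; apply: h; rewrite !inE eqxx ?orbT.
have [K K0 HK] := seq_bound [:: L.+1%:R; expR La; L.+1%:R * q / (2 * v); (5 * N0)%:R;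
   2 / (eta / 5); 32 / tau ^+ 2; 56 / dl ^+ 2; 8 / tau ^+ 2].
have K1 : L.+1%:R <= K by apply: HK; rewrite !inE eqxx ?orbT.
have K2 : expR La <= K by apply: HK; rewrite !inE eqxx ?orbT.
have K3 : L.+1%:R * q / (2 * v) <= K by apply: HK; rewrite !inE eqxx ?orbT.
have K4 : (5 * N0)%:R <= K by apply: HK; rewrite !inE eqxx ?orbT.
have K5 : 2 / (eta / 5) <= K by apply: HK; rewrite !inE eqxx ?orbT.
have K6 : 32 / tau ^+ 2 <= K by apply: HK; rewrite !inE eqxx ?orbT.
have K7 : 56 / dl ^+ 2 <= K by apply: HK; rewrite !inE eqxx ?orbT.
have K8 : 8 / tau ^+ 2 <= K by apply: HK; rewrite !inE eqxx ?orbT.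
clear HK.
exists K => // k n p k_gt0 n_gt0 p_gt0 Kp Kn.
have kR : 0 < k%:R :> R by rewrite ltr0n.
have k1 : 1 <= k%:R :> R by rewrite ler1n.
have pR : 0 < p%:R :> R by rewrite ltr0n.
have nR : 0 < n%:R :> R by rewrite ltr0n.
have pk : K <= p%:R / k%:R by rewrite ler_pdivlMr.
have Kp1 : K <= p%:R by apply: le_trans Kp; rewrite ler_peMr// ltW.
have [Lp LpE] : exists Lp : R, Lp = ln (p%:R / k%:R) by eexists.
have La_Lp : La <= Lp.
  rewrite LpE -[leLHS]expRK ler_ln ?posrE ?expR_gt0 ?divr_gt0//.
  exact: le_trans pk.
have Lp_sigma : 2 <= dl ^+ 2 * sigma ^+ 2 * Lp.
  rewrite mulrC -ler_pdivrMr ?mulr_gt0 ?exprn_gt0//; exact: le_trans La_Lp.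
have Lp0 : 0 < Lp.
  have h : 0 < dl ^+ 2 * sigma ^+ 2 by rewrite mulr_gt0 ?exprn_gt0.
  by rewrite -(pmulr_rgt0 _ h); apply: lt_le_trans Lp_sigma.
have Lp_q : 1 + ln (2 / q) <= dl * Lp.
  rewrite [dl * _]mulrC -ler_pdivrMr//; exact: le_trans La_Lp.
have Lp_ln : Lp <= ln p%:R.
  rewrite LpE ler_ln ?posrE ?divr_gt0// ler_pdivrMr// ler_peMr// ltW//.
have klp0 : 0 < k%:R * ln p%:R :> R := mulr_gt0 kR (lt_le_trans Lp0 Lp_ln).
have scale (a x : R) : 0 < x -> a / x <= K -> a * (k%:R * ln p%:R) <= x * n%:R.
  move=> x0 ax; rewrite mulrC [x * _]mulrC -ler_pdivrMr// -mulrA mulrC.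
  by apply: le_trans Kn; rewrite ler_wpM2r// ltW.
have n_large : 32 * (k%:R * Lp) <= tau ^+ 2 * n%:R.
  apply: le_trans (scale 32 _ (exprn_gt0 2 tau0) K6).
  by rewrite ler_pM2l// ler_pM2l.
have Lkp : (L.+1 * k <= p)%N.
  rewrite -(ler_nat R) natrM; apply: le_trans Kp.
  by rewrite ler_wpM2r// ltW.
have kp : (k <= p)%N by apply: leq_trans Lkp; rewrite leq_pmull.
have p_eta : 2 / p%:R <= eta / 5.
  by rewrite ler_pdivrMr// [leRHS]mulrC -ler_pdivrMr//; exact: le_trans Kp1.
have pV_eta : p%:R^-1 <= eta / 5.
  by apply: le_trans p_eta; rewrite ler_peMl ?invr_ge0 ?(ltW pR)// ler1n.
have rip_le : rip_term k n p N0 dl <= eta / 5.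
  apply: le_trans p_eta; apply: rip_term_le => //.
    rewrite -(ler_nat R); exact: le_trans Kp1.
  have := scale 56 _ (exprn_gt0 2 dl0) K7; lra.
have noise_le : noise_term n tau <= eta / 5.
  have l0 : 0 <= ln p%:R :> R by rewrite ln_ge0// ler1n.
  apply: le_trans (le_trans (expR_lnV k_gt0 p_gt0 l0) pV_eta).
  rewrite /noise_term ler_expR lerN2.
  have := scale 8 _ (exprn_gt0 2 tau0) K8; lra.
have signal_le : signal_term k sigma M dl Lp <= eta / 5.
  rewrite /signal_term.
  have -> : k%:R * (M ^+ 2 * second_moment) / (dl ^+ 2 * (2 * sigma ^+ 2 * k%:R * Lp)) =
      M ^+ 2 * second_moment / (2 * dl ^+ 2 * sigma ^+ 2) / Lp.
    by field; rewrite !gt_eqF.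
  rewrite ler_pdivrMr// [leRHS]mulrC -ler_pdivrMr//; exact: le_trans La_Lp.
have [ell ellE] : exists ell : R, ell = sigma * (1 + 4 * tau) * quantile q p (L.+1 * k).
  by eexists.
have Lk_gt0 : (0 < L.+1 * k)%N by rewrite muln_gt0.
have excess_le : excess_term k p rho0 M ell <= eta / 5.
  have lev0 := level_gt0 q0 p_gt0 Lk_gt0.
  have lev1 := level_lt q0 q1 p_gt0 Lkp.
  have G_ge : Gs <= quantile q p (L.+1 * k).
    apply: quantile_ge => //; rewrite -/v ler_pdivrMr ?mulr_gt0// natrM.
    have h : L.+1%:R * q <= K * (2 * v) by rewrite -ler_pdivrMr ?mulr_gt0.
    have := ler_wpM2r (ltW kR) h.
    have := ler_wpM2r (ltW v0) Kp; lra.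
  have G0 : 0 < quantile q p (L.+1 * k) by apply: lt_le_trans G_ge; apply: lt_le_trans Gs1.
  apply: (@le_trans _ _ (C / quantile q p (L.+1 * k))).
    apply: (excess_small (b := b)) => //.
    - rewrite ellE /b ME; field; rewrite gt_eqF//; lra.
    - exact: le_trans G_ge.
    - exact: le_trans G_ge.
    - exact: (Phi_inv_lower lev0 lev1).
  rewrite ler_pdivrMr// [leRHS]mulrC -ler_pdivrMr//; exact: le_trans G_ge.
have rank_le : rank_term k L q' <= eta / 5.
  rewrite /rank_term -rhoE ler_pdivrMr//; apply: HL0.
  by rewrite (leq_trans (leq_addr L1 L0))// leq_pmulr.
split; first by rewrite -LpE.
move=> d T P X z X_iid z_iid Xz bhat bhat_min beta Sk.
have cE' : c = eps / 3 * sigma * quantile q p p by rewrite quantile_last.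
have [B [mB PB hB]] := risk_event k_gt0 n_gt0 sigma0 eps0 eps1 q0 q1 X_iid z_iid Xz
  bhat_min Sk tauE ME dlE LpE q'E ellE cE' Lkp N0_gt0 N0_dl L_q rho00 rho01 rho0c
  Lp_q Lp_sigma n_large.
exists B; split => //.
  apply: (le_trans PB); rewrite lee_fin; move: rip_le noise_le signal_le excess_le rank_le.
  lra.
by move=> w nB; rewrite -LpE; exact: hB.
Qed.

(** * The limit *)

(** Monotonicity of probability applies to measurable events only, so the passage
    from the exceptional event of [uniform_risk] to the event of the statement
    rests on [fit_measurable]. *)
Lemma measurable_risk d (T : measurableType d) (R : realType) (P : probability T R)
    (n p : nat) (lam : nat -> R)
    (X : 'I_n * 'I_p -> {RV P >-> R}) (z : 'I_n -> {RV P >-> R})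
    (bhat : 'M[R]_(n, p) -> 'cV[R]_n -> 'cV[R]_p) (beta : 'cV[R]_p) :
  noninc (lam \o succn) p -> (forall i, (i < p)%N -> 0 <= lam i.+1) ->
  (forall A y, is_slope_estimate lam A y (bhat A y)) ->
  measurable_fun setT (fun w => enorm
    (design X w *m bhat (design X w) (design X w *m beta + noise z w) -
     design X w *m beta) ^+ 2).
Proof.
move=> dec lam_ge0 bhat_min.
have mA : mx_measurable (design X).
  move=> i j; rewrite (_ : (fun _ => _) = X (i, j))//.
  by apply/funext => w; rewrite mxE.
have mAb : mx_measurable (fun w => design X w *m beta).
  move=> i j; rewrite (_ : (fun _ => _) = (fun w => \sum_l X (i, l) w * beta l j)).
    by apply: measurable_sum => l; exact: measurable_funM.
  by apply/funext => w; rewrite mxE; apply: eq_bigr => l _; rewrite mxE.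
have my : mx_measurable (fun w => design X w *m beta + noise z w).
  move=> i j; rewrite (_ : (fun _ => _) = (fun w => (design X w *m beta) i j + z i w)).
    by apply: measurable_funD => //; exact: mAb.
  by apply/funext => w; rewrite mxE [X in _ + X]mxE.
have mF := fit_measurable dec lam_ge0 bhat_min mA my.
under eq_fun do rewrite enorm_sqr.
apply: measurable_sum => i.
have mi : measurable_fun setT (fun w => (design X w *m
    bhat (design X w) (design X w *m beta + noise z w) - design X w *m beta) i ord0).
  rewrite (_ : (fun _ => _) = (fun w => (design X w *m
    bhat (design X w) (design X w *m beta + noise z w)) i ord0 -
    (design X w *m beta) i ord0)).
    by apply: measurable_funB; [exact: mF|exact: mAb].
  by apply/funext => w; rewrite mxE [X in _ + X]mxE.
exact: measurable_funM.
Qed.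

Unset Implicit Arguments.

Theorem corollary1p4 (R : realType) (q sigma eps : R)
  (q_gt0 : 0 < q) (q_lt1 : q < 1) (sigma_gt0 : 0 < sigma)
  (eps_gt0 : 0 < eps) (eps_lt1 : eps < 1)
  (k n p : nat -> nat)
  (k_gt0 : forall m, (0 < k m)%N) (n_gt0 : forall m, (0 < n m)%N)
  (p_gt0 : forall m, (0 < p m)%N)
  (p_infty : p m @[m --> \oo] --> \oo)
  (kp_to0 : (k m)%:R / (p m)%:R @[m --> \oo] --> (0 : R))
  (klogp_to0 : (k m)%:R * ln (p m)%:R / (n m)%:R @[m --> \oo] --> (0 : R))
  (d : nat -> measure_display) (Omega : forall m, measurableType (d m))
  (P : forall m, probability (Omega m) R)
  (X : forall m, 'I_(n m) * 'I_(p m) -> {RV (P m) >-> R})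
  (z : forall m, 'I_(n m) -> {RV (P m) >-> R})
  (X_iid : forall m, iid_normal 0 (Num.sqrt ((n m)%:R^-1)) (X m))
  (z_iid : forall m, iid_normal 0 sigma (z m))
  (Xz_indep : forall m, independent_families (X m) (z m))
  (bhat : forall m, 'M[R]_(n m, p m) -> 'cV[R]_(n m) -> 'cV[R]_(p m))
  (bhat_slope : forall m (A : 'M[R]_(n m, p m)) (y : 'cV[R]_(n m)),
     is_slope_estimate (slope_weight sigma eps q (p m)) A y (bhat m A y)) :
  ereal_sup [set P m [set w |
      let A := design (X m) w in
      let y := A *m beta + noise (z m) w in
      1 + 3 * eps <
        enorm (A *m bhat m A y - A *m beta) ^+ 2
        / (2 * sigma ^+ 2 * (k m)%:R * ln ((p m)%:R / (k m)%:R))]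
    | beta in [set beta : 'cV[R]_(p m) | (l0 beta <= k m)%N]]
  @[m --> \oo] --> (0 : \bar R)%E.
Proof.
set S := fun m => ereal_sup _.
have S_ge0 m : (0 <= S m)%E.
  apply: (@le_trans _ _ (P m [set w |
      let A := design (X m) w in
      let y := A *m 0 + noise (z m) w in
      1 + 3 * eps <
        enorm (A *m bhat m A y - A *m 0) ^+ 2
        / (2 * sigma ^+ 2 * (k m)%:R * ln ((p m)%:R / (k m)%:R))])); first exact: measure_ge0.
  apply: ereal_sup_ubound; exists 0 => //=.
  rewrite /l0 (_ : [set i | _]%SET = finset.set0) ?cards0//.
  by apply/finset.setP => i; rewrite !inE mxE eqxx.
have S_le eta : 0 < eta -> \forall m \near \oo, (S m <= eta%:E)%E.
  move=> eta0.
  have [K K0 HK] := uniform_risk sigma_gt0 eps_gt0 eps_lt1 q_gt0 q_lt1 eta0.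
  have KV : 0 < K^-1 by rewrite invr_gt0.
  move/cvgrPdist_le : kp_to0 => /(_ _ KV) kp_near.
  move/cvgrPdist_le : klogp_to0 => /(_ _ KV) kn_near.
  near=> m.
  have pR : 0 < (p m)%:R :> R by rewrite ltr0n.
  have nR : 0 < (n m)%:R :> R by rewrite ltr0n.
  have kR : 0 < (k m)%:R :> R by rewrite ltr0n.
  have Kp : K * (k m)%:R <= (p m)%:R.
    have : `|0 - (k m)%:R / (p m)%:R| <= K^-1 by near: m.
    rewrite sub0r normrN => /(le_trans (ler_norm _)).
    by rewrite ler_pdivrMr// mulrC ler_pdivlMr// mulrC.
  have Kn : K * ((k m)%:R * ln (p m)%:R) <= (n m)%:R.
    have : `|0 - (k m)%:R * ln (p m)%:R / (n m)%:R| <= K^-1 by near: m.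
    rewrite sub0r normrN => /(le_trans (ler_norm _)).
    by rewrite ler_pdivrMr// [leRHS]mulrC ler_pdivlMr// [leLHS]mulrC.
  have [Lp0 risk] := HK _ _ _ (k_gt0 m) (n_gt0 m) (p_gt0 m) Kp Kn.
  apply: ge_ereal_sup => _ [beta /= beta_k <-].
  have [B [mB PB hB]] := risk _ _ _ _ _ (X_iid m) (z_iid m) (Xz_indep m) _ (bhat_slope m)
    beta beta_k.
  have den0 : 0 < 2 * sigma ^+ 2 * (k m)%:R * ln ((p m)%:R / (k m)%:R).
    by rewrite !mulr_gt0// exprn_gt0.
  apply: le_trans PB; apply: le_measure; rewrite ?inE//.
    have mf := measurable_risk (X m) (z m) beta
      (slope_weight_noninc sigma_gt0 eps_gt0 q_gt0 q_lt1 (p_gt0 m))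
      (slope_weight_ge0 sigma_gt0 eps_gt0 q_gt0 q_lt1 (p_gt0 m)) (bhat_slope m).
    have mg : measurable_fun setT (fun w => enorm
      (design (X m) w *m bhat m (design (X m) w) (design (X m) w *m beta + noise (z m) w) -
       design (X m) w *m beta) ^+ 2 /
      (2 * sigma ^+ 2 * (k m)%:R * ln ((p m)%:R / (k m)%:R))).
      exact: measurable_funM.
    rewrite -[X in measurable X]setTI.
    set f := (fun w => _ / _) in mg.
    rewrite (_ : [set w | _] = f @^-1` `]1 + 3 * eps, +oo[); first exact: mg.
    by apply/seteqP; split => w; rewrite /= in_itv/= andbT.
  move=> w /=; apply: contraPP => /hB h; apply/negP; rewrite -leNgt.
  by rewrite ler_pdivrMr.
have S_fin eta m : (S m <= eta%:E)%E -> S m \is a fin_num.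
  by move=> h; rewrite ge0_fin_numE// (le_lt_trans h)// ltry.
apply/fine_cvgP; split.
  (* the bound by 1 only serves to exclude infinite suprema *)
  near=> m; apply: (S_fin 1); near: m; exact: S_le.
apply/cvgrPdist_le => eta eta0; near=> m.
have S_m : (S m <= eta%:E)%E by near: m; exact: S_le.
rewrite sub0r normrN /= ger0_norm ?fine_ge0//.
by rewrite -lee_fin fineK// (S_fin eta).
Unshelve. all: by end_near. Qed.
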